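(* Let $\mathcal{F}$ be a foliation on a manifold $M$ endowed with a transverse generalized complex structure $\mathcal{J}$. Then $\mathcal{F}$ satisfies the basic $dd^{\mathcal{J}}$-lemma if and only if the inclusion $$i:(\mathrm{Ker}(d^{\mathcal{J}}),d)\rightarrow(\Omega^{\bullet}(M/\mathcal{F},\mathbb{C}),d)$$ induces an isomorphism in cohomology.
   Context: Foliations. $M$ is a smooth $n$-manifold with a foliation $\mathcal{F}$ of dimension $n-2q$ (codimension $2q$), given by an open cover $\{V_i\}_{i\in I}$ of $M$, a $2q$-dimensional smooth manifold $T_0$, submersions $f_i:V_i\to T_0$ with connected fibres, and, whenever $V_i\cap V_j\neq\emptyset$, a local diffeomorphism $\gamma_{ij}$ of $T_0$ with $f_j=\gamma_{ij}\circ f_i$. The transverse manifold is $T=\coprod_i f_i(V_i)$, and the holonomy pseudogroup $\mathcal{H}$ is the pseudogroup on $T$ generated by the $\gamma_{ij}$. A form $\omega$ on $M$ is basic if $i_X\omega=i_Xd\omega=0$ for all vector fields $X$ tangent to the leaves. Basic forms correspond bijectively to $\mathcal{H}$-invariant forms on $T$. $\Omega^\bullet(M/\mathcal{F},\mathbb{C})$ denotes the complex-valued basic forms, a subcomplex of the de Rham complex. Generalized complex structures. On $T$, the bundle $TT\oplus T^*T$ carries the pairing $(X_1+\alpha_1,X_2+\alpha_2)=\frac12(\alpha_1(X_2)+\alpha_2(X_1))$ and the Courant bracket $$[X_1+\alpha_1,X_2+\alpha_2]=[X_1,X_2]+i_{X_1}d\alpha_2-i_{X_2}d\alpha_1+\tfrac12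 d(\alpha_2(X_1)-\alpha_1(X_2)).$$ A generalized complex structure on $T$ is an almost complex structure $\mathcal{J}$ on the bundle $TT\oplus T^*T$, orthogonal for the pairing, such that $[\mathcal{J}Y_1,\mathcal{J}Y_2]-\mathcal{J}[Y_1,\mathcal{J}Y_2]-\mathcal{J}[\mathcal{J}Y_1,Y_2]+\mathcal{J}^2[Y_1,Y_2]=0$ for all sections $Y_1,Y_2$. A transverse generalized complex structure on $(M,\mathcal{F})$ is a generalized complex structure on $T$ invariant under $\mathcal{H}$. The operators. Let $L\subset(TT\oplus T^*T)\otimes\mathbb{C}$ be the $i$-eigenbundle of $\mathcal{J}$. The Clifford algebra of $(TT\oplus T^*T)\otimes\mathbb{C}$ acts on forms by $(X+\alpha)\bullet\beta=i_X\beta+\alpha\wedge\beta$. There is a unique complex line subbundle $\Phi$ of $\bigoplus_i\wedge^iT^*T\otimes\mathbb{C}$ with $L_x=\{v\in(T_xT\oplus T_x^*T)\otimes\mathbb{C}\mid v\bullet\Phi_x=0\}$ for all $x\in T$. Set $U^{q-k}_x=(\wedge^k\bar L_x)\bullet\Phi_x$ for $0\le k\le 2q$. Then $\bigoplus_i\wedge^iT^*T\otimes\mathbb{C}=\bigoplus_{j=-q}^{q}U^j$, and integrability of $\mathcal{J}$ gives $d=\partial+\bar\partial$ with $\partial:\Gamma(U^j)\to\Gamma(U^{j+1})$ and $\bar\partial:\Gamma(U^j)\to\Gamma(U^{j-1})$. The bundles $U^j$ are $\mathcal{H}$-invariant, so $\partial$ and $\bar\partial$ preserve $\mathcal{H}$-invariant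 forms and hence act on basic forms. Define $d^{\mathcal{J}}=i(\bar\partial-\partial)$. All of $d,d^{\mathcal{J}},\partial,\bar\partial$, and their kernels and images, are taken on $\Omega^\bullet(M/\mathcal{F},\mathbb{C})$. The basic $dd^{\mathcal{J}}$-lemma. $\mathcal{F}$ satisfies the basic $dd^{\mathcal{J}}$-lemma if $$\mathrm{Im}(dd^{\mathcal{J}})=\mathrm{Im}(d)\cap\mathrm{Ker}(d^{\mathcal{J}})=\mathrm{Ker}(d)\cap\mathrm{Im}(d^{\mathcal{J}}).$$ *)

(* Defs.v *)
From HB Require Import structures.
From mathcomp Require Import all_boot all_order all_algebra.
From mathcomp Require Import complex.
From mathcomp Require Import all_classical all_reals all_analysis.

Set Implicit Arguments.
Unset Strict Implicit.
Unset Printing Implicit Defensive.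

Import Order.TTheory GRing.Theory Num.Theory.
Import numFieldNormedType.Exports.

Local Open Scope classical_set_scope.
Local Open Scope ring_scope.

(** * Smooth functions between normed spaces *)

Fixpoint Cn (R : realType) (U V : normedModType R) (n : nat)
    (O : set U) (g : U -> V) : Prop :=
  if n is n'.+1 then
    (forall x, O x -> differentiable g x) /\
    (forall v, Cn n' O (fun x => 'D_v g x))
  else forall x, O x -> {for x, continuous g}.

Definition smooth_on (R : realType) (U V : normedModType R)
    (O : set U) (g : U -> V) : Prop := forall n, Cn n O g.

Definition csmooth_on (R : realType) (U : normedModType R)
    (O : set U) (g : U -> R[i]) : Prop :=
  smooth_on O (fun x => complex.Re (g x) : R^o) /\
  smooth_on O (fun x => complex.Im (g x) : R^o).

Definition cderive (R : realType) (U : normedModType R)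
    (g : U -> R[i]) (x v : U) : R[i] :=
  Complex ('D_v (fun y => complex.Re (g y) : R^o) x)
          ('D_v (fun y => complex.Im (g y) : R^o) x).

(** * Smooth manifolds *)

(* [coord] is only meaningful on [dom], and [point], its inverse, only on
   [coord @` dom]. *)
Record chart (R : realType) (m : nat) (X : Type) := Chart {
  dom : set X;
  coord : X -> 'rV[R]_m;
  point : 'rV[R]_m -> X
}.

Definition topological_chart (R : realType) (m : nat) (X : topologicalType)
    (c : chart R m X) : Prop :=
  [/\ open (dom c),
      open (coord c @` dom c),
      forall p, dom c p -> point c (coord c p) = p,
      forall p, dom c p -> {for p, continuous (coord c)} &
      forall x, (coord c @` dom c) x -> {for x, continuous (point c)}].

Definition compatible (R : realType) (m : nat) (X : Type)
    (c c' : chart R m X) : Prop :=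
  smooth_on (coord c @` (dom c `&` dom c')) (coord c' \o point c) /\
  smooth_on (coord c' @` (dom c `&` dom c')) (coord c \o point c').

(* The atlas is maximal. The choice of a preferred chart [chart_at p] at every
   point [p] serves to identify the tangent space at [p] with 'rV[R]_m. *)
Record manifold (R : realType) (m : nat) := Manifold {
  carrier :> topologicalType;
  atlas : set (chart R m carrier);
  chart_at : carrier -> chart R m carrier;
  manifold_hausdorff : hausdorff_space carrier;
  manifold_second_countable : @second_countable carrier;
  atlasP : forall c, atlas c <->
    topological_chart c /\ forall c', atlas c' -> compatible c c';
  chart_at_atlas : forall p, atlas (chart_at p);
  chart_at_dom : forall p, dom (chart_at p) p
}.

Definition smooth_map (R : realType) (m n : nat)
    (M : manifold R m) (N : manifold R n) (O : set M) (f : M -> N) : Prop :=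
  (forall p, O p -> {for p, continuous f}) /\
  forall c c', atlas c -> atlas c' ->
    smooth_on (coord c @` (dom c `&` O `&` f @^-1` dom c'))
              (coord c' \o f \o point c).

(* The differential at [p], acting on row vectors on the right, with respect
   to the preferred charts at [p] and [f p]. *)
Definition tangent_map (R : realType) (m n : nat)
    (M : manifold R m) (N : manifold R n) (f : M -> N) (p : M) : 'M[R]_(m, n) :=
  jacobian (coord (chart_at (f p)) \o f \o point (chart_at p))
           (coord (chart_at p) p).

(* The change of coordinates on the tangent space at [p], from the chart [c]
   to the preferred chart at [p]. *)
Definition to_pref (R : realType) (m : nat) (M : manifold R m)
    (c : chart R m M) (p : M) : 'M[R]_m :=
  jacobian (coord (chart_at p) \o point c) (coord c p).

Definition local_diffeo (R : realType) (m : nat) (N : manifold R m)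
    (O : set N) (h : N -> N) : Prop :=
  [/\ open O, open (h @` O), smooth_map O h &
      exists2 h' : N -> N, smooth_map (h @` O) h' &
        forall y, O y -> h' (h y) = y].

(* Submersions in the sense of Lang: in suitable charts around each point the
   map is a projection onto the first coordinates. *)
Definition submersion_on (R : realType) (m l : nat)
    (M : manifold R (m + l)) (N : manifold R m) (O : set M) (f : M -> N) : Prop :=
  forall p, O p -> exists c c',
    [/\ atlas c, atlas c', dom c p, dom c `<=` O &
        forall x, dom c x -> dom c' (f x) /\ coord c' (f x) = lsubmx (coord c x)].

(** * Complex differential forms *)

(* An element of the full complexified exterior algebra of the dual of
   'rV[R]_m is a function on lists of vectors, its restriction to lists of
   length k being the component of degree k. *)
Definition alternating (R : realType) (m : nat)
    (b : seq 'rV[R]_m -> R[i]) : Prop :=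
  (forall s1 s2 (a : R) u v,
     b (s1 ++ (a *: u + v) :: s2) =
     (a%:C)%C * b (s1 ++ u :: s2) + b (s1 ++ v :: s2)) /\
  (forall s1 s2 s3 u, b (s1 ++ u :: s2 ++ u :: s3) = 0).

Definition pull_alt (R : realType) (m n : nat) (A : 'M[R]_(m, n))
    (b : seq 'rV[R]_n -> R[i]) : seq 'rV[R]_m -> R[i] :=
  fun s => b [seq v *m A | v <- s].

Definition delete (T : Type) (i : nat) (s : seq T) : seq T :=
  take i s ++ drop i.+1 s.

(* A form on [M] is given by its values at each [p : M], expressed in the
   preferred chart at [p]; [local_form w c] is its expression in the chart [c]. *)
Definition local_form (R : realType) (m : nat) (M : manifold R m)
    (w : M -> seq 'rV[R]_m -> R[i]) (c : chart R m M) (x : 'rV[R]_m) :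
    seq 'rV[R]_m -> R[i] :=
  pull_alt (to_pref c (point c x)) (w (point c x)).

Definition smooth_form (R : realType) (m : nat) (M : manifold R m)
    (O : set M) (w : M -> seq 'rV[R]_m -> R[i]) : Prop :=
  (forall p, O p -> alternating (w p)) /\
  (forall c s, atlas c ->
     csmooth_on (coord c @` (dom c `&` O)) (fun x => local_form w c x s)).

Definition local_ext_d (R : realType) (m : nat)
    (w : 'rV[R]_m -> seq 'rV[R]_m -> R[i]) (x : 'rV[R]_m) :
    seq 'rV[R]_m -> R[i] :=
  fun s => \sum_(i < size s)
    (-1) ^+ i * cderive (fun y => w y (delete i s)) x (nth 0 s i).

Definition ext_d (R : realType) (m : nat) (M : manifold R m)
    (w : M -> seq 'rV[R]_m -> R[i]) : M -> seq 'rV[R]_m -> R[i] :=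
  fun p => local_ext_d (local_form w (chart_at p)) (coord (chart_at p) p).

(** * The bundle TT + T*T *)

(* The fibre is 'rV_(m + m): [row_mx X a] stands for X + a, the covector [a]
   being paired with [X] by a *m X^T. *)

Definition covec (F : comPzRingType) (m : nat) (a X : 'rV[F]_m) : F :=
  (a *m X^T) 0 0.

Definition pairing (R : realType) (m : nat) (v w : 'rV[R]_(m + m)) : R :=
  2^-1 * (covec (rsubmx v) (lsubmx w) + covec (rsubmx w) (lsubmx v)).

(* The action on TT + T*T of an isomorphism [A] of tangent spaces. *)
Definition gen_push (R : realType) (m : nat) (A : 'M[R]_m) : 'M[R]_(m + m) :=
  block_mx A 0 0 (invmx A)^T.

Definition local_endo (R : realType) (m : nat) (N : manifold R m)
    (J : N -> 'M[R]_(m + m)) (c : chart R m N) (x : 'rV[R]_m) : 'M[R]_(m + m) :=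
  let P := gen_push (to_pref c (point c x)) in
  P *m J (point c x) *m invmx P.

Definition local_section (R : realType) (m : nat) (N : manifold R m)
    (Y : N -> 'rV[R]_(m + m)) (c : chart R m N) (x : 'rV[R]_m) :
    'rV[R]_(m + m) :=
  Y (point c x) *m invmx (gen_push (to_pref c (point c x))).

Definition smooth_section (R : realType) (m : nat) (N : manifold R m)
    (W : set N) (Y : N -> 'rV[R]_(m + m)) : Prop :=
  forall c, atlas c -> smooth_on (coord c @` (dom c `&` W)) (local_section Y c).

(* i_X da *)
Definition contract_d (R : realType) (m : nat)
    (X a : 'rV[R]_m -> 'rV[R]_m) (x : 'rV[R]_m) : 'rV[R]_m :=
  'D_(X x) a x -
  \row_k 'D_(delta_mx 0 k) (fun y => covec (a y) (X x) : R^o) x.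

Definition local_courant (R : realType) (m : nat)
    (Y1 Y2 : 'rV[R]_m -> 'rV[R]_(m + m)) (x : 'rV[R]_m) : 'rV[R]_(m + m) :=
  let X1 := fun y => lsubmx (Y1 y) in let a1 := fun y => rsubmx (Y1 y) in
  let X2 := fun y => lsubmx (Y2 y) in let a2 := fun y => rsubmx (Y2 y) in
  row_mx
    ('D_(X1 x) X2 x - 'D_(X2 x) X1 x)
    (contract_d X1 a2 x - contract_d X2 a1 x +
     2^-1 *: \row_k 'D_(delta_mx 0 k)
       (fun y => covec (a2 y) (X1 y) - covec (a1 y) (X2 y) : R^o) x).

Definition courant (R : realType) (m : nat) (N : manifold R m)
    (Y1 Y2 : N -> 'rV[R]_(m + m)) (p : N) : 'rV[R]_(m + m) :=
  local_courant (local_section Y1 (chart_at p)) (local_section Y2 (chart_at p))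
                (coord (chart_at p) p).

(* A generalized complex structure over the open set [O]; sections are taken
   over arbitrary open subsets of [O]. *)
Definition gen_complex (R : realType) (m : nat) (N : manifold R m)
    (O : set N) (J : N -> 'M[R]_(m + m)) : Prop :=
  [/\ forall c, atlas c -> smooth_on (coord c @` (dom c `&` O)) (local_endo J c),
      forall p, O p -> J p *m J p = - 1%:M,
      forall p v w, O p -> pairing (v *m J p) (w *m J p) = pairing v w &
      forall (W : set N) (Y1 Y2 : N -> 'rV[R]_(m + m)),
        open W -> W `<=` O -> smooth_section W Y1 -> smooth_section W Y2 ->
        let JY1 := fun p => Y1 p *m J p in
        let JY2 := fun p => Y2 p *m J p in
        forall p, W p ->
          courant JY1 JY2 p - courant Y1 JY2 p *m J p - courant JY1 Y2 p *m J p
          + courant Y1 Y2 p *m J p *m J p = 0].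

(** * Spinors *)

Definition in_L (R : realType) (m : nat) (J : 'M[R]_(m + m))
    (v : 'rV[R[i]]_(m + m)) : Prop :=
  v *m map_mx (real_complex R) J = ('i)%C *: v.

Definition in_Lbar (R : realType) (m : nat) (J : 'M[R]_(m + m))
    (v : 'rV[R[i]]_(m + m)) : Prop := in_L J (map_mx (@conjc R) v).

Definition contract (R : realType) (m : nat) (X : 'rV[R[i]]_m)
    (b : seq 'rV[R]_m -> R[i]) : seq 'rV[R]_m -> R[i] :=
  fun s => b (map_mx (@complex.Re R) X :: s) +
           ('i)%C * b (map_mx (@complex.Im R) X :: s).

Definition wedge1 (R : realType) (m : nat) (a : 'rV[R[i]]_m)
    (b : seq 'rV[R]_m -> R[i]) : seq 'rV[R]_m -> R[i] :=
  fun s => \sum_(i < size s)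
    (-1) ^+ i * covec a (map_mx (real_complex R) (nth 0 s i)) * b (delete i s).

Definition clifford (R : realType) (m : nat) (v : 'rV[R[i]]_(m + m))
    (b : seq 'rV[R]_m -> R[i]) : seq 'rV[R]_m -> R[i] :=
  fun s => contract (lsubmx v) b s + wedge1 (rsubmx v) b s.

(* [phi] spans the line Phi_x. *)
Definition spans_Phi (R : realType) (m : nat) (J : 'M[R]_(m + m))
    (phi : seq 'rV[R]_m -> R[i]) : Prop :=
  [/\ alternating phi, phi <> (fun=> 0) &
      forall v, in_L J v <-> clifford v phi = (fun=> 0)].

(* With m = 2q, [spin J k] is the fibre of U^{q-k}, for 0 <= k <= 2q. *)
Definition spin (R : realType) (m : nat) (J : 'M[R]_(m + m)) (k : nat) :
    set (seq 'rV[R]_m -> R[i]) :=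
  [set b | exists (n : nat) (vs : 'I_n -> seq 'rV[R[i]]_(m + m))
                  (phi : 'I_n -> seq 'rV[R]_m -> R[i]),
    [/\ forall j, size (vs j) = k,
        forall j v, v \in vs j -> in_Lbar J v,
        forall j, spans_Phi J (phi j) &
        forall s, b s = \sum_j foldr (@clifford R m) (phi j) (vs j) s]].

Definition spin_decomposition (R : realType) (m : nat) (J : 'M[R]_(m + m))
    (b : seq 'rV[R]_m -> R[i]) (e : nat -> seq 'rV[R]_m -> R[i]) : Prop :=
  (forall k, (k <= m)%N -> spin J k (e k)) /\
  (forall s, b s = \sum_(k < m.+1) e k s).

(* The component of [b] in [spin J k]. *)
Definition spin_proj (R : realType) (m : nat) (J : 'M[R]_(m + m)) (k : nat)
    (b : seq 'rV[R]_m -> R[i]) : seq 'rV[R]_m -> R[i] :=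
  if pselect (exists e, spin_decomposition J b e) is left ex
  then projT1 (cid ex) k else fun=> 0.

(* The components of d from U^j to U^{j+1} and to U^{j-1} respectively. *)
Definition del (R : realType) (m : nat) (N : manifold R m)
    (J : N -> 'M[R]_(m + m)) (w : N -> seq 'rV[R]_m -> R[i]) :
    N -> seq 'rV[R]_m -> R[i] :=
  fun p s => \sum_(k < m)
    spin_proj (J p) k (ext_d (fun x => spin_proj (J x) k.+1 (w x)) p) s.

Definition delbar (R : realType) (m : nat) (N : manifold R m)
    (J : N -> 'M[R]_(m + m)) (w : N -> seq 'rV[R]_m -> R[i]) :
    N -> seq 'rV[R]_m -> R[i] :=
  fun p s => \sum_(k < m)
    spin_proj (J p) k.+1 (ext_d (fun x => spin_proj (J x) k (w x)) p) s.

(** * Foliations *)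

(* A foliation of codimension m with l-dimensional leaves. *)
Record foliation (R : realType) (m l : nat) (M : manifold R (m + l)) := Foliation {
  fol_T0 : manifold R m;
  fol_I : Type;
  fol_V : fol_I -> set M;
  fol_f : fol_I -> M -> fol_T0;
  fol_gamma : fol_I -> fol_I -> fol_T0 -> fol_T0;
  fol_open : forall i, open (fol_V i);
  fol_cover : forall p, exists i, fol_V i p;
  fol_submersion : forall i, submersion_on (fol_V i) (fol_f i);
  fol_fibres : forall i y, connected (fol_V i `&` fol_f i @^-1` [set y]);
  fol_gamma_diffeo : forall i j, fol_V i `&` fol_V j !=set0 ->
    local_diffeo (fol_f i @` (fol_V i `&` fol_V j)) (fol_gamma i j);
  fol_gammaE : forall i j p, fol_V i p -> fol_V j p ->
    fol_f j p = fol_gamma i j (fol_f i p)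
}.

(* Functions, forms... on the transverse manifold T, the disjoint union of the
   f_i(V_i), are families indexed by [i] of such objects on the open subset
   f_i(V_i) of T_0; their values outside f_i(V_i) are irrelevant. *)
Definition transversal (R : realType) (m l : nat) (M : manifold R (m + l))
    (F : foliation M) (i : fol_I F) : set (fol_T0 F) := fol_f i @` fol_V i.

(* [holonomy i j O h]: the map [h] from the open subset [O] of f_i(V_i) to
   f_j(V_j) belongs to the pseudogroup generated by the gamma_ij. *)
Inductive holonomy (R : realType) (m l : nat) (M : manifold R (m + l))
    (F : foliation M) :
    fol_I F -> fol_I F -> set (fol_T0 F) -> (fol_T0 F -> fol_T0 F) -> Prop :=
| hol_gen i j : fol_V i `&` fol_V j !=set0 ->
    holonomy i j (fol_f i @` (fol_V i `&` fol_V j)) (fol_gamma i j)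
| hol_id i : holonomy i i (transversal i) id
| hol_comp i j k O O' h h' :
    holonomy i j O h -> holonomy j k O' h' ->
    holonomy i k (O `&` h @^-1` O') (h' \o h)
| hol_inv i j O h h' :
    holonomy i j O h -> (forall y, O y -> h' (h y) = y) ->
    holonomy j i (h @` O) h'
| hol_local i j O h (O_ : fol_T0 F -> set (fol_T0 F))
    (h_ : fol_T0 F -> fol_T0 F -> fol_T0 F) :
    open O -> set_inj O h ->
    (forall y, O y -> holonomy i j (O_ y) (h_ y)) ->
    (forall y, O y -> O_ y y) ->
    (forall y z, O y -> O z -> O_ y z -> h z = h_ y z) ->
    holonomy i j O h.

Definition transverse_gen_complex (R : realType) (m l : nat)
    (M : manifold R (m + l)) (F : foliation M)
    (J : fol_I F -> fol_T0 F -> 'M[R]_(m + m)) : Prop :=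
  (forall i, gen_complex (transversal i) (J i)) /\
  (forall i j O h, holonomy i j O h -> forall y, O y ->
     let P := gen_push (tangent_map h y) in J i y *m P = P *m J j (h y)).

(** * Basic forms *)

Definition smooth_vfield (R : realType) (m : nat) (M : manifold R m)
    (W : set M) (X : M -> 'rV[R]_m) : Prop :=
  forall c, atlas c -> smooth_on (coord c @` (dom c `&` W))
    (fun x => X (point c x) *m invmx (to_pref c (point c x))).

Definition tangent_to_leaves (R : realType) (m l : nat)
    (M : manifold R (m + l)) (F : foliation M) (W : set M)
    (X : M -> 'rV[R]_(m + l)) : Prop :=
  forall p (i : fol_I F), W p -> fol_V i p -> X p *m tangent_map (fol_f i) p = 0.

(* Vector fields are taken over arbitrary open subsets of [M]. *)
Definition basic (R : realType) (m l : nat)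
    (M : manifold R (m + l)) (F : foliation M) :
    set (M -> seq 'rV[R]_(m + l) -> R[i]) :=
  [set w | smooth_form [set: M] w /\
    forall (W : set M) (X : M -> 'rV[R]_(m + l)),
      open W -> smooth_vfield W X -> tangent_to_leaves F W X ->
      forall p s, W p -> w p (X p :: s) = 0 /\ ext_d w p (X p :: s) = 0].

Definition invariant_form (R : realType) (m l : nat)
    (M : manifold R (m + l)) (F : foliation M)
    (w : fol_I F -> fol_T0 F -> seq 'rV[R]_m -> R[i]) : Prop :=
  (forall i, smooth_form (transversal i) (w i)) /\
  (forall i j O h, holonomy i j O h -> forall y, O y ->
     pull_alt (tangent_map h y) (w j (h y)) = w i y).

(* The form on [M] given by f_i^* w_i on V_i; for an invariant [w] the choice
   of [i] at each point is immaterial. *)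
Definition to_basic (R : realType) (m l : nat)
    (M : manifold R (m + l)) (F : foliation M)
    (w : fol_I F -> fol_T0 F -> seq 'rV[R]_m -> R[i]) :
    M -> seq 'rV[R]_(m + l) -> R[i] :=
  fun p => let i := projT1 (cid (fol_cover F p)) in
    pull_alt (tangent_map (fol_f i) p) (w i (fol_f i p)).

Definition of_basic (R : realType) (m l : nat)
    (M : manifold R (m + l)) (F : foliation M)
    (w : M -> seq 'rV[R]_(m + l) -> R[i]) :
    fol_I F -> fol_T0 F -> seq 'rV[R]_m -> R[i] :=
  if pselect (exists w', invariant_form w' /\ to_basic w' = w) is left ex
  then projT1 (cid ex) else fun _ _ _ => 0.

Definition dJ (R : realType) (m l : nat)
    (M : manifold R (m + l)) (F : foliation M)
    (J : fol_I F -> fol_T0 F -> 'M[R]_(m + m))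
    (w : M -> seq 'rV[R]_(m + l) -> R[i]) : M -> seq 'rV[R]_(m + l) -> R[i] :=
  to_basic (F := F) (fun i y s =>
    ('i)%C * (delbar (J i) (of_basic w i) y s - del (J i) (of_basic w i) y s)).

Definition ker_dJ (R : realType) (m l : nat)
    (M : manifold R (m + l)) (F : foliation M)
    (J : fol_I F -> fol_T0 F -> 'M[R]_(m + m)) :
    set (M -> seq 'rV[R]_(m + l) -> R[i]) :=
  [set w | basic F w /\ dJ J w = 0].

Definition ker_d (R : realType) (m l : nat)
    (M : manifold R (m + l)) (F : foliation M) :
    set (M -> seq 'rV[R]_(m + l) -> R[i]) :=
  [set w | basic F w /\ ext_d w = 0].

Definition ddJ_lemma (R : realType) (m l : nat)
    (M : manifold R (m + l)) (F : foliation M)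
    (J : fol_I F -> fol_T0 F -> 'M[R]_(m + m)) : Prop :=
  [set ext_d (dJ J w) | w in basic F] = [set ext_d w | w in basic F] `&` ker_dJ J /\
  [set ext_d w | w in basic F] `&` ker_dJ J = ker_d F `&` [set dJ J w | w in basic F].

(** * Cohomology of subcomplexes *)

(* [A] is a subspace of [V] stable under the differential [d]; the elements of
   the quotient (A /\ Ker d) / d A are represented by cosets. *)
Definition add_exact (V : zmodType) (d : V -> V) (A C : set V) : set V :=
  [set c + d e | c in C & e in A].

Definition cohomology (V : zmodType) (d : V -> V) (A : set V) : set (set V) :=
  [set add_exact d A [set a] | a in A `&` [set a | d a = 0]].

(* The map induced by the inclusion of [A] in [B] sends a coset C of d A to the
   coset C + d B; it is additive, so it is an isomorphism iff it is bijective. *)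
Definition inclusion_quasi_iso (V : zmodType) (d : V -> V) (A B : set V) : Prop :=
  set_bij (cohomology d A) (cohomology d B) (add_exact d B).

(* Main.v *)
(** The transverse spinor decomposition gives projections [P_k] (k = 0, ..., 2q) on basic
    forms, and integrability says that [d] changes [k] by exactly one: [d = D+ + D-].
    Conjugating [d] by [sum_k z^k P_k] yields [z D+ + z^-1 D-], which therefore squares to
    zero for all [z <> 0]; hence [D+^2 = D-^2 = D+ D- + D- D+ = 0], so [d] and [dJ]
    anticommute, and [T = sum_k i^k P_k] satisfies [T d = dJ T] and [T dJ = - d T].

    If the ddJ-lemma holds and [a] is closed, then [dJ a = d dJ e] for some [e], and [a + d e]
    is a representative of [a] in [Ker dJ]; likewise [a = d b] in [Ker dJ] is [d (dJ e)].
    Conversely, conjugating surjectivity by [T] writes every [c] in [Ker dJ] as [c' + dJ e]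
    with [d c' = 0]; an exact [a] in [Ker dJ] is [d c] with [c] in [Ker dJ] by injectivity,
    so [a = d (dJ e)], and the second equality of the lemma follows by conjugation.

    That [d] changes [k] by one is proved in a chart.  [P_k] is the projection on the
    [k]-eigenspace of a number operator built from the Clifford action of [L] and its
    conjugate.  A form killed by all [r]-fold products of sections of [L] has a differential
    killed by all [(r+1)]-fold ones, because [[[d, l1], l2]] is the Clifford action of the
    Courant bracket of [l1] and [l2], again in [L]; so [d] raises [k] by at most one, and
    lowers it by at most one by the same argument for [-J].  The case of an unchanged [k]
    is excluded by parity: [sum_k (-1)^k P_k] is, by Schur's lemma, the sign operator of the
    degree up to a constant [c] with [c^2 = 1], hence anticommutes with [d].

    A basic form is locally constant along the fibres of each submersion [f_i] by Cartan's
    formula, so it descends to the transversals because the fibres are connected. *)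
From mathcomp Require Import all_boot all_order all_algebra.
From mathcomp Require Import complex.
From mathcomp Require Import all_classical all_reals all_analysis.
From mathcomp Require Import ring.
Require Import Defs.

Set Implicit Arguments.
Unset Strict Implicit.
Unset Printing Implicit Defensive.

Import Order.TTheory GRing.Theory Num.Theory.
Import numFieldNormedType.Exports.

Local Open Scope classical_set_scope.
Local Open Scope ring_scope.


(** * Calculus on open subsets of normed spaces *)

(** Two features of the setting shape the proof. The projections [spin_proj] and the passage
    [of_basic] to the transversals are defined by choice, so that neither their linearity nor their
    smoothness is visible. Explicit constructions take over: a Lagrange polynomial in the number
    operator for the former, descent along the submersions for the existence behind the latter.
    Moreover forms have mixed degree: they are functions on lists of vectors. Contraction with a
    vector is then prepending it to the list, and identities are proved by induction on the list,
    from the value at [[::]] and the behaviour under contraction; no sum over permutations occurs.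

    The choice of [i] in T is what relates the two halves of the lemma: at this value the conjugate
    of [d] is [dJ], and conjugating once more gives [- d], so T exchanges the kernels and images of
    the two operators. Since [spin J k] stands for U^{q-k}, increasing [k] is delbar and decreasing
    it is del. *)

Section RealCalculus.
Variable R : realType.
Implicit Types U V : normedModType R.

(** The first order expansion of [f] at [x] is also one of [g], as the remainders agree near the
    point; uniqueness of the differential then identifies the two differentials. *)
Lemma near_differentiable U V (f g : U -> V) x :
  {near x, f =1 g} -> differentiable f x -> differentiable g x.
Proof.
move=> fg df.
have /diff_locallyP[cf /eqaddoP ef] := df.
have gx : g x = f x by rewrite (nbhs_singleton fg).
have eg : g \o shift x = cst (g x) + 'd f x +o_ 0 id.
  have A : \forall h \near 0, f (h + x) = g (h + x).
    have := fg; rewrite (near_shift 0 x).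
    by apply: filterS => h /=; rewrite subr0.
  apply/eqaddoP => e e0; near=> h.
  have E : f (h + x) = g (h + x) by near: h.
  have -> : (g \o shift x - (cst (g x) + 'd f x)) h =
            (f \o shift x - (cst (f x) + 'd f x)) h by rewrite !fctE /= E gx.
  by near: h; exact: ef.
apply/diff_locallyP.
by rewrite (diff_unique cf eg).
Unshelve. all: by end_near. Qed.

(** The set in [Cn] only says where conditions are imposed; derivatives are taken in the whole
    space. Regularity is therefore a conjunction over points, even on a set that is not open. *)
Lemma Cn_pointwise U V n (O : set U) (g : U -> V) :
  Cn n O g <-> forall x, O x -> Cn n [set x] g.
Proof.
elim: n g => [|n IH] g /=.
  by split=> [h x Ox y ->|h x Ox]; [exact: h|exact: (h x Ox)].
split=> [[h1 h2] x Ox|h].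
  split=> [y ->|v]; first exact: h1.
  by move: (h2 v) => /IH; exact.
split=> [x Ox|v]; first exact: (h x Ox).1.
by apply/IH => x Ox; exact: (h x Ox).2.
Qed.

Lemma Cn_subset U V n (O O' : set U) (g : U -> V) :
  O' `<=` O -> Cn n O g -> Cn n O' g.
Proof.
by move=> s /Cn_pointwise h; apply/Cn_pointwise => x /s; exact: h.
Qed.

(** Openness makes the two functions agree near each point of [O], hence have the same derivatives
    there. *)
Lemma Cn_eq U V n (O : set U) (f g : U -> V) :
  open O -> (forall x, O x -> f x = g x) -> Cn n O f -> Cn n O g.
Proof.
move=> oO; elim: n f g => [|n IH] f g fg /=.
  move=> h x Ox; have := h _ Ox.
  have : {near x, f =1 g}.
    by have := open_nbhs_nbhs (conj oO Ox); apply: filterS => y; exact: fg.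
  move=> ng cf; rewrite /prop_for /continuous_at -(fg _ Ox).
  by apply: cvg_trans cf; exact: near_eq_cvg.
have ng x : O x -> {near x, f =1 g}.
  by move=> Ox; have := open_nbhs_nbhs (conj oO Ox); apply: filterS => y; exact: fg.
move=> [h1 h2]; split=> [x Ox|v].
  exact: (near_differentiable (ng x Ox)) (h1 x Ox).
apply: IH (h2 v) => x Ox.
exact: near_eq_derive (ng x Ox).
Qed.

Lemma Cn_continuous U V n (O : set U) (g : U -> V) x :
  Cn n O g -> O x -> {for x, continuous g}.
Proof.
case: n => [|n] /= h Ox; first exact: h.
exact: differentiable_continuous (h.1 x Ox).
Qed.

Lemma CnS U V n (O : set U) (g : U -> V) : Cn n.+1 O g -> Cn n O g.
Proof.
elim: n g => [|n IH] g.
  by move=> h x Ox; exact: Cn_continuous h Ox.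
by move=> [h1 h2]; split=> [//|v]; exact: IH (h2 v).
Qed.

Lemma Cn_cst U V n (O : set U) (c : V) : Cn n O (fun=> c).
Proof.
elim: n c => [|n IH] c /=; first by move=> x _; exact: cst_continuous.
split=> [x _|v]; first exact: differentiable_cst.
have -> : (fun x : U => 'D_v (fun _ : U => c) x) = fun=> 0.
  by apply/funext => x; exact: derive_cst.
exact: IH.
Qed.

Lemma CnD U V n (O : set U) (f g : U -> V) : open O ->
  Cn n O f -> Cn n O g -> Cn n O (fun x => f x + g x).
Proof.
move=> oO; elim: n f g => [|n IH] f g /=.
  by move=> hf hg x Ox; apply: continuousD; [exact: hf|exact: hg].
move=> [hf1 hf2] [hg1 hg2]; split=> [x Ox|v].
  by apply: differentiableD; [exact: hf1|exact: hg1].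
apply: Cn_eq oO _ (IH _ _ (hf2 v) (hg2 v)) => x Ox.
by rewrite -deriveD //; apply: diff_derivable; [exact: hf1|exact: hg1].
Qed.

Lemma CnM U n (O : set U) (f g : U -> R^o) : open O ->
  Cn n O f -> Cn n O g -> Cn n O (fun x => f x * g x : R^o).
Proof.
move=> oO; elim: n f g => [|n IH] f g.
  by move=> hf hg x Ox; apply: continuousM; [exact: hf|exact: hg].
move=> Hf Hg; have [hf1 hf2] := Hf; have [hg1 hg2] := Hg; split=> [x Ox|v].
  by apply: differentiableM; [exact: hf1|exact: hg1].
have := CnD oO (IH _ _ (CnS Hf) (hg2 v)) (IH _ _ (CnS Hg) (hf2 v)).
apply: Cn_eq oO _ => x Ox.
have -> : (fun x => f x * g x : R^o) = f * g by [].
by rewrite deriveM //; apply: diff_derivable; [exact: hf1|exact: hg1].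
Qed.

Lemma Cn_sum U V n (O : set U) (I : Type) (r : seq I) (P : pred I)
    (f : I -> U -> V) : open O ->
  (forall i, Cn n O (f i)) -> Cn n O (fun x => \sum_(i <- r | P i) f i x).
Proof.
move=> oO h; elim: r => [|i r IH].
  apply: Cn_eq oO _ (@Cn_cst U V n O 0) => x _; by rewrite big_nil.
case Pi: (P i).
  apply: Cn_eq oO _ (CnD oO (h i) IH) => x _; by rewrite big_cons Pi.
apply: Cn_eq oO _ IH => x _; by rewrite big_cons Pi.
Qed.

Lemma differentiable_mxP U m n (M : U -> 'M[R]_(m, n)) x :
  differentiable M x <-> forall i j, differentiable (fun y => M y i j : R^o) x.
Proof.
split=> [h i j|h].
  have : differentiable ((fun N : 'M[R]_(m, n) => N i j : R^o) \o M) x.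
    apply: differentiable_comp => //; exact: differentiable_coord.
  by [].
have -> : M = \sum_(i < m) \sum_(j < n)
    (fun y => (M y i j : R) *: (delta_mx i j : 'M[R]_(m, n))).
  apply/funext => y; rewrite fct_sumE.
  under eq_bigr do rewrite fct_sumE.
  by rewrite [LHS]matrix_sum_delta.
apply: differentiable_sum => i; apply: differentiable_sum => j.
exact: differentiableZl.
Qed.

Lemma continuous_mxP (T : topologicalType) m n (M : T -> 'M[R]_(m, n)) x :
  {for x, continuous M} <-> forall i j, {for x, continuous (fun y => M y i j : R^o)}.
Proof.
split=> [h i j|h].
  have : {for x, continuous ((fun N : 'M[R]_(m, n) => N i j : R^o) \o M)}.
    apply: continuous_comp => //; exact: coord_continuous.
  by [].
apply/cvgrPdist_le => /= e e0.
near=> y.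
rewrite /Num.Def.normr/= mx_normrE (bigmax_le _ (ltW e0))//= => i _.
rewrite !mxE/=.
move: i; near: y; apply: filter_forall => /= i.
exact: ((cvgrPdist_le _ _).1 (h i.1 i.2)).
Unshelve. all: by end_near. Qed.

Lemma Cn_mxP U m n k (O : set U) (M : U -> 'M[R]_(m, n)) : open O ->
  Cn k O M <-> forall i j, Cn k O (fun y => M y i j : R^o).
Proof.
move=> oO; elim: k M => [|k IH] M.
  split=> [h i j x Ox|h x Ox].
    by have /continuous_mxP := h x Ox; exact.
  by apply/continuous_mxP => i j; exact: h.
split=> [[h1 h2] i j|h].
  split=> [x Ox|v]; first by have /differentiable_mxP := h1 x Ox; exact.
  have /IH/(_ i j) := h2 v; apply: Cn_eq oO _ => x Ox.
  by rewrite derive_mx ?mxE //; apply/diff_derivable/h1.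
split=> [x Ox|v].
  by apply/differentiable_mxP => i j; exact: (h i j).1.
apply/IH => i j; have := (h i j).2 v; apply: Cn_eq oO _ => x Ox.
rewrite derive_mx ?mxE //; apply/diff_derivable/differentiable_mxP => i' j'.
exact: (h i' j').1.
Qed.

Lemma derive_linear U V (f : U -> V) x (a : R) u v : differentiable f x ->
  'D_(a *: u + v) f x = a *: 'D_u f x + 'D_v f x.
Proof. by move=> df; rewrite !deriveE // linearP. Qed.

Lemma rV_sum_delta n (v : 'rV[R]_n) : v = \sum_k v 0 k *: delta_mx 0 k.
Proof. by rewrite {1}[v]matrix_sum_delta big_ord1. Qed.

Lemma derive_sum_delta V n (f : 'rV[R]_n -> V) x v : differentiable f x ->
  'D_v f x = \sum_k v 0 k *: 'D_(delta_mx 0 k) f x.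
Proof.
move=> df; rewrite deriveE // {1}(rV_sum_delta v) linear_sum.
by apply: eq_bigr => k _; rewrite linearZ /= deriveE.
Qed.

Lemma derive_comp U V (W : normedModType R) (f : U -> V) (g : V -> W) x v :
  differentiable f x -> differentiable g (f x) ->
  'D_v (g \o f) x = 'D_('D_v f x) g (f x).
Proof.
move=> df dg; rewrite !deriveE //; last exact: differentiable_comp.
by rewrite diff_comp.
Qed.

(** With coordinates on the middle space, the chain rule writes a derivative of the composite as a
    finite sum of products of a derivative of [f] and a partial derivative of [g] composed with [f];
    the induction hypothesis applies to the latter. *)
Lemma Cn_comp U n k (O : set U) (O' : set 'rV[R]_n) (f : U -> 'rV[R]_n)
    (g : 'rV[R]_n -> R^o) : open O -> (forall x, O x -> O' (f x)) ->
  Cn k O f -> Cn k O' g -> Cn k O (fun x => g (f x)).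
Proof.
move=> oO fO; elim: k g => [|k IH] g.
  move=> hf hg x Ox; apply: (@continuous_comp _ _ _ f g); first exact: hf.
  exact: hg (fO x Ox).
move=> Hf [hg1 hg2]; have [hf1 hf2] := Hf; split=> [x Ox|v].
  by apply: (@differentiable_comp _ _ _ _ f g); [exact: hf1|exact/hg1/fO].
have : Cn k O (fun x => \sum_j ('D_v f x 0 j * 'D_(delta_mx 0 j) g (f x) : R^o)).
  apply: Cn_sum => // j; apply: CnM => //.
    by have /Cn_mxP := hf2 v; exact.
  exact: (IH _ (CnS Hf) (hg2 _)).
apply: Cn_eq oO _ => x Ox.
rewrite (derive_comp (g := g) (f := f)) ?(derive_sum_delta (f := g)) //; do ?exact: hf1.
  exact/hg1/fO.
exact/hg1/fO.
Qed.

Lemma mvt_segment U (f : U -> R^o) x v (h : R) : 0 < h ->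
  (forall t, 0 <= t <= h -> differentiable f (x + t *: v)) ->
  exists2 t, 0 <= t <= h & f (x + h *: v) - f x = h * 'D_v f (x + t *: v).
Proof.
move=> h0 df.
pose phi (t : R) : R^o := f (x + t *: v).
have dphi t : 0 <= t <= h -> is_derive (t : R^o) (1 : R^o) phi ('D_v f (x + t *: v)).
  move=> th.
  have dl (s : R^o) : is_diff s (fun s : R^o => x + s *: v) (fun s => s *: v).
    apply: (@is_diff_eq _ _ _ _ _ _ _ (is_diffD (is_diff_cst x s) (is_diff_scalel s v))).
    by rewrite add0r.
  have dd : differentiable phi (t : R^o).
    apply: (@differentiable_comp _ _ _ _ (fun s : R^o => x + s *: v) f).
      by case: (dl t).
    exact: df.
  apply: DeriveDef; first exact: diff_derivable.
  rewrite (@derive_comp R^o U R^o (fun s : R^o => x + s *: v) f); last 2 first.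
  - by case: (dl t).
  - exact: df.
  congr ('D_ _ f _).
  rewrite deriveE; last by case: (dl t).
  by rewrite diff_val scale1r.
have [||c ch] := @MVT R phi (fun t => 'D_v f (x + t *: v)) 0 h h0.
- move=> t; rewrite in_itv /= => /andP[t0 th]; apply: dphi.
  by rewrite !ltW.
- apply: continuous_in_subspaceT => t; rewrite inE /= in_itv /= => th.
  by apply: differentiable_continuous; apply/derivable1_diffP; case: (dphi t th).
- rewrite subr0 /phi scale0r addr0 mulrC => E.
  exists c => //; move: ch; rewrite in_itv /= => /andP[? ?].
  by rewrite !ltW.
Qed.

Lemma near_square U (x u v : U) (P : set U) : nbhs x P ->
  exists2 h : R, 0 < h & forall s t, 0 <= s <= h -> 0 <= t <= h ->
    P (x + s *: u + t *: v).
Proof.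
move=> /nbhs_ballP[e /= e0 Pe].
(* The summand 1 keeps the denominator positive when both vectors vanish, and the factor 2 makes the
   final inequality strict. *)
pose h := e / (2 * (1 + `|u| + `|v|)).
have n0 : 0 < 1 + `|u| + `|v| by rewrite -addrA ltr_wpDr // addr_ge0.
have h0 : 0 < h by rewrite divr_gt0 // mulr_gt0.
exists h => // s t /andP[s0 sh] /andP[t0 th]; apply: Pe.
rewrite -ball_normE /ball_ /= -addrA opprD addrA subrr sub0r normrN.
apply: le_lt_trans (ler_normD _ _) _; rewrite !normrZ !ger0_norm //.
apply: (@le_lt_trans _ _ (h * (1 + `|u| + `|v|))).
  have : s * `|u| + t * `|v| <= h * `|u| + h * `|v|.
    by apply: lerD; apply: ler_wpM2r.
  by move=> /le_trans; apply; rewrite !mulrDr mulr1 -addrA lerDr ltW.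
rewrite /h invfM mulrA mulfVK ?gt_eqF //.
by rewrite ltr_pdivrMr // ltr_pMr // ltr1n.
Qed.

(** Schwarz's argument: the second difference of [f] over the parallelogram with sides [h *: u] and
    [h *: v] is [h * h] times a value of either mixed derivative inside it, and continuity puts
    these values within [e] of the values at [x]. *)
Lemma derive_comm_near U (f : U -> R^o) (O : set U) x u v (e : R) : open O -> O x ->
  Cn 2 O f -> 0 < e ->
  exists h : R, exists2 y, 0 < h & `|'D_v (fun y => 'D_u f y : R^o) x - y| < e /\
    f (x + h *: u + h *: v) - f (x + h *: u) - f (x + h *: v) + f x = h * h * y /\
   exists2 z, `|'D_u (fun y => 'D_v f y : R^o) x - z| < e &
    f (x + h *: u + h *: v) - f (x + h *: u) - f (x + h *: v) + f x = h * h * z.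
Proof.
move=> oO Ox [f1 f2] e0.
have step a b : {for x, continuous (fun y => 'D_a (fun y => 'D_b f y) y)}.
  exact: (Cn_continuous (n := 0) ((f2 b).2 a) Ox).
have nuv := step v u; have nvu := step u v.
have /(near_square u v)[h h0 hP] : \forall y \near x, O y /\
  (`|'D_v (fun y => 'D_u f y : R^o) x - 'D_v (fun y => 'D_u f y : R^o) y| < e /\
   `|'D_u (fun y => 'D_v f y : R^o) x - 'D_u (fun y => 'D_v f y : R^o) y| < e).
  apply: filterI; first exact: (open_nbhs_nbhs (conj oO Ox)).
  apply: filterI.
    by move/cvgrPdist_lt : nuv => /(_ e e0).
  by move/cvgrPdist_lt : nvu => /(_ e e0).
have hh : 0 <= h <= h by rewrite lexx (ltW h0).
(* The mean value theorem is used twice: along [a] for the increment of [f] in the direction [b],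
   then along [b] for the derivative of [f] in the direction [a]. *)
have dbl a b : (forall s t, 0 <= s <= h -> 0 <= t <= h -> O (x + s *: a + t *: b)) ->
  exists s t, [/\ 0 <= s <= h, 0 <= t <= h &
   f (x + h *: a + h *: b) - f (x + h *: a) - f (x + h *: b) + f x
   = h * h * 'D_b (fun y => 'D_a f y : R^o) (x + s *: a + t *: b)].
  move=> Oab.
  have dshift y : O (y + h *: b) ->
    is_diff y (fun y => f (y + h *: b) : R^o) ('d f (y + h *: b)).
    move=> Oy.
    have dl : is_diff y (fun y => y + h *: b) id.
      apply: (@is_diff_eq _ _ _ _ _ _ _ (is_diffD (is_diff_id y) (is_diff_cst (h *: b) y))).
      by rewrite addr0.
    have df' : is_diff (y + h *: b) f ('d f (y + h *: b)).
      exact/differentiableP/f1.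
    exact: (@is_diff_comp _ _ _ _ _ _ _ _ _ dl df').
  have Oa s : 0 <= s <= h -> O (x + s *: a).
    by move=> sh; have := Oab s 0 sh; rewrite scale0r addr0 lexx (ltW h0); exact.
  have [|s sh Es] := @mvt_segment U (fun y => f (y + h *: b) - f y) x a h h0.
    move=> s sh; apply: differentiableB; last exact/f1/Oa.
    by case: (dshift (x + s *: a) (Oab _ _ sh hh)).
  have [|t th Et] := @mvt_segment U (fun y => 'D_a f y) (x + s *: a) b h h0.
    by move=> t th; exact/(f2 a).1/Oab.
  exists s, t; split; [exact: sh|exact: th|].
  rewrite -mulrA -Et.
  have -> : f (x + h *: a + h *: b) - f (x + h *: a) - f (x + h *: b) + f x =
   f (x + h *: a + h *: b) - f (x + h *: a) - (f (x + h *: b) - f x).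
    by rewrite opprB addrA [RHS]addrAC.
  rewrite Es; congr (_ * _).
  have dd := dshift (x + s *: a) (Oab _ _ sh hh).
  rewrite deriveB; last 2 first.
  - by apply: diff_derivable; case: dd.
  - exact/diff_derivable/f1/Oa.
  congr (_ - _); rewrite deriveE; last by case: dd.
  rewrite deriveE; last exact/f1/Oab.
  by rewrite diff_val.
have [s [t [sh th E1]]] := dbl u v (fun s t sh th => (hP s t sh th).1).
have [|s' [t' [sh' th' E2]]] := dbl v u.
  by move=> a b ah bh; rewrite addrAC; exact: (hP b a bh ah).1.
exists h; exists ('D_v (fun y => 'D_u f y : R^o) (x + s *: u + t *: v)); first exact: h0.
split; first exact: (hP _ _ sh th).2.1.
split; first exact: E1.
exists ('D_u (fun y => 'D_v f y : R^o) (x + s' *: v + t' *: u)).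
  rewrite [x + s' *: v + _]addrAC; exact: (hP _ _ th' sh').2.2.
rewrite -E2 [x + h *: v + _]addrAC.
by rewrite -[in RHS](addrA (f _)) [- _ - _ in RHS]addrC addrA.
Unshelve. all: by end_near. Qed.

Lemma derive_comm U (f : U -> R^o) (O : set U) x u v : open O -> O x ->
  Cn 2 O f ->
  'D_v (fun y => 'D_u f y : R^o) x = 'D_u (fun y => 'D_v f y : R^o) x.
Proof.
move=> oO Ox f2; apply/eqP/negP => /negP ne.
set a := 'D_v _ x in ne *; set b := 'D_u _ x in ne *.
have e0 : 0 < `|a - b| / 2 by rewrite divr_gt0 // normr_gt0 subr_eq0.
have [h [y h0 [hy [Ey [z hz Ez]]]]] := derive_comm_near u v oO Ox f2 e0.
have yz : y = z.
  have : h * h * y = h * h * z by rewrite -Ey -Ez.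
  by apply: mulfI; rewrite mulf_neq0 // gt_eqF.
have : `|a - b| < `|a - b| / 2 + `|a - b| / 2.
  have E : a - b = (a - y) - (b - z) by rewrite yz opprB addrA subrK.
  by rewrite {1}E; exact: le_lt_trans (ler_normB _ _) (ltrD hy hz).
by rewrite -splitr ltxx.
Qed.

End RealCalculus.

(** * Derivatives of complex-valued functions of real variables *)

Section ComplexCalculus.
Variable R : realType.
Implicit Types (U : normedModType R).
Notation C := R[i].

Definition cdifferentiable U (g : U -> C) (x : U) : Prop :=
  differentiable (fun y => complex.Re (g y) : R^o) x /\
  differentiable (fun y => complex.Im (g y) : R^o) x.

Lemma ReD (a b : C) : complex.Re (a + b) = complex.Re a + complex.Re b.
Proof. by case: a; case: b. Qed.

Lemma ImD (a b : C) : complex.Im (a + b) = complex.Im a + complex.Im b.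
Proof. by case: a; case: b. Qed.

Lemma ReM (a b : C) : complex.Re (a * b) =
  complex.Re a * complex.Re b - complex.Im a * complex.Im b.
Proof. by case: a; case: b. Qed.

Lemma ImM (a b : C) : complex.Im (a * b) =
  complex.Re a * complex.Im b + complex.Im a * complex.Re b.
Proof. by case: a; case: b => *. Qed.

Lemma complexP (a b : C) :
  complex.Re a = complex.Re b -> complex.Im a = complex.Im b -> a = b.
Proof. by case: a; case: b => ? ? ? ? /= -> ->. Qed.

Lemma csmooth_pointwise U (O : set U) (g : U -> C) :
  (forall x, O x -> exists2 O', csmooth_on O' g & O' x) -> csmooth_on O g.
Proof.
move=> h; split=> n; apply/Cn_pointwise => x Ox; have [W [h1 h2] Wx] := h x Ox;
  by [apply: Cn_subset (h1 n) => y ->|apply: Cn_subset (h2 n) => y ->].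
Qed.

Lemma csmooth_eq U (O : set U) (f g : U -> C) : open O ->
  (forall x, O x -> f x = g x) -> csmooth_on O f -> csmooth_on O g.
Proof.
by move=> oO fg [h1 h2]; split=> n; [apply: Cn_eq oO _ (h1 n)|apply: Cn_eq oO _ (h2 n)];
  move=> x /fg ->.
Qed.

Lemma csmooth_cst U (O : set U) (c : C) : csmooth_on O (fun=> c).
Proof. by split=> n; exact: Cn_cst. Qed.

Lemma csmoothD U (O : set U) (f g : U -> C) : open O ->
  csmooth_on O f -> csmooth_on O g -> csmooth_on O (fun x => f x + g x).
Proof.
move=> oO [f1 f2] [g1 g2]; split=> n.
  by apply: Cn_eq oO _ (CnD oO (f1 n) (g1 n)) => x _; rewrite ReD.
by apply: Cn_eq oO _ (CnD oO (f2 n) (g2 n)) => x _; rewrite ImD.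
Qed.

Lemma csmoothM U (O : set U) (f g : U -> C) : open O ->
  csmooth_on O f -> csmooth_on O g -> csmooth_on O (fun x => f x * g x).
Proof.
move=> oO [f1 f2] [g1 g2]; split=> n.
  have := CnD oO (CnM oO (f1 n) (g1 n))
    (CnM oO (@Cn_cst _ _ _ n O (-1 : R^o)) (CnM oO (f2 n) (g2 n))).
  by apply: Cn_eq oO _ => x _; rewrite ReM mulN1r.
have := CnD oO (CnM oO (f1 n) (g2 n)) (CnM oO (f2 n) (g1 n)).
by apply: Cn_eq oO _ => x _; rewrite ImM.
Qed.

Lemma csmoothZ U (O : set U) (c : C) (f : U -> C) : open O ->
  csmooth_on O f -> csmooth_on O (fun x => c * f x).
Proof. by move=> oO; apply: csmoothM => //; exact: csmooth_cst. Qed.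

Lemma csmooth_sum U (O : set U) (I : Type) (r : seq I) (P : pred I)
    (f : I -> U -> C) : open O ->
  (forall i, csmooth_on O (f i)) -> csmooth_on O (fun x => \sum_(i <- r | P i) f i x).
Proof.
move=> oO h; elim: r => [|i r IH].
  by apply: csmooth_eq oO _ (@csmooth_cst U O 0) => x _; rewrite big_nil.
case Pi: (P i).
  by apply: csmooth_eq oO _ (csmoothD oO (h i) IH) => x _; rewrite big_cons Pi.
by apply: csmooth_eq oO _ IH => x _; rewrite big_cons Pi.
Qed.

Lemma csmooth_real U (O : set U) (f : U -> R^o) :
  smooth_on O f -> csmooth_on O (fun x => (f x)%:C%C).
Proof. by move=> h; split=> n; [exact: h|exact: Cn_cst]. Qed.

Lemma csmooth_comp U n (O : set U) (O' : set 'rV[R]_n) (f : U -> 'rV[R]_n)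
    (g : 'rV[R]_n -> C) : open O -> (forall x, O x -> O' (f x)) ->
  smooth_on O f -> csmooth_on O' g -> csmooth_on O (fun x => g (f x)).
Proof.
by move=> oO fO sf [g1 g2]; split=> k; [apply: Cn_comp oO fO (sf k) (g1 k)|
  apply: Cn_comp oO fO (sf k) (g2 k)].
Qed.

Lemma csmooth_differentiable U (O : set U) (g : U -> C) x :
  csmooth_on O g -> O x -> cdifferentiable g x.
Proof. by move=> [h1 h2] Ox; split; [exact: (h1 1).1|exact: (h2 1).1]. Qed.

Lemma csmooth_cderive U (O : set U) (g : U -> C) v :
  csmooth_on O g -> csmooth_on O (fun x => cderive g x v).
Proof. by move=> [h1 h2]; split=> n; [exact: (h1 n.+1).2|exact: (h2 n.+1).2]. Qed.

Lemma near_cderive U (f g : U -> C) x v :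
  {near x, f =1 g} -> cderive f x v = cderive g x v.
Proof.
move=> fg; rewrite /cderive; congr Complex; apply: near_eq_derive;
  by apply: filterS fg => y /= ->.
Qed.

Lemma open_cderive U (O : set U) (f g : U -> C) x v : open O -> O x ->
  (forall y, O y -> f y = g y) -> cderive f x v = cderive g x v.
Proof.
move=> oO Ox fg; apply: near_cderive.
by have := open_nbhs_nbhs (conj oO Ox); apply: filterS => y /fg.
Qed.

Lemma cderive_cst U (c : C) (x v : U) : cderive (fun=> c) x v = 0.
Proof. by rewrite /cderive !derive_cst. Qed.

Lemma cderiveD U (f g : U -> C) x v : cdifferentiable f x -> cdifferentiable g x ->
  cderive (fun y => f y + g y) x v = cderive f x v + cderive g x v.
Proof.
move=> [f1 f2] [g1 g2]; rewrite /cderive.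
have -> : (fun y => complex.Re (f y + g y) : R^o) =
  (fun y => complex.Re (f y) : R^o) + (fun y => complex.Re (g y) : R^o).
  by apply/funext => y; rewrite ReD.
have -> : (fun y => complex.Im (f y + g y) : R^o) =
  (fun y => complex.Im (f y) : R^o) + (fun y => complex.Im (g y) : R^o).
  by apply/funext => y; rewrite ImD.
by rewrite !deriveD //; exact: diff_derivable.
Qed.

Lemma cdifferentiableM U (f g : U -> C) x :
  cdifferentiable f x -> cdifferentiable g x -> cdifferentiable (fun y => f y * g y) x.
Proof.
move=> [f1 f2] [g1 g2]; split.
  have -> : (fun y => complex.Re (f y * g y) : R^o) =
    (fun y => complex.Re (f y) : R^o) * (fun y => complex.Re (g y) : R^o) -
    (fun y => complex.Im (f y) : R^o) * (fun y => complex.Im (g y) : R^o).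
    by apply/funext => y; rewrite ReM.
  by apply: differentiableB; apply: differentiableM.
have -> : (fun y => complex.Im (f y * g y) : R^o) =
  (fun y => complex.Re (f y) : R^o) * (fun y => complex.Im (g y) : R^o) +
  (fun y => complex.Im (f y) : R^o) * (fun y => complex.Re (g y) : R^o).
  by apply/funext => y; rewrite ImM.
by apply: differentiableD; apply: differentiableM.
Qed.

(** The values -1 and 1 of [s] give the real and the imaginary part of a product of complex
    functions. *)
Lemma derive_mul2 U (s : R) (a b c d : U -> R^o) x v :
  differentiable a x -> differentiable b x -> differentiable c x -> differentiable d x ->
  'D_v (fun y => a y * b y + s * (c y * d y) : R^o) x =
  'D_v a x * b x + a x * 'D_v b x + s * ('D_v c x * d x + c x * 'D_v d x).
Proof.
move=> /(diff_derivable (v := v)) da /(diff_derivable (v := v)) db.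
move=> /(diff_derivable (v := v)) dc /(diff_derivable (v := v)) dd.
have dab := derivableM da db; have dcd := derivableM dc dd.
transitivity ('D_v (a * b + s *: (c * d)) x); first by [].
have dsz := derivableZ (k := s) dcd; rewrite (deriveD dab dsz) (deriveZ s dcd) (deriveM da db) (deriveM dc dd).
congr (_ + _); last congr (_ * _); rewrite addrC; congr (_ + _); exact: mulrC.
Qed.

Lemma cderiveM U (f g : U -> C) x v : cdifferentiable f x -> cdifferentiable g x ->
  cderive (fun y => f y * g y) x v = cderive f x v * g x + f x * cderive g x v.
Proof.
move=> [f1 f2] [g1 g2].
have E1 := derive_mul2 (-1) v f1 g1 f2 g2.
have E2 := derive_mul2 1 v f1 g2 f2 g1.
rewrite /cderive.
have -> : (fun y => complex.Re (f y * g y) : R^o) = (fun y => complex.Re (f y) *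
   complex.Re (g y) + -1 * (complex.Im (f y) * complex.Im (g y)) : R^o).
  by apply/funext => y; rewrite ReM mulN1r.
have -> : (fun y => complex.Im (f y * g y) : R^o) = (fun y => complex.Re (f y) *
   complex.Im (g y) + 1 * (complex.Im (f y) * complex.Re (g y)) : R^o).
  by apply/funext => y; rewrite ImM mul1r.
rewrite {}E1 {}E2.
move: ('D_v _ x) ('D_v _ x) ('D_v _ x) ('D_v _ x) => a b c d.
case: (f x) => p q; case: (g x) => r s /=.
by apply: complexP => /=; ring.
Qed.

Lemma cdifferentiable_cst U (c : C) (x : U) : cdifferentiable (fun=> c) x.
Proof. by split; exact: differentiable_cst. Qed.

Lemma cderiveZ U (c : C) (g : U -> C) x v : cdifferentiable g x ->
  cderive (fun y => c * g y) x v = c * cderive g x v.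
Proof.
move=> dg; by rewrite cderiveM ?cderive_cst ?mul0r ?add0r //.
Qed.

Lemma cdifferentiableD U (f g : U -> C) x :
  cdifferentiable f x -> cdifferentiable g x -> cdifferentiable (fun y => f y + g y) x.
Proof.
move=> [f1 f2] [g1 g2]; split.
  have -> : (fun y => complex.Re (f y + g y) : R^o) =
    (fun y => complex.Re (f y) : R^o) + (fun y => complex.Re (g y) : R^o).
    by apply/funext => y; rewrite ReD.
  exact: differentiableD.
have -> : (fun y => complex.Im (f y + g y) : R^o) =
  (fun y => complex.Im (f y) : R^o) + (fun y => complex.Im (g y) : R^o).
  by apply/funext => y; rewrite ImD.
exact: differentiableD.
Qed.

Lemma cdifferentiable_sum U (I : Type) (r : seq I) (P : pred I) (f : I -> U -> C) x :
  (forall i, cdifferentiable (f i) x) ->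
  cdifferentiable (fun y => \sum_(i <- r | P i) f i y) x.
Proof.
move=> h; elim: r => [|i r IH].
  have -> : (fun y : U => \sum_(i <- [::] | P i) f i y) = (fun=> 0).
    by apply/funext => y; rewrite big_nil.
  exact: cdifferentiable_cst.
have -> : (fun y => \sum_(j <- i :: r | P j) f j y) =
  (fun y => (if P i then f i y else 0) + \sum_(j <- r | P j) f j y).
  by apply/funext => y; rewrite big_cons; case: (P i) => //; rewrite add0r.
apply: cdifferentiableD => //; case: (P i) => //; exact: cdifferentiable_cst.
Qed.

Lemma cderive_sum U (I : Type) (r : seq I) (P : pred I) (f : I -> U -> C) x v :
  (forall i, cdifferentiable (f i) x) ->
  cderive (fun y => \sum_(i <- r | P i) f i y) x v = \sum_(i <- r | P i) cderive (f i) x v.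
Proof.
move=> h; elim: r => [|i r IH].
  have -> : (fun y : U => \sum_(i <- [::] | P i) f i y) = (fun=> 0).
    by apply/funext => y; rewrite big_nil.
  by rewrite big_nil cderive_cst.
have -> : (fun y => \sum_(j <- i :: r | P j) f j y) =
  (fun y => (if P i then f i y else 0) + \sum_(j <- r | P j) f j y).
  by apply/funext => y; rewrite big_cons; case: (P i) => //; rewrite add0r.
rewrite cderiveD; last 2 first.
- by case: (P i) => //; exact: cdifferentiable_cst.
- exact: cdifferentiable_sum.
by rewrite IH big_cons; case: (P i) => //; rewrite cderive_cst add0r.
Qed.

Lemma cderive_real U (f : U -> R^o) x v :
  cderive (fun y => (f y)%:C%C) x v = ('D_v f x)%:C%C.
Proof. by rewrite /cderive /= derive_cst. Qed.

Lemma cderive_linear U (g : U -> C) x (a : R) u v : cdifferentiable g x ->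
  cderive g x (a *: u + v) = a%:C%C * cderive g x u + cderive g x v.
Proof.
move=> [g1 g2]; rewrite /cderive !derive_linear //.
by apply: complexP; rewrite ?(ReD,ImD,ReM,ImM) /= /GRing.scale /=; ring.
Qed.

Lemma cderive_sum_delta n (g : 'rV[R]_n -> C) x v : cdifferentiable g x ->
  cderive g x v = \sum_k (v 0 k)%:C%C * cderive g x (delta_mx 0 k).
Proof.
move=> [g1 g2]; rewrite /cderive (derive_sum_delta _ g1) (derive_sum_delta _ g2).
apply: complexP.
  rewrite (big_morph (@complex.Re R) ReD (erefl : complex.Re 0 = 0)) /=.
  by apply: eq_bigr => k _; rewrite /= mul0r subr0.
rewrite (big_morph (@complex.Im R) ImD (erefl : complex.Im 0 = 0)) /=.
by apply: eq_bigr => k _; rewrite /= mul0r addr0.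
Qed.

Lemma cderive_comp U (V : normedModType R) (f : U -> V) (g : V -> C) x v :
  differentiable f x -> cdifferentiable g (f x) ->
  cderive (fun y => g (f y)) x v = cderive g (f x) ('D_v f x).
Proof.
move=> df [g1 g2]; rewrite /cderive.
by rewrite -(derive_comp v df g1) -(derive_comp v df g2).
Qed.

Lemma cderive_comm U (O : set U) (g : U -> C) x u v : open O -> O x ->
  csmooth_on O g ->
  cderive (fun y => cderive g y u) x v = cderive (fun y => cderive g y v) x u.
Proof.
move=> oO Ox [g1 g2].
have E1 := derive_comm u v oO Ox (g1 2).
have E2 := derive_comm u v oO Ox (g2 2).
by rewrite /cderive /= E1 E2.
Qed.

(** The real and imaginary parts are treated apart, because the mean value theorem gives each its
    own intermediate point. *)
Lemma cconst_segment U (g : U -> C) x v :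
  (forall t : R, 0 <= t <= 1 -> cdifferentiable g (x + t *: v)) ->
  (forall t : R, 0 <= t <= 1 -> cderive g (x + t *: v) v = 0) -> g (x + v) = g x.
Proof.
move=> dg g0; apply/eqP; rewrite -subr_eq0; apply/eqP.
have [|t t1 E1] := @mvt_segment R U (fun y => complex.Re (g y)) x v 1 ltr01.
  by move=> t /dg[].
have [|s s1 E2] := @mvt_segment R U (fun y => complex.Im (g y)) x v 1 ltr01.
  by move=> s /dg[].
have [D1 _] := g0 t t1; have [_ D2] := g0 s s1.
move: E1 E2; rewrite D1 D2 mulr0 scale1r => E1 E2.
by apply: complexP; [move: E1|move: E2]; case: (g _) => a b; case: (g _).
Qed.

End ComplexCalculus.

(** * Alternating forms and the Clifford action *)

Section AltEvaluation.
Variables (R : realType) (m : nat).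
Notation alt := (seq 'rV[R]_m -> R[i]).
Implicit Types (b c : alt) (s : seq 'rV[R]_m).

Lemma altDE b c s : (b + c) s = b s + c s. Proof. by []. Qed.
Lemma altNE b s : (- b) s = - b s. Proof. by []. Qed.
Lemma altZE (k : R[i]) b s : (k *: b) s = k * b s. Proof. by []. Qed.
Lemma alt0E s : (0 : alt) s = 0. Proof. by [].  Qed.
Lemma alt_sumE (I : Type) (r : seq I) (P : pred I) (f : I -> alt) s :
  (\sum_(i <- r | P i) f i) s = \sum_(i <- r | P i) f i s.
Proof. by rewrite fct_sumE. Qed.

End AltEvaluation.

Ltac alt_ring := apply/funext => ?;
  rewrite ?(altDE, altNE, altZE, alt0E) /=; ring.

Section AlternatingForms.
Variables (R : realType) (m : nat).
Notation C := R[i].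
Notation vect := 'rV[R]_m.
Notation alt := (seq vect -> C).
Implicit Types (b c : alt) (u v : vect) (s : seq vect).

(** The contraction i_u, uniformly in all degrees. A form is determined by its value at [[::]] and
    its contractions, which is the basis of the inductions on lists below. *)
Definition interior u b : alt := fun s => b (u :: s).

Lemma alternating_interior u b : alternating b -> alternating (interior u b).
Proof.
by move=> [h1 h2]; split=> [s1 s2 a v w|s1 s2 s3 v]; [exact: (h1 (u :: s1))|exact: (h2 (u :: s1))].
Qed.

Lemma interior_linear b (a : R) u v : alternating b ->
  interior (a *: u + v) b = a%:C%C *: interior u b + interior v b.
Proof. by move=> [h _]; apply/funext => s; exact: (h [::]). Qed.

Lemma interior_interior u b : alternating b -> interior u (interior u b) = 0.
Proof. by move=> [_ h]; apply/funext => s; exact: (h [::] [::]). Qed.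

(** A coinduction principle: in a class stable under contraction, linearity and vanishing need only
    be checked on the leading arguments, since later positions are leading ones for a contracted
    form. It replaces computations with signed sums for [wedge1] and the exterior derivative. *)
Lemma alternating_coind (P : set alt) :
  (forall b, P b -> [/\ forall a u v, interior (a *: u + v) b = a%:C%C *: interior u b + interior v b,
     forall u, interior u (interior u b) = 0 & forall u, P (interior u b)]) ->
  forall b, P b -> alternating b.
Proof.
move=> hP b Pb; split=> [s1 s2 a u v|s1 s2 s3 u].
  elim: s1 b Pb => [|w s1 IH] b Pb.
    by have [h _ _] := hP b Pb; have := congr1 (@^~ s2) (h a u v).
  by have [_ _ h] := hP b Pb; exact: IH (h w).
elim: s1 b Pb => [|w s1 IH] b Pb; last first.
  by have [_ _ h] := hP b Pb; exact: IH (h w).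
elim: s2 b Pb => [|w s2 IH] b Pb.
  by have [_ h _] := hP b Pb; exact: (congr1 (@^~ s3) (h u)).
have [h1 h2 h3] := hP b Pb.
(* Polarisation: vanishing at the repeated vector [x + y] gives antisymmetry in the first two
   arguments, which moves the repeated vector one place forward, into the reach of the induction
   hypothesis. *)
have swap x y t : b (x :: y :: t) = - b (y :: x :: t).
  have := congr1 (@^~ t) (h2 (1 *: x + y)); rewrite /interior /=.
  have E p q : b ((1 *: x + y) :: (1 *: p + q) :: t) =
     b (x :: p :: t) + b (x :: q :: t) + (b (y :: p :: t) + b (y :: q :: t)).
    have F z : b (z :: (1 *: p + q) :: t) = b (z :: p :: t) + b (z :: q :: t).
      have [k _ _] := hP _ (h3 z); have := congr1 (@^~ t) (k 1 p q).
      by rewrite altDE altZE mul1r.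
    have := congr1 (@^~ ((1 *: p + q) :: t)) (h1 1 x y).
    by rewrite altDE altZE mul1r /interior !F.
  rewrite E.
  have Z z : b (z :: z :: t) = 0 by exact: (congr1 (@^~ t) (h2 z)).
  by rewrite !Z add0r addr0 => /eqP; rewrite addr_eq0 => /eqP.
rewrite /= swap; apply/eqP; rewrite oppr_eq0; apply/eqP.
exact: (IH (interior w b) (h3 w)).
Qed.

Lemma alternating0 : alternating (0 : alt).
Proof. by split=> [*|*]; rewrite /= ?mulr0 ?addr0. Qed.

Lemma alternatingD b c : alternating b -> alternating c -> alternating (b + c).
Proof.
move=> [b1 b2] [c1 c2]; split=> [s1 s2 a u v|s1 s2 s3 u].
  by rewrite !altDE b1 c1 mulrDr addrACA.
by rewrite altDE b2 c2 addr0.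
Qed.

Lemma alternatingZ (k : C) b : alternating b -> alternating (k *: b).
Proof.
move=> [b1 b2]; split=> [s1 s2 a u v|s1 s2 s3 u].
  by rewrite !altZE b1 mulrDr mulrCA.
by rewrite altZE b2 mulr0.
Qed.

Lemma alternatingN b : alternating b -> alternating (- b).
Proof. by move=> /(alternatingZ (-1)); rewrite scaleN1r. Qed.

Lemma alternating_sum (I : Type) (r : seq I) (P : pred I) (f : I -> alt) :
  (forall i, P i -> alternating (f i)) -> alternating (\sum_(i <- r | P i) f i).
Proof.
move=> h; elim/big_rec: _ => [|i b Pi hb]; first exact: alternating0.
exact: alternatingD (h i Pi) hb.
Qed.

Lemma interiorD u b c : interior u (b + c) = interior u b + interior u c. Proof. by []. Qed.
Lemma interiorZ u (k : C) b : interior u (k *: b) = k *: interior u b. Proof. by []. Qed.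
Lemma interiorN u b : interior u (- b) = - interior u b. Proof. by []. Qed.

Lemma covecD (F : comPzRingType) (a X Y : 'rV[F]_m) : covec a (X + Y) = covec a X + covec a Y.
Proof. by rewrite /covec linearD mulmxDr mxE. Qed.
Lemma covecZ (F : comPzRingType) (k : F) (a X : 'rV[F]_m) : covec a (k *: X) = k * covec a X.
Proof. by rewrite /covec linearZ /= -scalemxAr mxE. Qed.
Lemma covecDl (F : comPzRingType) (a c X : 'rV[F]_m) : covec (a + c) X = covec a X + covec c X.
Proof. by rewrite /covec mulmxDl mxE. Qed.
Lemma covecZl (F : comPzRingType) (k : F) (a X : 'rV[F]_m) : covec (k *: a) X = k * covec a X.
Proof. by rewrite /covec -scalemxAl mxE. Qed.
Lemma covec_sum (F : comPzRingType) (a X : 'rV[F]_m) : covec a X = \sum_k a 0 k * X 0 k.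
Proof. by rewrite /covec mxE; apply: eq_bigr => k _; rewrite mxE. Qed.
Lemma covecC (F : comPzRingType) (a X : 'rV[F]_m) : covec a X = covec X a.
Proof. by rewrite !covec_sum; apply: eq_bigr => k _; rewrite mulrC. Qed.

Notation toC := (map_mx (real_complex R)).

Lemma wedge1_nil (a : 'rV[C]_m) b : wedge1 a b [::] = 0.
Proof. by rewrite /wedge1 big_ord0. Qed.

Lemma interior_wedge1 u (a : 'rV[C]_m) b :
  interior u (wedge1 a b) = covec a (toC u) *: b - wedge1 a (interior u b).
Proof.
apply/funext => s; rewrite /interior /wedge1 /= big_ord_recl /=.
rewrite expr0 mul1r /delete /= drop0; congr (_ + _).
rewrite altNE -sumrN; apply: eq_bigr => i _.
by rewrite /bump /= add1n exprS !mulN1r !mulNr.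
Qed.

Lemma wedge1D (a : 'rV[C]_m) b c : wedge1 a (b + c) = wedge1 a b + wedge1 a c.
Proof.
apply/funext => s; rewrite altDE /wedge1 -big_split /=.
by apply: eq_bigr => i _; rewrite altDE mulrDr.
Qed.

Lemma wedge1Z (a : 'rV[C]_m) (k : C) b : wedge1 a (k *: b) = k *: wedge1 a b.
Proof.
apply/funext => s; rewrite altZE /wedge1 mulr_sumr /=.
by apply: eq_bigr => i _; rewrite altZE mulrCA.
Qed.

Lemma wedge1N (a : 'rV[C]_m) b : wedge1 a (- b) = - wedge1 a b.
Proof. by rewrite -scaleN1r wedge1Z scaleN1r. Qed.

Lemma wedge1_0 (a : 'rV[C]_m) : wedge1 a (0 : alt) = 0.
Proof. by have := wedge1Z a 0 0; rewrite !scale0r. Qed.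

Lemma wedge1Dl (a a' : 'rV[C]_m) b : wedge1 (a + a') b = wedge1 a b + wedge1 a' b.
Proof.
apply/funext => s; rewrite altDE /wedge1 -big_split /=.
by apply: eq_bigr => i _; rewrite covecDl mulrDr mulrDl.
Qed.

Lemma wedge1Zl (a : 'rV[C]_m) (k : C) b : wedge1 (k *: a) b = k *: wedge1 a b.
Proof.
apply/funext => s; rewrite altZE /wedge1 mulr_sumr /=.
by apply: eq_bigr => i _; rewrite covecZl mulrCA -!mulrA.
Qed.

Lemma toC_lin (a : R) u v : toC (a *: u + v) = a%:C%C *: toC u + toC v.
Proof. by rewrite map_mxD map_mxZ. Qed.

Lemma alternating_wedge1 (a : 'rV[C]_m) b : alternating b -> alternating (wedge1 a b).
Proof.
(* An alternating summand is allowed because contracting a wedge also yields a multiple of the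
   wedged form; without it the class would not be stable. *)
move=> hb; apply: (@alternating_coind [set c : alt | exists b1 b2 : alt,
  [/\ alternating b1, alternating b2 & c = b1 + wedge1 a b2]]); last first.
  by exists 0, b; split=> //; [exact: alternating0|rewrite add0r].
move=> c [b1 [b2 [h1 h2 ->]]]; split=> [k u v|u|u].
- rewrite !interiorD !interior_wedge1 !interior_linear // toC_lin covecD covecZ.
  by rewrite wedge1D wedge1Z; alt_ring.
- rewrite interiorD interior_wedge1 !interiorD interiorN interior_wedge1 interiorZ !interior_interior //.
  by rewrite wedge1_0 subr0 subrr addr0.
- exists (interior u b1 + covec a (toC u) *: b2), (- interior u b2); split.
  + by apply: alternatingD; [exact: alternating_interior|exact: alternatingZ].
  + exact/alternatingN/alternating_interior.
  + by rewrite interiorD interior_wedge1 wedge1N addrA.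
Qed.

(** Contracting with [u] turns the identity for [b] into the identity for the contracted form, the
    terms with [covec] cancelling in pairs. *)
Lemma wedge1_anti (a c : 'rV[C]_m) b : wedge1 a (wedge1 c b) = - wedge1 c (wedge1 a b).
Proof.
apply/eqP; rewrite -addr_eq0; apply/eqP/funext => s.
elim: s b => [|u s IH] b; first by rewrite altDE !wedge1_nil addr0.
have := IH (interior u b).
set T := _ + _ => T0; set T' := _ + _.
have -> : T' (u :: s) = (interior u T') s by [].
suff -> : interior u T' = T by [].
rewrite /T' interiorD !interior_wedge1 (wedge1D a (covec c (toC u) *: b)).
rewrite (wedge1D c (covec a (toC u) *: b)) !wedge1N !wedge1Z /T.
clear; move: (wedge1 a (wedge1 c _)) (wedge1 c (wedge1 a _)) (wedge1 _ _) (wedge1 _ _).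
by move=> p q r t; alt_ring.
Qed.

Lemma contractE (X : 'rV[C]_m) b : contract X b =
  interior (map_mx (@complex.Re R) X) b + ('i)%C *: interior (map_mx (@complex.Im R) X) b.
Proof. by []. Qed.

Lemma contractD (X : 'rV[C]_m) b c : contract X (b + c) = contract X b + contract X c.
Proof. by rewrite !contractE !interiorD scalerDr addrACA. Qed.

Lemma contractZ (X : 'rV[C]_m) (k : C) b : contract X (k *: b) = k *: contract X b.
Proof. by rewrite !contractE !interiorZ scalerDr !scalerA mulrC. Qed.

Lemma contractDl (X Y : 'rV[C]_m) b : alternating b ->
  contract (X + Y) b = contract X b + contract Y b.
Proof.
move=> hb; rewrite !contractE.
have -> : map_mx (@complex.Re R) (X + Y) =
   1 *: map_mx (@complex.Re R) X + map_mx (@complex.Re R) Y.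
  by apply/matrixP => i j; rewrite !mxE ReD mul1r.
have -> : map_mx (@complex.Im R) (X + Y) =
   1 *: map_mx (@complex.Im R) X + map_mx (@complex.Im R) Y.
  by apply/matrixP => i j; rewrite !mxE ImD mul1r.
by rewrite !interior_linear // !scale1r scalerDr addrACA.
Qed.

Lemma contractZl (X : 'rV[C]_m) (k : C) b : alternating b ->
  contract (k *: X) b = k *: contract X b.
Proof.
move=> hb; rewrite !contractE.
have Z a u : interior (a *: u) b = a%:C%C *: interior u b.
  have := interior_linear a u 0 hb; rewrite addr0 => ->.
  suff -> : interior 0 b = 0 by rewrite addr0.
  have := interior_linear 1 0 0 hb; rewrite scaler0 addr0 scale1r.
  by move/eqP; rewrite -subr_eq0 opprD addrA subrr sub0r oppr_eq0 => /eqP.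
case: k => p q.
have -> : map_mx (@complex.Re R) ((p +i* q)%C *: X) =
   p *: map_mx (@complex.Re R) X + (- q) *: map_mx (@complex.Im R) X.
  by apply/matrixP => i j; rewrite !mxE ReM mulNr.
have -> : map_mx (@complex.Im R) ((p +i* q)%C *: X) =
   p *: map_mx (@complex.Im R) X + q *: map_mx (@complex.Re R) X.
  by apply/matrixP => i j; rewrite !mxE ImM.
rewrite !interior_linear // !Z !scalerDr !scalerA.
have E1 : (p +i* q)%C * 'i%C = 'i%C * p%:C%C + (- q)%:C%C :> C.
  by apply: complexP; rewrite /= ; ring.
have E2 : (p +i* q)%C = p%:C%C + 'i%C * q%:C%C :> C.
  by apply: complexP; rewrite /= ; ring.
by rewrite E1 E2; alt_ring.
Qed.

Lemma alternating_contract (X : 'rV[C]_m) b : alternating b -> alternating (contract X b).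
Proof.
move=> hb; rewrite contractE; apply: alternatingD; first exact: alternating_interior.
exact/alternatingZ/alternating_interior.
Qed.

Lemma interior_anti u v b : alternating b -> interior u (interior v b) = - interior v (interior u b).
Proof.
move=> hb; apply/eqP; rewrite -addr_eq0; apply/eqP.
have := interior_interior (1 *: u + v) hb.
rewrite (interior_linear _ _ _ (alternating_interior _ hb)) !interior_linear //.
rewrite !scale1r !interiorD !interior_interior // add0r addr0 => <-.
by [].
Qed.

Lemma contract_anti (X Y : 'rV[C]_m) b : alternating b ->
  contract X (contract Y b) = - contract Y (contract X b).
Proof.
move=> hb; rewrite !contractE !interiorD !interiorZ !scalerDr !scalerA.
rewrite (interior_anti _ (map_mx (@complex.Re R) Y)) // (interior_anti _ (map_mx (@complex.Im R) Y)) //.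
rewrite (interior_anti (map_mx (@complex.Im R) X) (map_mx (@complex.Re R) Y)) //.
rewrite (interior_anti (map_mx (@complex.Im R) X) (map_mx (@complex.Im R) Y)) //.
by rewrite !scalerN !opprD -!addrA; congr (_ + _); rewrite addrCA.
Qed.

Lemma contract_wedge1 (X a : 'rV[C]_m) b :
  contract X (wedge1 a b) = covec a X *: b - wedge1 a (contract X b).
Proof.
rewrite !contractE !interior_wedge1 wedge1D wedge1Z !scalerBr opprD.
rewrite addrACA; congr (_ + _); rewrite scalerA -scalerDl; congr (_ *: _).
rewrite -covecZ -covecD; congr (covec _ _); apply/matrixP => i j.
by rewrite !mxE [RHS]complexE.
Qed.

(** Twice the complex bilinear extension of [pairing]: this normalisation removes the factor 2 from
    the Clifford relation. *)
Definition cpair (v w : 'rV[C]_(m + m)) : C :=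
  covec (rsubmx v) (lsubmx w) + covec (rsubmx w) (lsubmx v).

Lemma cpairC (v w : 'rV[C]_(m + m)) : cpair v w = cpair w v.
Proof. exact: addrC. Qed.

Lemma cliffordE (v : 'rV[C]_(m + m)) b :
  clifford v b = contract (lsubmx v) b + wedge1 (rsubmx v) b.
Proof. by []. Qed.

Lemma cliffordD (v : 'rV[C]_(m + m)) b c : clifford v (b + c) = clifford v b + clifford v c.
Proof. by rewrite !cliffordE contractD wedge1D addrACA. Qed.

Lemma cliffordZ (v : 'rV[C]_(m + m)) (k : C) b : clifford v (k *: b) = k *: clifford v b.
Proof. by rewrite !cliffordE contractZ wedge1Z; alt_ring. Qed.

Lemma cliffordN (v : 'rV[C]_(m + m)) b : clifford v (- b) = - clifford v b.
Proof. by rewrite -scaleN1r cliffordZ scaleN1r. Qed.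

Lemma clifford0 (v : 'rV[C]_(m + m)) : clifford v (0 : alt) = 0.
Proof. by have := cliffordZ v 0 0; rewrite !scale0r. Qed.

Lemma clifford_sum (v : 'rV[C]_(m + m)) (I : Type) (r : seq I) (P : pred I) (f : I -> alt) :
  clifford v (\sum_(i <- r | P i) f i) = \sum_(i <- r | P i) clifford v (f i).
Proof. exact: (big_morph (clifford v) (@cliffordD v) (clifford0 v)). Qed.

Lemma cliffordDl (v w : 'rV[C]_(m + m)) b : alternating b ->
  clifford (v + w) b = clifford v b + clifford w b.
Proof.
by move=> hb; rewrite !cliffordE !linearD /= contractDl // wedge1Dl addrACA.
Qed.

Lemma cliffordZl (v : 'rV[C]_(m + m)) (k : C) b : alternating b ->
  clifford (k *: v) b = k *: clifford v b.
Proof.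
by move=> hb; rewrite !cliffordE !linearZ /= contractZl // wedge1Zl; alt_ring.
Qed.

Lemma cliffordNl (v : 'rV[C]_(m + m)) b : alternating b ->
  clifford (- v) b = - clifford v b.
Proof. by move=> hb; rewrite -scaleN1r cliffordZl // scaleN1r. Qed.

Lemma clifford0l b : alternating b -> clifford 0 b = 0.
Proof. by move=> hb; rewrite -(scale0r 0) cliffordZl // scale0r. Qed.

Lemma clifford_suml b (I : Type) (r : seq I) (P : pred I) (f : I -> 'rV[C]_(m + m)) :
  alternating b ->
  clifford (\sum_(i <- r | P i) f i) b = \sum_(i <- r | P i) clifford (f i) b.
Proof.
move=> hb; elim: r => [|i r IH]; first by rewrite !big_nil clifford0l.
by rewrite !big_cons; case: (P i) => //; rewrite cliffordDl // IH.
Qed.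

Lemma alternating_clifford (v : 'rV[C]_(m + m)) b : alternating b -> alternating (clifford v b).
Proof.
by move=> hb; rewrite cliffordE; apply: alternatingD;
  [exact: alternating_contract|exact: alternating_wedge1].
Qed.

(** Contractions anticommute among themselves and so do wedges; only the mixed terms leave a
    scalar. *)
Lemma clifford_rel (v w : 'rV[C]_(m + m)) b : alternating b ->
  clifford v (clifford w b) = cpair v w *: b - clifford w (clifford v b).
Proof.
move=> hb; rewrite !cliffordE !(contractD _ (contract _ b) (wedge1 _ b)).
rewrite !(wedge1D _ (contract _ b) (wedge1 _ b)) !contract_wedge1.
rewrite (contract_anti (lsubmx v)) // (wedge1_anti (rsubmx v)) /cpair scalerDl.
by alt_ring.
Qed.

End AlternatingForms.

(** * Spinors of a linear generalized complex structure *)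

Section Fock.
Variables (R : realType) (m : nat).
Notation C := R[i].
Notation alt := (seq 'rV[R]_m -> C).
Notation vec := 'rV[C]_(m + m).

(** Induction in a Fock space with annihilators [l] and creators [lb]: every form is reached from
    those killed by all annihilators. The index of [P] bounds the number of creators used;
    internally it counts the annihilators not yet known to kill the form. *)
Lemma fock_ind (r : nat) (l lb : 'I_r -> vec) (P : nat -> alt -> Prop) :
  (forall i j, cpair (l i) (l j) = 0) ->
  (forall i j, cpair (l i) (lb j) = (i == j)%:R) ->
  (forall b, alternating b -> (forall i, clifford (l i) b = 0) -> P 0 b) ->
  (forall n i b, alternating b -> (n < r)%N -> P n b -> P n.+1 (clifford (lb i) b)) ->
  (forall n b, (n < r)%N -> P n b -> P n.+1 b) ->
  (forall n b c, alternating b -> alternating c -> P n b -> P n c -> P n (b + c)) ->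
  forall b, alternating b -> P r b.
Proof.
move=> ll llb P0 PS Pw PD.
have main n : (n <= r)%N -> forall b, alternating b ->
    (forall i : 'I_r, (n <= i)%N -> clifford (l i) b = 0) -> P n b.
  elim: n => [|n IH] nr b hb kb.
    by apply: P0 => // i; exact: kb.
  pose j := Ordinal nr.
  have lb_alt := alternating_clifford (lb j) hb.
  have l_alt := alternating_clifford (l j) hb.
  (* The first summand is killed by [l j], whose square is zero, and the second is [lb j] applied to
     a form killed by [l j]. The annihilators that already killed [b] still kill both of these. *)
  have -> : b = clifford (l j) (clifford (lb j) b) + clifford (lb j) (clifford (l j) b).
    by rewrite clifford_rel // llb eqxx scale1r subrK.
  have ani (i k : 'I_r) c : alternating c -> clifford (l i) (clifford (l k) c) =
      - clifford (l k) (clifford (l i) c).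
    by move=> hc; rewrite clifford_rel // ll scale0r sub0r.
  have sq c : alternating c -> clifford (l j) (clifford (l j) c) = 0.
    move=> hc; have /eqP := ani j j c hc; rewrite -addr_eq0 => /eqP E.
    apply: (@scalerI _ _ (2 : C)); first by rewrite pnatr_eq0.
    by rewrite scaler0 -E scaler_nat mulr2n.
  apply: PD.
  - exact: alternating_clifford.
  - exact: alternating_clifford.
  - apply: Pw => //; apply: IH; [exact: ltnW|exact: alternating_clifford|].
    move=> i; rewrite leq_eqVlt => /orP[/eqP ni|ni].
      have -> : i = j by apply/val_inj.
      exact: sq.
    have ij : i != j by rewrite -val_eqE /= gtn_eqF.
    rewrite ani // (clifford_rel _ _ hb) llb (negPf ij) scale0r sub0r.
    by rewrite kb // clifford0 oppr0 clifford0 oppr0.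
  - apply: PS => //; apply: IH; [exact: ltnW|exact: alternating_clifford|].
    move=> i; rewrite leq_eqVlt => /orP[/eqP ni|ni].
      have -> : i = j by apply/val_inj.
      exact: sq.
    by rewrite ani // kb // clifford0 oppr0.
move=> b hb; apply: main => // i; by rewrite leqNgt ltn_ord.
Qed.

Definition altone : alt := fun s => (s == [::])%:R.

Lemma alternating_altone : alternating altone.
Proof.
split=> [s1 s2 a u v|s1 s2 s3 u].
  by case: s1 => [|? ?]; rewrite /altone /= mulr0 addr0.
by case: s1.
Qed.

Lemma cpair_row (X a Y c : 'rV[C]_m) :
  cpair (row_mx X a) (row_mx Y c) = covec a Y + covec c X.
Proof. by rewrite /cpair !row_mxKl !row_mxKr. Qed.

Lemma covec0 (X : 'rV[C]_m) : covec 0 X = 0.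
Proof. by rewrite /covec mul0mx mxE. Qed.

Lemma covec_delta (i j : 'I_m) : covec (delta_mx 0 i) (delta_mx 0 j) = (i == j)%:R :> C.
Proof.
rewrite covec_sum (bigD1 i) //= big1 => [|k /negPf ki]; last by rewrite !mxE ki mul0r.
by rewrite !mxE !eqxx mul1r addr0.
Qed.

Lemma wedge1_0l b : wedge1 (0 : 'rV[C]_m) b = 0.
Proof. by have := wedge1Zl (0 : 'rV[C]_m) 0 b; rewrite !scale0r. Qed.

Lemma contract_delta (i : 'I_m) (b : alt) : alternating b ->
  contract (delta_mx 0 i) b = interior (delta_mx 0 i) b.
Proof.
move=> hb; rewrite contractE.
have -> : map_mx (@complex.Re R) (delta_mx 0 i : 'rV[C]_m) = delta_mx 0 i.
  by apply/matrixP => j k; rewrite !mxE; case: (_ && _).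
have -> : map_mx (@complex.Im R) (delta_mx 0 i : 'rV[C]_m) = 0 *: 0 + 0.
  by apply/matrixP => j k; rewrite !mxE mul0r addr0; case: (_ && _).
rewrite interior_linear // scale0r add0r.
suff -> : interior 0 b = 0 by rewrite scaler0 addr0.
have /eqP := interior_linear 1 0 0 hb; rewrite scaler0 addr0 scale1r.
by rewrite -subr_eq0 opprD addrA subrr sub0r oppr_eq0 => /eqP.
Qed.

Lemma interior_delta_eq0 (b : alt) : alternating b ->
  (forall i : 'I_m, interior (delta_mx 0 i) b = 0) -> b = b [::] *: altone.
Proof.
move=> hb h; apply/funext => -[|u s]; rewrite altZE /altone ?mulr1 //= mulr0.
have -> : b (u :: s) = interior u b s by [].
have E : u = \sum_(i < m) u 0 i *: delta_mx 0 i by exact: rV_sum_delta.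
rewrite E.
elim/big_ind: _ => [|x y hx hy|i _].
- have := interior_linear (-1) 0 0 hb; rewrite scaler0 addr0 => /(congr1 (@^~ s)).
  rewrite altDE altZE => ->.
  have -> : (-1)%:C%C = -1 :> C by apply: complexP; rewrite /= ?oppr0.
  by rewrite mulN1r addNr.
- have := interior_linear 1 x y hb; rewrite scale1r => /(congr1 (@^~ s)).
  by rewrite altDE altZE hx hy mulr0 addr0 => ->.
- have := interior_linear (u 0 i) (delta_mx 0 i) 0 hb; rewrite addr0 => /(congr1 (@^~ s)).
  rewrite altDE altZE h mulr0 add0r => ->.
  have /eqP := interior_linear 1 0 0 hb; rewrite scaler0 addr0 scale1r.
  by rewrite -subr_eq0 opprD addrA subrr sub0r oppr_eq0 => /eqP ->.
Qed.

(** The image of the constant form 1 is killed by all contractions, as 1 is, so it is a multiple of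
    1. Wedging with coordinate covectors generates all forms from 1, and [T] commutes with these
    wedges. *)
Lemma schur (T : alt -> alt) :
  (forall b c, alternating b -> alternating c -> T (b + c) = T b + T c) ->
  (forall k b, alternating b -> T (k *: b) = k *: T b) ->
  (forall b, alternating b -> alternating (T b)) ->
  (forall v b, alternating b -> T (clifford v b) = clifford v (T b)) ->
  forall b, alternating b -> T b = T altone [::] *: b.
Proof.
move=> TD TZ Talt TC b hb.
have T1 : T altone = T altone [::] *: altone.
  apply: interior_delta_eq0 => [|i]; first exact/Talt/alternating_altone.
  rewrite -contract_delta; last exact/Talt/alternating_altone.
  have := TC (row_mx (delta_mx 0 i) 0) altone alternating_altone.
  rewrite !cliffordE row_mxKl row_mxKr !wedge1_0l !addr0 => <-.
  suff -> : contract (delta_mx 0 i) altone = 0.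
    by rewrite -(scale0r altone) TZ ?scale0r //; exact: alternating_altone.
  by rewrite contract_delta; [|exact: alternating_altone].
apply: (@fock_ind m (fun i => row_mx (delta_mx 0 i) 0) (fun i => row_mx 0 (delta_mx 0 i))
  (fun _ b => T b = T altone [::] *: b)) hb.
- by move=> i j; rewrite cpair_row !covec0 addr0.
- by move=> i j; rewrite cpair_row covec0 add0r covec_delta eq_sym.
- move=> c hc kc.
  have -> : c = c [::] *: altone.
    apply: interior_delta_eq0 => // i; have := kc i.
    by rewrite cliffordE row_mxKl row_mxKr wedge1_0l addr0 contract_delta.
  rewrite TZ; last exact: alternating_altone.
  by rewrite {1}T1 !scalerA mulrC.
- by move=> n i c hc _ E; rewrite TC // E cliffordZ.
- by [].
- by move=> n c1 c2 h1 h2 E1 E2; rewrite TD // E1 E2 scalerDr.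
Qed.

End Fock.

Section Spinors.
Variables (R : realType) (m : nat).
Notation C := R[i].
Notation alt := (seq 'rV[R]_m -> C).
Notation vec := 'rV[C]_(m + m).
Implicit Types (b c : alt) (v w : vec).

Definition pairing_mx (F : pzRingType) : 'M[F]_(m + m) := block_mx 0 1%:M 1%:M 0.

Lemma mul_pairing_mx (F : pzRingType) (v : 'rV[F]_(m + m)) :
  v *m pairing_mx F = row_mx (rsubmx v) (lsubmx v).
Proof.
by rewrite -{1}[v]hsubmxK mul_row_block !mulmx0 !mulmx1 add0r addr0.
Qed.

Lemma pairing_mxK (F : pzRingType) : pairing_mx F *m pairing_mx F = 1%:M.
Proof.
by rewrite mulmx_block !mulmx0 !mul0mx !mulmx1 !addr0 !add0r -scalar_mx_block.
Qed.

Lemma cpairE v w : cpair v w = (v *m pairing_mx C *m w^T) 0 0.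
Proof.
rewrite mul_pairing_mx -{2}[w]hsubmxK tr_row_mx mul_row_col mxE /cpair.
by rewrite [X in _ + X]covecC.
Qed.

Lemma pairingE (v w : 'rV[R]_(m + m)) :
  pairing v w = 2^-1 * (v *m pairing_mx R *m w^T) 0 0.
Proof.
rewrite mul_pairing_mx -[in w^T](hsubmxK w) tr_row_mx mul_row_col mxE /pairing.
by rewrite [X in _ + X]covecC.
Qed.

Lemma cpairD v v' w : cpair (v + v') w = cpair v w + cpair v' w.
Proof. by rewrite !cpairE !mulmxDl mxE. Qed.
Lemma cpairZ (k : C) v w : cpair (k *: v) w = k * cpair v w.
Proof. by rewrite !cpairE -!scalemxAl mxE. Qed.
Lemma cpairDr v w w' : cpair v (w + w') = cpair v w + cpair v w'.
Proof. by rewrite cpairC cpairD !(cpairC v). Qed.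
Lemma cpairZr (k : C) v w : cpair v (k *: w) = k * cpair v w.
Proof. by rewrite cpairC cpairZ (cpairC v). Qed.

Lemma cpair_nondeg v : (forall w, cpair w v = 0) -> v = 0.
Proof.
move=> h; have E : pairing_mx C *m v^T = 0.
  apply/matrixP => i j; rewrite ord1 [RHS]mxE.
  by have := h (delta_mx 0 i); rewrite cpairE -mulmxA -rowE mxE.
have : pairing_mx C *m (pairing_mx C *m v^T) = 0 by rewrite E mulmx0.
by rewrite mulmxA pairing_mxK mul1mx => /(congr1 trmx); rewrite trmxK trmx0.
Qed.

Lemma rV_sum_deltaC n (w : 'rV[C]_n) : w = \sum_k w 0 k *: delta_mx 0 k.
Proof. by rewrite {1}[w]matrix_sum_delta big_ord1. Qed.

Lemma clifford2D v w b c :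
  clifford v (clifford w (b + c)) = clifford v (clifford w b) + clifford v (clifford w c).
Proof. by rewrite !cliffordD. Qed.

Lemma clifford2Z v w k b :
  clifford v (clifford w (k *: b)) = k *: clifford v (clifford w b).
Proof. by rewrite !cliffordZ. Qed.

Lemma clifford3 v v' w b : alternating b ->
  clifford v (clifford v' (clifford w b)) = clifford w (clifford v (clifford v' b)) +
  cpair v' w *: clifford v b - cpair v w *: clifford v' b.
Proof.
move=> hb; rewrite (clifford_rel v' w hb) (cliffordD v) (cliffordZ v) (cliffordN v).
by rewrite (clifford_rel v w (alternating_clifford v' hb)) opprB addrCA addrA.
Qed.

Section OneStructure.
Variable J : 'M[R]_(m + m).
Hypothesis J2 : J *m J = - 1%:M.
Hypothesis Jorth : forall v w : 'rV[R]_(m + m), pairing (v *m J) (w *m J) = pairing v w.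

Notation JC := (map_mx (real_complex R) J).

(** With P the matrix of the pairing, orthogonality reads J P J^T = P; multiplying by [J] and using
    J^2 = -1 turns it into skewness. *)
Lemma skew_mx : J *m pairing_mx R = - (pairing_mx R *m J^T).
Proof.
have E : J *m pairing_mx R *m J^T = pairing_mx R.
  apply/matrixP => i j.
  have := Jorth (delta_mx 0 i) (delta_mx 0 j); rewrite !pairingE => /mulfI.
  rewrite invr_eq0 pnatr_eq0 => /(_ isT).
  rewrite trmx_mul trmx_delta -!rowE !mulmxA => E0.
  have F (M : 'M[R]_(m + m)) : (row i M *m delta_mx j 0) 0 0 = M i j.
    rewrite mxE (bigD1 j) //= !mxE !eqxx mulr1 big1 ?addr0 // => k kj.
    by rewrite !mxE (negPf kj) mulr0.
  by move: E0; rewrite -(row_mul i J) -(row_mul i (J *m _)) !F.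
have := congr1 (mulmx J) E; rewrite !mulmxA J2 mulNmx mul1mx mulNmx => <-.
by [].
Qed.

Lemma JC2 : JC *m JC = - 1%:M.
Proof. by rewrite -map_mxM J2 map_mxN map_mx1. Qed.

Lemma cpair_skew v w : cpair (v *m JC) w = - cpair v (w *m JC).
Proof.
have E : JC *m pairing_mx C = - (pairing_mx C *m JC^T).
  have Q : pairing_mx C = map_mx (real_complex R) (pairing_mx R).
    by rewrite /pairing_mx map_block_mx !map_mx0 !map_mx1.
  by rewrite Q -map_mxM skew_mx map_mxN map_mxM map_trmx.
rewrite !cpairE -(mulmxA v) E mulmxN mulNmx mxE; congr (- _).
by rewrite trmx_mul !mulmxA.
Qed.

Fact proj_key : unit. Proof. exact: tt. Qed.

(** The spectral projection of [J], acting on row vectors from the right, for the eigenvalue i;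
    [projLbar] is the one for -i. *)
Definition projL : 'M[C]_(m + m) := locked_with proj_key (2^-1 *: (1%:M - 'i%C *: JC)).
Definition projLbar : 'M[C]_(m + m) := locked_with proj_key (2^-1 *: (1%:M + 'i%C *: JC)).

Lemma projLE : projL = 2^-1 *: (1%:M - 'i%C *: JC). Proof. exact: unlock. Qed.
Lemma projLbarE : projLbar = 2^-1 *: (1%:M + 'i%C *: JC). Proof. exact: unlock. Qed.

Lemma ii : 'i%C * 'i%C = -1 :> C.
Proof. by rewrite -expr2 sqr_i. Qed.

Lemma half_double v : (2^-1 : C) *: (v + v) = v.
Proof.
have n2 : (2 : C) != 0 by rewrite pnatr_eq0.
by apply/matrixP => i j; rewrite !mxE; field.
Qed.

Lemma projLJ v : in_L J (v *m projL).
Proof.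
rewrite /in_L projLE -scalemxAr -scalemxAl scalerA mulrC -scalerA; congr (_ *: _).
rewrite -mulmxA mulmxBl mul1mx -scalemxAl JC2 scalerN opprK.
by rewrite scalemxAr scalerBr scalerA ii scaleN1r opprK addrC scalemx1.
Qed.

Lemma in_LbarE v : in_Lbar J v <-> v *m JC = - 'i%C *: v.
Proof.
have cj : map_mx (@conjc R) JC = JC.
  by apply/matrixP => i j; rewrite !mxE conjc_real.
have ci : (@conjc R) 'i%C = - 'i%C by apply: complexP; rewrite /= ?oppr0.
have conjZ (k : C) (M : vec) :
    map_mx (@conjc R) (k *: M) = conjc k *: map_mx (@conjc R) M.
  by apply/matrixP => i j; rewrite !mxE rmorphM.
have ck (M : vec) : map_mx (@conjc R) (map_mx (@conjc R) M) = M.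
  by apply/matrixP => i j; rewrite !mxE conjcK.
split; rewrite /in_Lbar /in_L => E.
  have := congr1 (map_mx (@conjc R)) E.
  by rewrite map_mxM cj conjZ !ck ci.
by rewrite -{1}cj -map_mxM E conjZ rmorphN; congr (_ *: _); rewrite -[RHS]opprK -ci.
Qed.

Lemma projLbarJ v : in_Lbar J (v *m projLbar).
Proof.
apply/in_LbarE.
rewrite projLbarE -scalemxAr -scalemxAl scalerA mulrC -scalerA; congr (_ *: _).
rewrite -mulmxA mulmxDl mul1mx -scalemxAl JC2 scalerN.
by rewrite scalemxAr scalerDr scalerA mulNr ii opprK scale1r scaleNr addrC scalemx1.
Qed.

Lemma projD v : v *m projL + v *m projLbar = v.
Proof.
rewrite -mulmxDr projLE projLbarE -scalerDr addrACA addNr addr0.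
by rewrite -scalemxAr mulmxDr mulmx1 half_double.
Qed.

Lemma L_projL v : in_L J v -> v *m projL = v.
Proof.
rewrite /in_L => E; rewrite projLE -scalemxAr mulmxBr mulmx1 -scalemxAr E.
by rewrite scalerA ii scaleN1r opprK half_double.
Qed.

Lemma L_projLbar v : in_L J v -> v *m projLbar = 0.
Proof.
move=> /L_projL E; have := projD v; rewrite E => /(congr1 (+%R (- v))).
by rewrite addrA addNr add0r.
Qed.

Lemma Lbar_projLbar v : in_Lbar J v -> v *m projLbar = v.
Proof.
move=> /in_LbarE E; rewrite projLbarE -scalemxAr mulmxDr mulmx1 -scalemxAr E.
by rewrite scalerA mulrN ii opprK scale1r half_double.
Qed.

Lemma Lbar_projL v : in_Lbar J v -> v *m projL = 0.
Proof.
move=> /Lbar_projLbar E; have := projD v; rewrite E => /(congr1 (+%R^~ (- v))).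
by rewrite /= addrK subrr.
Qed.

(** Skewness of [J] makes the two spectral projections adjoint to each other. Isotropy of L, and the
    duality between L and its conjugate, come from this. *)
Lemma cpair_projLbar v w : cpair (v *m projLbar) w = cpair v (w *m projL).
Proof.
rewrite projLE projLbarE -!scalemxAr cpairZ cpairZr; congr (_ * _).
rewrite mulmxDr mulmxBr !mulmx1 -!scalemxAr cpairD cpairZ cpairDr; congr (_ + _).
by rewrite cpair_skew -scaleNr cpairZr mulrN mulNr.
Qed.

Lemma cpair_projL v w : cpair (v *m projL) w = cpair v (w *m projLbar).
Proof. by rewrite cpairC -cpair_projLbar cpairC. Qed.

Lemma L_isotropic v w : in_L J v -> in_L J w -> cpair v w = 0.
Proof.
move=> hv hw; rewrite -(L_projL hv) cpair_projL (L_projLbar hw).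
by rewrite -(scale0r 0) cpairZr mul0r.
Qed.

Fact numop_key : unit. Proof. exact: tt. Qed.

(* Sealed, as unification would otherwise unfold it against sums of functions. *)
Definition numop b : alt := locked_with numop_key (\sum_(a < m + m)
  clifford (delta_mx 0 a *m projLbar) (clifford (delta_mx 0 a *m pairing_mx C *m projL) b)).

Lemma numopE b : numop b = \sum_(a < m + m)
  clifford (delta_mx 0 a *m projLbar) (clifford (delta_mx 0 a *m pairing_mx C *m projL) b).
Proof. exact: unlock. Qed.

Lemma alternating_numop b : alternating b -> alternating (numop b).
Proof.
by move=> hb; rewrite numopE; apply: alternating_sum => a _; do 2!apply: alternating_clifford.
Qed.

Lemma numopD b c : numop (b + c) = numop b + numop c.
Proof. by rewrite !numopE -big_split; apply: eq_bigr => a _; exact: clifford2D. Qed.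

Lemma numopZ (k : C) b : numop (k *: b) = k *: numop b.
Proof. by rewrite !numopE scaler_sumr; apply: eq_bigr => a _; exact: clifford2Z. Qed.

Lemma sum_cpair_dual w :
  \sum_a cpair (delta_mx 0 a *m pairing_mx C) w *: delta_mx 0 a = w.
Proof.
rewrite [RHS]rV_sum_deltaC; apply: eq_bigr => a _; congr (_ *: _).
by rewrite cpairE -(mulmxA (delta_mx _ _)) pairing_mxK mulmx1 -rowE !mxE.
Qed.

Lemma sum_cpair w :
  \sum_a cpair (delta_mx 0 a) w *: (delta_mx 0 a *m pairing_mx C) = w.
Proof.
have {2}-> : w = w *m pairing_mx C *m pairing_mx C by rewrite -mulmxA pairing_mxK mulmx1.
rewrite [in RHS](rV_sum_deltaC (w *m _)) mulmx_suml; apply: eq_bigr => a _.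
rewrite -scalemxAl; congr (_ *: _).
by rewrite cpairC cpairE trmx_delta -colE mxE.
Qed.

(** The vectors [delta_mx 0 a] and [delta_mx 0 a *m pairing_mx m C] form dual bases for [cpair], so
    commuting [w] past the products in [numop] reassembles its two components: the conjugate part
    raises the eigenvalue by one, the L part lowers it. Summing over dual bases of the whole bundle
    avoids choosing a frame of L, which keeps [numop] explicit in [J]. *)
Lemma numop_clifford w b : alternating b ->
  numop (clifford w b) = clifford w (numop b) +
   clifford (w *m projLbar) b - clifford (w *m projL) b.
Proof.
move=> hb.
pose v a : vec := delta_mx 0 a *m projLbar.
pose v' a : vec := delta_mx 0 a *m pairing_mx C *m projL.
transitivity (\sum_a clifford w (clifford (v a) (clifford (v' a) b)) +
  \sum_a (cpair (v' a) w *: clifford (v a) b) - \sum_a (cpair (v a) w *: clifford (v' a) b)).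
  rewrite numopE -big_split -sumrB; apply: eq_bigr => a _; exact: clifford3.
congr (_ + _ - _).
- by rewrite numopE clifford_sum.
- have -> : w *m projLbar = \sum_a cpair (v' a) w *: v a.
    rewrite -{1}(Lbar_projLbar (projLbarJ w)) -{1}(sum_cpair_dual (w *m _)) mulmx_suml.
    by apply: eq_bigr => a _; rewrite -scalemxAl -cpair_projL.
  by rewrite (clifford_suml _ _ _ hb); apply: eq_bigr => a _; rewrite (cliffordZl _ _ hb).
- have -> : w *m projL = \sum_a cpair (v a) w *: v' a.
    rewrite -{1}(L_projL (projLJ w)) -{1}(sum_cpair (w *m _)) mulmx_suml.
    by apply: eq_bigr => a _; rewrite -scalemxAl -cpair_projLbar.
  by rewrite (clifford_suml _ _ _ hb); apply: eq_bigr => a _; rewrite (cliffordZl _ _ hb).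
Qed.

Lemma numop_L w b : alternating b -> in_L J w ->
  numop (clifford w b) = clifford w (numop b) - clifford w b.
Proof.
move=> hb hw; rewrite (numop_clifford w hb) (L_projL hw) (L_projLbar hw).
by rewrite (clifford0l hb) [_ + 0]addr0.
Qed.

Lemma numop_Lbar w b : alternating b -> in_Lbar J w ->
  numop (clifford w b) = clifford w (numop b) + clifford w b.
Proof.
move=> hb hw; rewrite (numop_clifford w hb) (Lbar_projL hw) (Lbar_projLbar hw).
by rewrite (clifford0l hb) [_ - 0]subr0.
Qed.

Lemma numop_killed b : (forall w, in_L J w -> clifford w b = 0) -> numop b = 0.
Proof.
move=> h; rewrite numopE big1 // => a _.
by rewrite [X in clifford _ X]h ?clifford0 //; exact: projLJ.
Qed.

(** Each creator adds one to the eigenvalue, starting from 0 on the vacuum. *)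
Lemma numop_foldr (vs : seq vec) c : alternating c ->
  (forall v, v \in vs -> in_Lbar J v) -> numop c = 0 ->
  numop (foldr (@clifford R m) c vs) = (size vs)%:R *: foldr (@clifford R m) c vs.
Proof.
move=> hc; elim: vs => [|v vs IH] hvs Nc /=; first by rewrite scale0r.
rewrite numop_Lbar; last first.
- by apply: hvs; rewrite mem_head.
- by elim: (vs) => //= w ws; exact: alternating_clifford.
rewrite IH //; last by move=> w hw; apply: hvs; rewrite in_cons hw orbT.
by rewrite cliffordZ mulrSr scalerDl scale1r.
Qed.

Lemma numop_spin k b : spin J k b -> numop b = k%:R *: b.
Proof.
move=> [n [vs [phi [hs hv h E]]]].
have -> : b = \sum_j foldr (@clifford R m) (phi j) (vs j).
  by apply/funext => s; rewrite E alt_sumE.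
rewrite (big_morph numop numopD (numop_killed (fun w _ => clifford0 w))) scaler_sumr.
apply: eq_bigr => j _; have [halt _ hk] := h j.
rewrite numop_foldr ?hs //; first exact: hv.
by apply: numop_killed => w /hk.
Qed.

End OneStructure.
End Spinors.

(** * Eigenspace decomposition for the number operator, parity and filtration *)

Section SpinDecomposition.
Variables (R : realType) (m : nat).
Notation C := R[i].
Notation alt := (seq 'rV[R]_m -> C).
Notation vec := 'rV[C]_(m + m).
Implicit Types (b c : alt) (v w : vec).
Variable J : 'M[R]_(m + m).
Hypothesis J2 : J *m J = - 1%:M.
Hypothesis Jorth : forall v w : 'rV[R]_(m + m), pairing (v *m J) (w *m J) = pairing v w.
Notation JC := (map_mx (real_complex R) J).

Lemma negone_neq_nat j : (-1 : C) != j%:R.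
Proof. by rewrite -subr_eq0 -opprD oppr_eq0 addrC natr1 pnatr_eq0. Qed.

Lemma projLbar_conj : projLbar J = map_mx (@conjc R) (projL J).
Proof.
apply/matrixP => i j; rewrite projLE projLbarE !mxE rmorphM fmorphV rmorph_nat.
by congr (_ * _); case: (i == j); apply: complexP => /=; ring.
Qed.

(** The two projections are complex conjugate, hence of equal rank; their sum is the identity, which
    bounds the sum of the ranks below by 2m, and their product is zero, which bounds it above by
    2m. *)
Lemma rank_projL : \rank (projL J) = m.
Proof.
have e1 : \rank (projLbar J) = \rank (projL J).
  by rewrite projLbar_conj mxrank_map.
have s1 : projL J + projLbar J = 1%:M.
  apply/row_matrixP => i; rewrite !rowE mulmxDr mulmx1; exact: projD.
have p0 : projL J *m projLbar J = 0.
  apply/row_matrixP => i; rewrite rowE mulmxA row0; apply: L_projLbar.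
  exact: projLJ.
have := mxrank_add (projL J) (projLbar J); rewrite s1 mxrank1 e1.
have := mulmx0_rank_max p0; rewrite e1 => h1 h2.
have : (\rank (projL J) + \rank (projL J) = m + m)%N.
  by apply/eqP; rewrite eqn_leq h1 h2.
by move=> _; apply/eqP; rewrite eqn_leq -leq_double -[(m <= _)%N]leq_double -!addnn h1 h2.
Qed.

(** A basis of L and the dual basis of its conjugate. Together they satisfy the canonical
    anticommutation relations required by [fock_ind]. *)
Lemma L_frame : exists l lb : 'I_m -> vec,
  [/\ forall i, in_L J (l i), forall i, in_Lbar J (lb i),
      forall i j, cpair (l i) (lb j) = (i == j)%:R &
      forall v, in_L J v -> exists u : 'I_m -> C, v = \sum_i u i *: l i].
Proof.
(* The row base is naturally indexed by the rank; the index type is changed only once the rank is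
   known to be [m]. *)
suff : exists l lb : 'I_(\rank (projL J)) -> vec,
    [/\ forall i, in_L J (l i), forall i, in_Lbar J (lb i),
      forall i j, cpair (l i) (lb j) = (i == j)%:R &
      forall v, in_L J v -> exists u : 'I_(\rank (projL J)) -> C, v = \sum_i u i *: l i].
  by rewrite rank_projL.
pose A := row_base (projL J).
have AL i : in_L J (row i A).
  have /submxP[y ->] : (row i A <= projL J)%MS.
    by apply: submx_trans (row_sub i A) _; rewrite eq_row_base.
  exact: projLJ.
have AE v : in_L J v -> exists y : 'rV_(\rank (projL J)), v = y *m A.
  move=> /L_projL E.
  by apply/submxP; rewrite eq_row_base -E submxMl.
pose Ab := map_mx (@conjc R) A.
have conjvK (M : vec) : map_mx (@conjc R) (map_mx (@conjc R) M) = M.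
  by apply/matrixP => i j; rewrite !mxE conjcK.
have AbL i : in_Lbar J (row i Ab).
  by rewrite /in_Lbar -map_row conjvK; exact: AL.
have AbE v : in_Lbar J v -> exists y : 'rV_(\rank (projL J)), v = y *m Ab.
  move=> /AE[y E]; exists (map_mx (@conjc R) y).
  by rewrite -[LHS]conjvK E map_mxM.
pose G : 'M[C]_(\rank (projL J)) := A *m pairing_mx m C *m Ab^T.
have LbarM (u : 'rV_(\rank (projL J))) : in_Lbar J (u *m Ab).
  rewrite mulmx_sum_row; apply/in_LbarE; rewrite mulmx_suml scaler_sumr.
  by apply: eq_bigr => i _; rewrite -scalemxAl (in_LbarE _ _).1 // !scalerA mulrC.
have LM (u : 'rV_(\rank (projL J))) : in_L J (u *m A).
  rewrite mulmx_sum_row /in_L mulmx_suml scaler_sumr.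
  by apply: eq_bigr => i _; rewrite -scalemxAl AL !scalerA mulrC.
(* A vector [u] in the kernel of the Gram matrix gives an element [u *m A] of L orthogonal to the
   conjugate of L, and to L itself by isotropy. Nondegeneracy makes it zero, and the rows of [A] are
   independent. *)
have Gu : G \in unitmx.
  rewrite -row_free_unit; apply/row_freeP.
  suff : kermx G = 0.
    by move/eqP; rewrite kermx_eq0 => /row_freeP.
  apply/row_matrixP => i; rewrite row0; set u := row i _.
  have uG : u *m G = 0 by rewrite /u -row_mul mulmx_ker row0.
  have uA : u *m A = 0.
    apply: cpair_nondeg => w; rewrite -(projD J w) cpairD.
    rewrite (L_isotropic J2 Jorth (projLJ J2 w) (LM u)) add0r cpairC.
    have [y ->] := AbE _ (projLbarJ J2 w).
    have E : u *m A *m pairing_mx m C *m Ab^T = u *m G by rewrite /G !mulmxA.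
    rewrite cpairE trmx_mul mulmxA.
    by rewrite E uG mul0mx mxE.
  have /row_freeP[B AB] : row_free A by exact: row_base_free.
  by rewrite -[u]mulmx1 -AB mulmxA uA mul0mx.
(* The inverse transposed Gram matrix turns the conjugate basis into the dual one. *)
exists (fun i => row i A), (fun i => row i ((invmx G)^T *m Ab)).
split=> //.
- by move=> i; rewrite row_mul; exact: LbarM.
- move=> i j; rewrite cpairE tr_row trmx_mul trmxK.
  have -> : (row i A *m pairing_mx m C *m col j (Ab^T *m invmx G)) 0 0 =
     (A *m pairing_mx m C *m Ab^T *m invmx G) i j.
    rewrite -(mulmxA (A *m _)) [LHS]mxE [RHS]mxE; apply: eq_bigr => k _.
    by rewrite -row_mul [row _ _ _ _]mxE [col _ _ _ _]mxE.
  by rewrite -/G mulmxV // mxE.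
- move=> v /AE[y ->]; exists (fun i => y 0 i); exact: mulmx_sum_row.
Qed.

(** L is maximal isotropic: if [v] kills [phi], so does its conjugate component, and two elements
    killing a nonzero form are orthogonal by the Clifford relation. That component is thus
    orthogonal to L, and to the conjugate of L by isotropy, so it vanishes. *)
Lemma spans_PhiP (phi : alt) : alternating phi -> phi <> 0 ->
  (forall w, in_L J w -> clifford w phi = 0) -> spans_Phi J phi.
Proof.
move=> hphi nz hL; split=> // v; split; first exact: hL.
move=> v0.
have z : clifford (v *m projLbar J) phi = 0.
  have : clifford (v *m projL J + v *m projLbar J) phi = 0 by rewrite projD.
  by rewrite (cliffordDl _ _ hphi) (hL _ (projLJ J2 v)) add0r.
have kk w : clifford w phi = 0 -> cpair w (v *m projLbar J) = 0.
  move=> w0; have := clifford_rel w (v *m projLbar J) hphi.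
  rewrite z w0 clifford0 clifford0 subr0 => /esym/eqP.
  by rewrite scaler_eq0 => /orP[/eqP //|/eqP /nz].
suff E : v *m projLbar J = 0.
  by rewrite -(projD J v) E addr0; exact: projLJ.
apply: cpair_nondeg => w; rewrite -(projD J w) cpairD.
rewrite kk; last exact: hL (projLJ J2 w).
rewrite cpair_projLbar // add0r.
by rewrite (Lbar_projL (projLbarJ J2 v)) -(scale0r 0) cpairZr mul0r.
Qed.

Lemma spin_0 k : spin J k (0 : alt).
Proof.
exists 0%N, (fun=> [::]), (fun=> 0); split; try by case.
by move=> s; rewrite big_ord0.
Qed.

Lemma spinD k b c : spin J k b -> spin J k c -> spin J k (b + c).
Proof.
move=> [n1 [vs1 [p1 [a1 b1 c1 d1]]]] [n2 [vs2 [p2 [a2 b2 c2 d2]]]].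
pose g T (f1 : 'I_n1 -> T) (f2 : 'I_n2 -> T) (j : 'I_(n1 + n2)) :=
  match fintype.split j with inl i => f1 i | inr i => f2 i end.
exists (n1 + n2)%N, (g _ vs1 vs2), (g _ p1 p2); split.
- by move=> j; rewrite /g; case: (fintype.split j).
- by move=> j v; rewrite /g; case: (fintype.split j) => i; [exact: b1|exact: b2].
- by move=> j; rewrite /g; case: (fintype.split j).
move=> s; rewrite altDE d1 d2 big_split_ord /=; congr (_ + _);
  apply: eq_bigr => i _.
- by rewrite /g -[lshift _ _]/(unsplit (inl i)) unsplitK.
- by rewrite /g -[rshift _ _]/(unsplit (inr i)) unsplitK.
Qed.

Lemma spin_clifford k w b : in_Lbar J w -> spin J k b -> spin J k.+1 (clifford w b).
Proof.
move=> hw [n [vs [phi [hs hv h E]]]].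
exists n, (fun j => w :: vs j), phi; split=> //.
- by move=> j /=; rewrite hs.
- by move=> j v; rewrite in_cons => /orP[/eqP -> //|]; exact: hv.
have -> : b = \sum_j foldr (@clifford R m) (phi j) (vs j).
  by apply/funext => s; rewrite E alt_sumE.
by move=> s; rewrite clifford_sum alt_sumE.
Qed.

Lemma spin_killed b : alternating b -> (forall w, in_L J w -> clifford w b = 0) -> spin J 0 b.
Proof.
move=> hb hL; have [->|nz] := pselect (b = 0); first exact: spin_0.
exists 1%N, (fun=> [::]), (fun=> b); split=> //.
- by move=> _; exact: spans_PhiP.
- by move=> s; rewrite big_ord1.
Qed.

(** Fock induction on a frame of L: forms killed by L lie in the lowest component, and a creator
    shifts all components by one. *)
Lemma spin_decompose b : alternating b -> exists e, spin_decomposition J b e.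
Proof.
have [l [lb [hl hlb llb lE]]] := L_frame.
move=> hb.
suff [e [he E]] : exists e : nat -> alt, (forall k, (k <= m)%N -> spin J k (e k)) /\
    b = \sum_(k < m.+1) e k.
  by exists e; split=> // s; rewrite E alt_sumE.
apply: (@fock_ind R m m l lb (fun n b => exists e : nat -> alt,
  (forall k, (k <= n)%N -> spin J k (e k)) /\ b = \sum_(k < n.+1) e k)) hb.
- by move=> i j; apply: (L_isotropic J2 Jorth).
- exact: llb.
- move=> c hc kc; exists (fun=> c); split; last by rewrite big_ord1.
  move=> k; rewrite leqn0 => /eqP ->; apply: spin_killed => // w /lE[u ->].
  rewrite (clifford_suml _ _ _ hc) big1 // => i _.
  by rewrite (cliffordZl _ _ hc) kc scaler0.
- move=> n i c hc _ [e [he ->]].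
  exists (fun k => if k is k'.+1 then clifford (lb i) (e k') else 0); split.
    case=> [_|k nk]; first exact: spin_0.
    by apply: spin_clifford => //; exact: he.
  by rewrite clifford_sum [RHS]big_ord_recl /= add0r.
- move=> n c _ [e [he ->]]; exists (fun k => if k == n.+1 then 0 else e k); split.
    move=> k; rewrite leq_eqVlt; case: eqP => [->|_ /= /he //]; first by move=> _; exact: spin_0.
  rewrite [RHS]big_ord_recr /= eqxx addr0; apply: eq_bigr => k _.
  by rewrite ltn_eqF // ltn_ord.
- move=> n c1 c2 _ _ [e1 [h1 ->]] [e2 [h2 ->]].
  exists (fun k => e1 k + e2 k); split; last by rewrite big_split.
  by move=> k nk; apply: spinD; [exact: h1|exact: h2].
Qed.

(** A factor of the Lagrange polynomial that is 1 at [k] and 0 at the other eigenvalues. Evaluated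
    at the number operator, the product of these factors is the spectral projection; it is linear in
    the form, and smooth when [J] is. *)
Definition lagrange (k j : nat) b : alt :=
  (k%:R - j%:R)^-1 *: (numop J b - j%:R *: b).

Fact spart_key : unit. Proof. exact: tt. Qed.

Definition spart (k : nat) b : alt := locked_with spart_key
  (foldr (fun j c => if j == k then c else lagrange k j c) b (index_iota 0 m.+1)).

Lemma spartE k b : spart k b =
  foldr (fun j c => if j == k then c else lagrange k j c) b (index_iota 0 m.+1).
Proof. exact: unlock. Qed.

Lemma lagrangeD k j b c : lagrange k j (b + c) = lagrange k j b + lagrange k j c.
Proof. by rewrite /lagrange numopD (scalerDr j%:R) opprD addrACA [LHS]scalerDr. Qed.

Lemma lagrangeZ k j (x : C) b : lagrange k j (x *: b) = x *: lagrange k j b.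
Proof.
rewrite /lagrange numopZ scalerA (mulrC _ x) -scalerA -scalerBr.
by rewrite scalerA (mulrC _ x) -scalerA.
Qed.

Lemma spartD k b c : spart k (b + c) = spart k b + spart k c.
Proof.
rewrite !spartE; elim: (index_iota _ _) => [//|j s IH] /=.
by case: ifP => _; rewrite IH // lagrangeD.
Qed.

Lemma spartZ k (x : C) b : spart k (x *: b) = x *: spart k b.
Proof.
rewrite !spartE; elim: (index_iota _ _) => [//|j s IH] /=.
by case: ifP => _; rewrite IH // lagrangeZ.
Qed.

Lemma spart0 k : spart k (0 : alt) = 0.
Proof. by have := spartZ k 0 0; rewrite !scale0r. Qed.

Lemma spartN k b : spart k (- b) = - spart k b.
Proof. by rewrite -scaleN1r spartZ scaleN1r. Qed.

Lemma spart_sum k (I : Type) (r : seq I) (P : pred I) (f : I -> alt) :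
  spart k (\sum_(i <- r | P i) f i) = \sum_(i <- r | P i) spart k (f i).
Proof. exact: (big_morph (spart k) (spartD k) (spart0 k)). Qed.

Lemma alternating_spart k b : alternating b -> alternating (spart k b).
Proof.
rewrite spartE => hb; elim: (index_iota _ _) => [//|j s IH] /=.
case: ifP => _ //; apply: alternatingZ; apply: alternatingD; first exact: alternating_numop.
exact/alternatingN/alternatingZ.
Qed.

Lemma spart_eig i k b : numop J b = i%:R *: b -> (i <= m)%N ->
  spart k b = if i == k then b else 0.
Proof.
move=> E im.
have [y [Ey Hy]] : exists y : C, spart k b = y *: b /\
    y = \prod_(j <- index_iota 0 m.+1 | j != k) ((k%:R - j%:R)^-1 * (i%:R - j%:R)).
  rewrite !spartE; elim: (index_iota _ _) => [|j s [y [Ey Hy]]] /=.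
    by exists 1; rewrite scale1r big_nil.
  rewrite big_cons Ey -Hy; case: ifP => _ /=; first by exists y.
  exists ((k%:R - j%:R)^-1 * (i%:R - j%:R) * y); split=> //.
  by rewrite /lagrange numopZ E !scalerA -scalerBl scalerA -mulrA (mulrC y) mulrBl.
rewrite Ey Hy; case: eqP => [<-|/eqP ik].
  rewrite big1 ?scale1r // => j ji; rewrite mulVf // subr_eq0 eqr_nat.
  by rewrite eq_sym.
(* The factor with index [i] occurs because [i <= m] and [i] differs from [k], and it vanishes at
   the eigenvalue [i]. *)
rewrite (big_rem i) /=; last by rewrite mem_index_iota.
by rewrite ik subrr mulr0 mul0r scale0r.
Qed.

Lemma spart_spin i k b : spin J i b -> (i <= m)%N -> spart k b = if i == k then b else 0.
Proof. by move=> /(numop_spin J2 Jorth); exact: spart_eig. Qed.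

Lemma spart_decomposition b e k : spin_decomposition J b e -> (k <= m)%N -> spart k b = e k.
Proof.
move=> [he E] km.
have -> : b = \sum_(k < m.+1) e k by apply/funext => s; rewrite E alt_sumE.
rewrite spart_sum (bigD1 (Ordinal (km : (k < m.+1)%N))) //= big1 ?addr0.
  by rewrite (spart_spin _ (he _ km)) // eqxx.
move=> i ik; have im : (i <= m)%N by rewrite -ltnS.
rewrite (spart_spin _ (he _ im)) //; case: eqP => // ik'.
by move/eqP: ik; case; apply/val_inj.
Qed.

(** Every decomposition has the components given by the polynomial projections, so it is unique and
    the choice made in [spin_proj] is immaterial. *)
Lemma spin_projE k b : alternating b -> (k <= m)%N -> spin_proj J k b = spart k b.
Proof.
move=> hb km; rewrite /spin_proj; case: pselect => [ex|[]]; last exact: spin_decompose.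
by case: cid => e /= he; rewrite (spart_decomposition he).
Qed.

Lemma spin_spart k b : alternating b -> (k <= m)%N -> spin J k (spart k b).
Proof.
move=> hb km; have [e he] := spin_decompose hb.
by rewrite (spart_decomposition he) //; exact: he.1.
Qed.

Lemma spart_total b : alternating b -> b = \sum_(k < m.+1) spart k b.
Proof.
move=> hb; have [e he] := spin_decompose hb.
apply/funext => s; rewrite he.2 alt_sumE; apply: eq_bigr => k _.
by rewrite (spart_decomposition he) // -ltnS.
Qed.

Lemma numop_spart k b : alternating b -> (k <= m)%N ->
  numop J (spart k b) = k%:R *: spart k b.
Proof. by move=> hb km; apply: (numop_spin J2 Jorth); exact: spin_spart. Qed.

Lemma spart_spart i k b : alternating b -> (i <= m)%N ->
  spart k (spart i b) = if i == k then spart i b else 0.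
Proof. by move=> hb im; apply: spart_spin => //; exact: spin_spart. Qed.

Lemma numop_sum (I : Type) (r : seq I) (P : pred I) (f : I -> alt) :
  numop J (\sum_(i <- r | P i) f i) = \sum_(i <- r | P i) numop J (f i).
Proof.
apply: (big_morph (numop J)) => [b c|]; first exact: numopD.
by have := numopZ J 0 0; rewrite !scale0r.
Qed.

Lemma numop_spartC k b : alternating b -> (k <= m)%N ->
  spart k (numop J b) = k%:R *: spart k b.
Proof.
move=> hb km; rewrite {1}(spart_total hb) numop_sum spart_sum.
rewrite (bigD1 (Ordinal (km : (k < m.+1)%N))) //= big1 ?addr0.
  by rewrite numop_spart // spartZ spart_spart // eqxx.
move=> i ik; have im : (i <= m)%N by rewrite -ltnS.
rewrite numop_spart // spartZ spart_spart //; case: eqP => [ik'|]; last by rewrite scaler0.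
by move/eqP: ik; case; apply/val_inj.
Qed.

(** The spectrum lies in 0, ..., m: on each component of [b] the operator acts both by [x] and by
    the index of the component. Its main uses are the values -1 and [m.+1], just outside the
    range. *)
Lemma numop_eig_eq0 (x : C) b : alternating b -> numop J b = x *: b ->
  (forall k, (k <= m)%N -> x != k%:R) -> b = 0.
Proof.
move=> hb E xk; rewrite (spart_total hb) big1 // => k _.
have km : (k <= m)%N by rewrite -ltnS.
have := numop_spartC hb km; rewrite E spartZ => /eqP.
by rewrite -subr_eq0 -scalerBl scaler_eq0 subr_eq0 (negPf (xk k km)) => /eqP.
Qed.

Lemma clifford_spart_L k w b : alternating b -> in_L J w -> (k <= m)%N ->
  spart k (clifford w b) = if (k < m)%N then clifford w (spart k.+1 b) else 0.
Proof.
move=> hb hw km.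
have eig i : (i <= m)%N -> numop J (clifford w (spart i b)) =
    (i%:R - 1) *: clifford w (spart i b).
  move=> im; rewrite (numop_L J2 Jorth (alternating_spart i hb) hw) numop_spart //.
  by rewrite cliffordZ scalerBl scale1r.
rewrite {1}(spart_total hb) clifford_sum spart_sum big_ord_recl /=.
(* The lowest component would be moved to the eigenvalue -1. *)
rewrite (_ : clifford w (spart 0 b) = 0); last first.
  apply: numop_eig_eq0 (eig 0%N (leq0n _)) _; first exact/alternating_clifford/alternating_spart.
  by move=> j _; rewrite sub0r; exact: negone_neq_nat.
rewrite spart0 add0r.
have step (i : 'I_m) : spart k (clifford w (spart (bump 0 i) b)) =
    if i == k :> nat then clifford w (spart i.+1 b) else 0.
  rewrite /bump /= add1n; apply: spart_eig; last exact: ltnW.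
  by rewrite eig // -natr1 addrK.
rewrite (eq_bigr _ (fun i _ => step i)).
case: ifP => [km'|/negP km'].
  rewrite (bigD1 (Ordinal km')) //= eqxx big1 ?addr0 // => i ik.
  by case: eqP => // e; move/eqP: ik; case; apply/val_inj.
by rewrite big1 // => i _; case: eqP => // e; case: km'; rewrite -e.
Qed.

Lemma clifford_spart_Lbar k w b : alternating b -> in_Lbar J w -> (k <= m)%N ->
  spart k (clifford w b) = if k is k'.+1 then clifford w (spart k' b) else 0.
Proof.
move=> hb hw km.
have eig i : (i <= m)%N -> numop J (clifford w (spart i b)) =
    i.+1%:R *: clifford w (spart i b).
  move=> im; rewrite (numop_Lbar J2 Jorth (alternating_spart i hb) hw) numop_spart //.
  by rewrite cliffordZ -natr1 scalerDl scale1r.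
rewrite {1}(spart_total hb) clifford_sum spart_sum big_ord_recr /=.
rewrite (_ : clifford w (spart m b) = 0); last first.
  apply: numop_eig_eq0 (eig m (leqnn _)) _; first exact/alternating_clifford/alternating_spart.
  by move=> j jm; rewrite eqr_nat gtn_eqF.
rewrite spart0 addr0.
have step (i : 'I_m) : spart k (clifford w (spart i b)) =
    if i.+1 == k :> nat then clifford w (spart i b) else 0.
  by apply: spart_eig => //; apply: eig; exact: ltnW.
rewrite (eq_bigr _ (fun i _ => step i)).
case: k km {step} => [|k] km; first by rewrite big1.
rewrite (bigD1 (Ordinal km)) //= eqxx big1 ?addr0 // => i ik.
by case: eqP => // -[e]; move/eqP: ik; case; apply/val_inj.
Qed.

Definition parity b : alt := \sum_(k < m.+1) (-1) ^+ k *: spart k b.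

Lemma parityD b c : parity (b + c) = parity b + parity c.
Proof.
by rewrite /parity -big_split; apply: eq_bigr => k _; rewrite spartD scalerDr.
Qed.

Lemma parityZ (x : C) b : parity (x *: b) = x *: parity b.
Proof.
by rewrite /parity scaler_sumr; apply: eq_bigr => k _; rewrite spartZ !scalerA mulrC.
Qed.

Lemma alternating_parity b : alternating b -> alternating (parity b).
Proof.
by move=> hb; apply: alternating_sum => k _; apply/alternatingZ/alternating_spart.
Qed.

Lemma spart_parity k b : alternating b -> (k <= m)%N ->
  spart k (parity b) = (-1) ^+ k *: spart k b.
Proof.
move=> hb km; rewrite /parity spart_sum (bigD1 (Ordinal (km : (k < m.+1)%N))) //= big1 ?addr0.
  by rewrite spartZ spart_spart // eqxx.
move=> i ik; have im : (i <= m)%N by rewrite -ltnS.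
rewrite spartZ spart_spart //; case: eqP => [ik'|]; last by rewrite scaler0.
by move/eqP: ik; case; apply/val_inj.
Qed.

Lemma parityK b : alternating b -> parity (parity b) = b.
Proof.
move=> hb; rewrite [RHS](spart_total hb); apply: eq_bigr => k _.
by rewrite (spart_parity hb (leq_ord k)) scalerA -expr2 sqrr_sign scale1r.
Qed.

(** Elements of L and of its conjugate both change the index by one, in opposite directions, and
    these span everything. *)
Lemma parity_clifford w b : alternating b -> parity (clifford w b) = - clifford w (parity b).
Proof.
move=> hb.
have PL v : in_L J v -> parity (clifford v b) = - clifford v (parity b).
  move=> hv; rewrite /parity clifford_sum -sumrN big_ord_recr /=.
  rewrite (clifford_spart_L hb hv (leqnn m)) ltnn scaler0 addr0.
  rewrite [RHS]big_ord_recl /=.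
  have z : clifford v (spart 0 b) = 0.
    apply: (@numop_eig_eq0 (- 1)); first exact/alternating_clifford/alternating_spart.
      rewrite (numop_L J2 Jorth (alternating_spart 0 hb) hv) numop_spart // scale0r.
      by rewrite clifford0 sub0r scaleN1r.
    by move=> j _; exact: negone_neq_nat.
  rewrite cliffordZ z scaler0 oppr0 add0r; apply: eq_bigr => k _.
  rewrite (clifford_spart_L hb hv (ltnW (ltn_ord k))) ltn_ord /bump /= add1n.
  by rewrite cliffordZ exprS mulN1r scaleNr opprK.
have PLb v : in_Lbar J v -> parity (clifford v b) = - clifford v (parity b).
  move=> hv; rewrite /parity clifford_sum -sumrN big_ord_recl /=.
  rewrite (clifford_spart_Lbar hb hv (leq0n m)) scaler0 add0r.
  rewrite [RHS]big_ord_recr /=.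
  have z : clifford v (spart m b) = 0.
    apply: (@numop_eig_eq0 m.+1%:R); first exact/alternating_clifford/alternating_spart.
      rewrite (numop_Lbar J2 Jorth (alternating_spart m hb) hv) numop_spart //.
      by rewrite cliffordZ -natr1 scalerDl scale1r.
    by move=> j jm; rewrite eqr_nat gtn_eqF.
  rewrite cliffordZ z scaler0 oppr0 addr0; apply: eq_bigr => k _.
  rewrite /bump /= add1n (clifford_spart_Lbar hb hv (ltn_ord k)).
  by rewrite cliffordZ exprS mulN1r scaleNr.
have [v1 [v2 [h1 h2 ->]]] : exists v1 v2, [/\ in_L J v1, in_Lbar J v2 & w = v1 + v2].
  by exists (w *m projL J), (w *m projLbar J); split; [exact: projLJ|exact: projLbarJ|rewrite projD].
rewrite (cliffordDl _ _ hb) (cliffordDl _ _ (alternating_parity hb)).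
rewrite (parityD (clifford v1 b)) (PL _ h1) (PLb _ h2); exact/esym/opprD.
Qed.

Definition degree_sign b : alt := fun s => (-1) ^+ size s * b s.

Lemma degree_signK b : degree_sign (degree_sign b) = b.
Proof. by apply/funext => s; rewrite /degree_sign mulrA -expr2 sqrr_sign mul1r. Qed.

Lemma interior_degree_sign u b : interior u (degree_sign b) = - degree_sign (interior u b).
Proof. by apply/funext => s; rewrite /interior altNE /degree_sign /= exprS mulN1r mulNr. Qed.

Lemma alternating_degree_sign b : alternating b -> alternating (degree_sign b).
Proof.
move=> [h1 h2]; split=> [s1 s2 a u v|s1 s2 s3 u]; rewrite /degree_sign.
  by rewrite h1 !size_cat /= mulrDr mulrCA.
by rewrite h2 mulr0.
Qed.

Lemma degree_sign_clifford w b : degree_sign (clifford w b) = - clifford w (degree_sign b).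
Proof.
rewrite !cliffordE !contractE !interior_degree_sign.
apply/funext => s; rewrite altNE !(altDE, altNE, altZE) /degree_sign.
have -> : wedge1 (rsubmx w) (fun s => (-1) ^+ size s * b s) s =
   - ((-1) ^+ size s * wedge1 (rsubmx w) b s).
  rewrite /wedge1 mulr_sumr -sumrN; apply: eq_bigr => i _.
  have sz : size s = (size (delete i s)).+1.
    by rewrite size_cat size_take size_drop ltn_ord -addSn subnKC.
  have -> : (-1) ^+ size s = - (-1) ^+ size (delete i s) :> C.
    by rewrite {1}sz exprS mulN1r.
  ring.
rewrite !(altDE, altZE); ring.
Qed.

(** Both operators anticommute with every Clifford multiplication, so their composite commutes with
    all of them and [schur] applies. *)
Lemma parity_degree_sign : exists2 x : C, x ^+ 2 = 1 &
  forall b, alternating b -> parity b = x *: degree_sign b.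
Proof.
pose T b := parity (degree_sign b).
have TT b : alternating b -> T b = T (@altone R m) [::] *: b.
  apply: schur.
  - move=> c c' _ _; rewrite /T -parityD; congr parity.
    by apply/funext => s; rewrite /degree_sign altDE mulrDr.
  - move=> k c _; rewrite /T -parityZ; congr parity.
    by apply/funext => s; rewrite /degree_sign altZE mulrCA.
  - by move=> c hc; apply/alternating_parity/alternating_degree_sign.
  - move=> v c hc; rewrite /T degree_sign_clifford -scaleN1r parityZ scaleN1r.
    by rewrite parity_clifford ?opprK //; exact: alternating_degree_sign.
set x := T _ _ in TT.
have P b : alternating b -> parity b = x *: degree_sign b.
  move=> hb; rewrite -{1}(degree_signK b).
  exact: TT (alternating_degree_sign hb).
exists x => //.
have h1 := alternating_altone R m.
(* Both operators are involutions; comparing their squares on the constant form 1, at the empty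
   list, gives the equation for the scalar. *)
have := parityK h1; rewrite (P _ h1) parityZ (P _ (alternating_degree_sign h1)) degree_signK.
move=> /(congr1 (@^~ [::])); rewrite !altZE /altone /= !mulr1 expr2; exact.
Qed.

(** The sum of the components of index below [r], described by annihilation under r-fold products
    from L. In this form it can be compared with [d] through brackets of sections of L, without
    differentiating projections. *)
Fixpoint filtered (r : nat) b : Prop :=
  if r is r'.+1 then forall w, in_L J w -> filtered r' (clifford w b) else b = 0.

Lemma filtered0 r : filtered r (0 : alt).
Proof. by elim: r => [//|r IH] w _; rewrite clifford0. Qed.

Lemma filteredD r b c : filtered r b -> filtered r c -> filtered r (b + c).
Proof.
elim: r b c => [|r IH] b c /=; first by move=> -> ->; rewrite addr0.
by move=> hb hc w hw; rewrite cliffordD; apply: IH; [exact: hb|exact: hc].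
Qed.

Lemma filteredN r b : filtered r b -> filtered r (- b).
Proof.
elim: r b => [|r IH] b /=; first by move=> ->; rewrite oppr0.
by move=> hb w hw; rewrite cliffordN; apply: IH; exact: hb.
Qed.

(** An element of L lowers both [r] and [j], so by induction all of L kills [b]; then the number
    operator vanishes on [b] although its eigenvalue there is positive. *)
Lemma filtered_eig_eq0 r j b : alternating b -> filtered r b -> (r <= j)%N ->
  numop J b = j%:R *: b -> b = 0.
Proof.
elim: r j b => [//|r IH] [//|j] b hb fb rj E.
have L0 w : in_L J w -> clifford w b = 0.
  move=> hw; apply: (IH j) => //; [exact: alternating_clifford|exact: fb|].
  by rewrite (numop_L J2 Jorth hb hw) E cliffordZ -natr1 scalerDl scale1r addrK.
have /eqP := numop_killed J2 L0.
by rewrite E scaler_eq0 pnatr_eq0 => /eqP.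
Qed.

Lemma filtered_spart r j b : alternating b -> filtered r b -> (j <= m)%N ->
  filtered r (spart j b).
Proof.
elim: r j b => [|r IH] j b hb /=; first by move=> -> _; exact: spart0.
move=> fb jm w hw; case: j jm => [|j] jm.
  suff -> : clifford w (spart 0 b) = 0 by exact: filtered0.
  apply: (@numop_eig_eq0 (- 1)); first exact/alternating_clifford/alternating_spart.
    rewrite (numop_L J2 Jorth (alternating_spart 0 hb) hw) numop_spart // scale0r.
    by rewrite clifford0 sub0r scaleN1r.
  by move=> j _; exact: negone_neq_nat.
have := clifford_spart_L hb hw (ltnW jm); rewrite jm => <-.
by apply: IH (ltnW jm); [exact: alternating_clifford|exact: fb].
Qed.

Lemma filtered_spart_eq0 r j b : alternating b -> filtered r b -> (r <= j <= m)%N ->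
  spart j b = 0.
Proof.
move=> hb fb /andP[rj jm].
apply: filtered_eig_eq0 rj (numop_spart hb jm); first exact: alternating_spart.
exact: filtered_spart.
Qed.

(** Applying [k.+1] elements of L would lead to the eigenvalue -1. *)
Lemma eig_filtered k b : alternating b -> numop J b = k%:R *: b -> filtered k.+1 b.
Proof.
elim: k b => [|k IH] b hb E w hw.
  apply: (@numop_eig_eq0 (- 1)); first exact: alternating_clifford.
    by rewrite (numop_L J2 Jorth hb hw) E scale0r clifford0 sub0r scaleN1r.
  by move=> j _; exact: negone_neq_nat.
apply: IH; first exact: alternating_clifford.
by rewrite (numop_L J2 Jorth hb hw) E cliffordZ -natr1 scalerDl scale1r addrK.
Qed.

End SpinDecomposition.

(** * The structure -J: exchange of L with its conjugate and of k with m - k *)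

Section Opposite.
Variables (R : realType) (m : nat).
Notation C := R[i].
Notation alt := (seq 'rV[R]_m -> C).
Notation vec := 'rV[C]_(m + m).
Implicit Types (b c : alt) (v w : vec).
Variable J : 'M[R]_(m + m).
Hypothesis J2 : J *m J = - 1%:M.
Hypothesis Jorth : forall v w : 'rV[R]_(m + m), pairing (v *m J) (w *m J) = pairing v w.
Notation JC := (map_mx (real_complex R) J).

Lemma clifford_anticomm v w b : alternating b ->
  clifford v (clifford w b) + clifford w (clifford v b) = cpair v w *: b.
Proof. by move=> hb; rewrite (clifford_rel v w hb) subrK. Qed.

Lemma opp_square : - J *m - J = - 1%:M.
Proof. by rewrite mulmxN mulNmx opprK. Qed.

Lemma opp_orth (v w : 'rV[R]_(m + m)) : pairing (v *m - J) (w *m - J) = pairing v w.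
Proof.
rewrite !mulmxN -[RHS]Jorth !pairingE; congr (_ * _).
by rewrite linearN /= mulmxN !mulNmx opprK.
Qed.

Lemma in_L_opp v : in_L (- J) v <-> in_Lbar J v.
Proof.
split; rewrite in_LbarE /in_L map_mxN mulmxN.
  by move=> E; rewrite -[LHS]opprK E scaleNr.
by move=> ->; rewrite scaleNr opprK.
Qed.

Lemma projL_opp : projL (- J) = projLbar J.
Proof. by rewrite projLE projLbarE map_mxN scalerN opprK. Qed.

Lemma projLbar_opp : projLbar (- J) = projL J.
Proof. by rewrite projLE projLbarE map_mxN scalerN. Qed.

(** Skewness makes [J] similar to the negative of its transpose, hence traceless; only the identity
    in the projection contributes, half of 2m. *)
Lemma trace_projLbar : \sum_a projLbar J a a = m%:R.
Proof.
have tJ : \tr J = 0.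
  have E : J = - (pairing_mx m R *m J^T *m pairing_mx m R).
    by rewrite -mulNmx -(skew_mx J2 Jorth) -mulmxA pairing_mxK mulmx1.
  have : \tr J = - \tr J.
    by rewrite {1}E linearN /= mxtrace_mulC mulmxA pairing_mxK mul1mx mxtrace_tr.
  move=> /eqP; rewrite -subr_eq0 opprK -mulr2n mulrn_eq0 /= => /eqP //.
have E a : projLbar J a a = 2^-1 * (1 + 'i%C * (J a a)%:C%C).
  by rewrite projLbarE !mxE eqxx.
rewrite (eq_bigr _ (fun a _ => E a)) -mulr_sumr big_split /= sumr_const card_ord.
rewrite -mulr_sumr -rmorph_sum /=.
have -> : \sum_i J i i = 0 by exact: tJ.
rewrite rmorph0 mulr0 addr0 natrD.
have n2 : (2 : C) != 0 by rewrite pnatr_eq0.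
by field.
Qed.

Lemma delta_pairing_l (i : 'I_m) :
  delta_mx 0 (lshift m i) *m pairing_mx m C = delta_mx 0 (rshift m i) :> vec.
Proof.
rewrite mul_pairing_mx; apply/rowP => k; rewrite mxE.
case: (splitP k) => j kj; rewrite !mxE eqxx /=.
  rewrite (_ : (k == rshift m i) = false); last by apply/eqP => e; move: kj (ltn_ord j); rewrite e /= => <-; rewrite ltnNge leq_addr.
  by rewrite (_ : (rshift m j == lshift m i) = false) //; apply/eqP => /eqP; rewrite eq_rlshift.
by rewrite (_ : k = rshift m j) ?eq_rshift ?eq_lshift //; apply/val_inj.
Qed.

Lemma delta_pairing_r (i : 'I_m) :
  delta_mx 0 (rshift m i) *m pairing_mx m C = delta_mx 0 (lshift m i) :> vec.
Proof. by rewrite -delta_pairing_l -mulmxA pairing_mxK mulmx1. Qed.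

Lemma sum_swap (V : nmodType) (f g : 'I_(m + m) -> V) :
  (forall i, f (lshift m i) = g (rshift m i)) ->
  (forall i, f (rshift m i) = g (lshift m i)) -> \sum_a f a = \sum_a g a.
Proof.
move=> fg gf; rewrite !big_split_ord /= addrC.
by rewrite (eq_bigr _ (fun i _ => gf i)) (eq_bigr _ (fun i _ => fg i)).
Qed.

(** For -J creators and annihilators change places. Restoring the order costs the sum of the
    anticommutators, which is the trace of the projection. *)
Lemma numop_opp b : alternating b -> numop (- J) b = m%:R *: b - numop J b.
Proof.
move=> hb; apply/eqP; rewrite -subr_eq opprK; apply/eqP.
pose v a : vec := delta_mx 0 a *m projLbar J.
pose v' a : vec := delta_mx 0 a *m pairing_mx m C *m projL J.
have -> : numop (- J) b = \sum_(a < m + m) clifford (v' a) (clifford (v a) b).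
  rewrite numopE projL_opp projLbar_opp; apply: sum_swap => i.
    by rewrite /v /v' delta_pairing_l delta_pairing_r.
  by rewrite /v /v' delta_pairing_l delta_pairing_r.
have -> : numop J b = \sum_(a < m + m) clifford (v a) (clifford (v' a) b) by exact: numopE.
rewrite -big_split /=.
have E a : clifford (v' a) (clifford (v a) b) + clifford (v a) (clifford (v' a) b) =
    projLbar J a a *: b.
  rewrite (clifford_anticomm (v' a) (v a) hb); congr (_ *: _).
  rewrite (cpair_projL J2 Jorth) (Lbar_projLbar (projLbarJ J2 _)) cpairE.
  by rewrite -(mulmxA (delta_mx _ _)) pairing_mxK mulmx1 -!rowE !mxE.
by rewrite (eq_bigr _ (fun a _ => E a)) -scaler_suml trace_projLbar.
Qed.

Lemma spart_opp k b : alternating b -> (k <= m)%N -> spart (- J) k b = spart J (m - k) b.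
Proof.
move=> hb km.
have e i : (i <= m)%N -> numop (- J) (spart J i b) = (m - i)%:R *: spart J i b.
  move=> im; rewrite numop_opp; last exact: alternating_spart.
  by rewrite (numop_spart J2 Jorth hb im) natrB // scalerBl.
rewrite {1}(spart_total J2 Jorth hb) spart_sum.
have mk : (m - k < m.+1)%N by rewrite ltnS leq_subr.
rewrite (bigD1 (Ordinal mk)) //= big1 ?addr0.
  rewrite (spart_eig k (e _ (leq_subr _ _))) ?leq_subr //.
  by rewrite subKn // eqxx.
move=> i ik; rewrite (spart_eig k (e _ (leq_ord i))) ?leq_subr //.
case: eqP => // E; move/eqP: ik; case; apply/val_inj => /=.
by rewrite -E subKn // leq_ord.
Qed.

End Opposite.

(** * Equivariance of the spinor decomposition under linear isomorphisms *)

Section Pullback.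
Variable R : realType.
Notation C := R[i].

Lemma alternating_pull m n (A : 'M[R]_(m, n)) (b : seq 'rV[R]_n -> C) :
  alternating b -> alternating (pull_alt A b).
Proof.
move=> [h1 h2]; split=> [s1 s2 a u v|s1 s2 s3 u]; rewrite /pull_alt.
  by rewrite !map_cat /= mulmxDl -scalemxAl h1.
by rewrite !map_cat /= map_cat /= h2.
Qed.

Lemma pull_pull m n p (A : 'M[R]_(m, n)) (B : 'M[R]_(n, p)) (b : seq 'rV[R]_p -> C) :
  pull_alt A (pull_alt B b) = pull_alt (A *m B) b.
Proof.
apply/funext => s; rewrite /pull_alt -map_comp; congr b.
by apply: eq_map => v /=; rewrite mulmxA.
Qed.

Lemma pull_1 m (b : seq 'rV[R]_m -> C) : pull_alt 1%:M b = b.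
Proof.
apply/funext => s; rewrite /pull_alt; congr b.
by rewrite -[RHS]map_id; apply: eq_map => v; rewrite mulmx1.
Qed.

Lemma interior_pull m n (A : 'M[R]_(m, n)) u (b : seq 'rV[R]_n -> C) :
  interior u (pull_alt A b) = pull_alt A (interior (u *m A) b).
Proof. by []. Qed.

Lemma wedge1_pull m n (A : 'M[R]_(m, n)) (a : 'rV[C]_n) (b : seq 'rV[R]_n -> C) :
  wedge1 (a *m (map_mx (real_complex R) A)^T) (pull_alt A b) = pull_alt A (wedge1 a b).
Proof.
apply/funext => s; rewrite /wedge1 /pull_alt size_map; apply: eq_bigr => i _.
congr (_ * _ * _).
  rewrite (nth_map 0) // /covec map_mxM /= trmx_mul mulmxA //.
by congr b; rewrite /delete map_cat map_take map_drop.
Qed.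

Lemma pull_sum m n (A : 'M[R]_(m, n)) (I : Type) (r : seq I) (P : pred I)
    (f : I -> seq 'rV[R]_n -> C) :
  pull_alt A (\sum_(i <- r | P i) f i) = \sum_(i <- r | P i) pull_alt A (f i).
Proof. by apply/funext => s; rewrite alt_sumE /pull_alt alt_sumE. Qed.

Section Equivariance.
Variables (m : nat) (A : 'M[R]_m) (J J' : 'M[R]_(m + m)).
Hypothesis Au : A \in unitmx.
Hypothesis JA : J *m gen_push A = gen_push A *m J'.
Hypothesis J2 : J *m J = - 1%:M.
Hypothesis Jorth : forall v w : 'rV[R]_(m + m), pairing (v *m J) (w *m J) = pairing v w.
Hypothesis J'2 : J' *m J' = - 1%:M.
Hypothesis J'orth : forall v w : 'rV[R]_(m + m), pairing (v *m J') (w *m J') = pairing v w.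
Notation toC := (map_mx (real_complex R)).

Lemma gen_push_inv : gen_push A *m gen_push (invmx A) = 1%:M.
Proof.
rewrite /gen_push mulmx_block !mulmx0 !mul0mx !addr0 !add0r.
by rewrite mulmxV // -trmx_mul invmxK mulmxV // trmx1 -scalar_mx_block.
Qed.

Lemma clifford_pull v (b : seq 'rV[R]_m -> C) :
  clifford v (pull_alt A b) = pull_alt A (clifford (v *m toC (gen_push A)) b).
Proof.
have E : v *m toC (gen_push A) =
    row_mx (lsubmx v *m toC A) (rsubmx v *m (toC (invmx A))^T).
  rewrite /gen_push map_block_mx !map_mx0 -{1}[v]hsubmxK mul_row_block.
  by rewrite !mulmx0 addr0 add0r map_trmx.
rewrite !cliffordE E row_mxKl row_mxKr.
have -> : wedge1 (rsubmx v) (pull_alt A b) =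
    pull_alt A (wedge1 (rsubmx v *m (toC (invmx A))^T) b).
  rewrite -wedge1_pull -mulmxA -trmx_mul -map_mxM mulmxV //.
  by rewrite map_mx1 trmx1 mulmx1.
rewrite !contractE !interior_pull.
have -> : map_mx (@complex.Re R) (lsubmx v) *m A = map_mx (@complex.Re R) (lsubmx v *m toC A).
  apply/rowP => j; rewrite !mxE (big_morph (@complex.Re R) (@ReD R) (erefl : complex.Re 0 = 0)).
  by apply: eq_bigr => k _; rewrite ReM !mxE /= mulr0 subr0.
have -> : map_mx (@complex.Im R) (lsubmx v) *m A = map_mx (@complex.Im R) (lsubmx v *m toC A).
  apply/rowP => j; rewrite !mxE (big_morph (@complex.Im R) (@ImD R) (erefl : complex.Im 0 = 0)).
  by apply: eq_bigr => k _; rewrite ImM !mxE /= mulr0 add0r.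
by [].
Qed.

Lemma in_L_push v : in_L J v <-> in_L J' (v *m toC (gen_push A)).
Proof.
rewrite /in_L; split => E.
  by rewrite -mulmxA -map_mxM -JA map_mxM mulmxA E scalemxAl.
move: E; rewrite -mulmxA -map_mxM -JA map_mxM mulmxA => /(congr1 (mulmx^~ (toC (gen_push (invmx A))))) /=.
by rewrite -scalemxAl -!mulmxA -map_mxM gen_push_inv map_mx1 !mulmx1.
Qed.

Lemma pull_inj (b c : seq 'rV[R]_m -> C) : pull_alt A b = pull_alt A c -> b = c.
Proof.
by move=> /(congr1 (pull_alt (invmx A))); rewrite !pull_pull mulVmx // !pull_1.
Qed.

Lemma in_Lbar_push v : in_Lbar J' v -> in_Lbar J (v *m toC (gen_push (invmx A))).
Proof.
move=> /in_LbarE E; apply/in_LbarE.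
have F : toC (gen_push (invmx A)) *m toC J = toC J' *m toC (gen_push (invmx A)).
  have G : gen_push (invmx A) *m gen_push A = 1%:M by apply: mulmx1C; exact: gen_push_inv.
  rewrite -!map_mxM; congr (toC _).
  by rewrite -[J in LHS]mulmx1 -gen_push_inv (mulmxA J) JA !mulmxA G mul1mx.
by rewrite -mulmxA F mulmxA E scalemxAl.
Qed.

Lemma spin_pull k (b : seq 'rV[R]_m -> C) : spin J' k b -> spin J k (pull_alt A b).
Proof.
move=> [n [vs [phi [hs hv hp E]]]].
exists n, (fun j => [seq v *m toC (gen_push (invmx A)) | v <- vs j]),
  (fun j => pull_alt A (phi j)); split.
- by move=> j; rewrite size_map.
- by move=> j v /mapP[w wv ->]; apply: in_Lbar_push; exact: (hv j).
- move=> j; have [ha nz hk] := hp j; apply: spans_PhiP => //.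
  + exact: alternating_pull.
  + move=> z; apply: nz; apply: pull_inj; rewrite z; by apply/funext.
  + move=> w /in_L_push /hk; rewrite clifford_pull => ->; exact/funext.
have -> : b = \sum_j foldr (@clifford R m) (phi j) (vs j).
  by apply/funext => s; rewrite E alt_sumE.
move=> s; rewrite pull_sum alt_sumE; apply: eq_bigr => j _.
congr (_ s); elim: (vs j) => [//|v ws /= <-].
rewrite clifford_pull; congr (pull_alt A (clifford _ _)).
rewrite -mulmxA -map_mxM.
have -> : gen_push (invmx A) *m gen_push A = 1%:M by apply: mulmx1C; exact: gen_push_inv.
by rewrite map_mx1 mulmx1.
Qed.

(** The pulled back components form a decomposition for [J], so the claim is uniqueness of the
    decomposition. *)
Lemma spart_pull k (b : seq 'rV[R]_m -> C) : alternating b -> (k <= m)%N ->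
  spart J k (pull_alt A b) = pull_alt A (spart J' k b).
Proof.
move=> hb km.
apply: (spart_decomposition J2 Jorth (e := fun k => pull_alt A (spart J' k b))) => //; split.
  by move=> i im; apply: spin_pull; exact: spin_spart.
move=> s; rewrite {1}(spart_total J'2 J'orth hb).
by rewrite pull_sum alt_sumE.
Qed.

End Equivariance.
End Pullback.

(** * Differential forms in coordinates *)

Section LocalForms.
Variables (R : realType) (m : nat).
Notation C := R[i].
Notation U := 'rV[R]_m.
Notation alt := (seq 'rV[R]_m -> C).
Implicit Types (w : U -> alt) (O : set U).

Definition lsmooth O w : Prop :=
  (forall x, O x -> alternating (w x)) /\ forall s, csmooth_on O (fun x => w x s).

Definition fder (v : U) w : U -> alt := fun x s => cderive (fun y => w y s) x v.

Lemma lsmooth_eq O w w' : open O -> (forall x, O x -> w x = w' x) -> lsmooth O w -> lsmooth O w'.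
Proof.
move=> oO ww [h1 h2]; split=> [x Ox|s]; first by rewrite -ww //; exact: h1.
by apply: csmooth_eq oO _ (h2 s) => x Ox; rewrite ww.
Qed.

Lemma lsmooth_cdiff O w x s : lsmooth O w -> O x -> cdifferentiable (fun y => w y s) x.
Proof. by move=> [_ h] Ox; exact: csmooth_differentiable (h s) Ox. Qed.

Lemma lsmooth_interior O w u : lsmooth O w -> lsmooth O (fun x => interior u (w x)).
Proof.
by move=> [h1 h2]; split=> [x Ox|s]; [exact/alternating_interior/h1|exact: (h2 (u :: s))].
Qed.

Lemma lsmoothD O w w' : open O -> lsmooth O w -> lsmooth O w' ->
  lsmooth O (fun x => w x + w' x).
Proof.
move=> oO [h1 h2] [k1 k2]; split=> [x Ox|s].
  by apply: alternatingD; [exact: h1|exact: k1].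
exact: csmoothD.
Qed.

Lemma lsmoothZ O (f : U -> C) w : open O -> csmooth_on O f -> lsmooth O w ->
  lsmooth O (fun x => f x *: w x).
Proof.
move=> oO sf [h1 h2]; split=> [x Ox|s]; first exact/alternatingZ/h1.
exact: csmoothM.
Qed.

Lemma lsmoothN O w : open O -> lsmooth O w -> lsmooth O (fun x => - w x).
Proof.
move=> oO hw; apply: (lsmooth_eq (w := fun x => (-1) *: w x) oO).
  by move=> x _; rewrite scaleN1r.
by apply: (lsmoothZ oO _ hw); exact: csmooth_cst.
Qed.

Lemma lsmooth_sum O (I : Type) (r : seq I) (P : pred I) (f : I -> U -> alt) : open O ->
  (forall i, lsmooth O (f i)) -> lsmooth O (fun x => \sum_(i <- r | P i) f i x).
Proof.
move=> oO h; split=> [x Ox|s]; first by apply: alternating_sum => i _; exact: (h i).1.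
apply: (csmooth_eq (f := fun x => \sum_(i <- r | P i) f i x s) oO).
  by move=> x _; rewrite alt_sumE.
by apply: (csmooth_sum _ _ oO) => i; exact: (h i).2.
Qed.

Lemma lsmooth_wedge1 O (a : 'rV[C]_m) w : open O -> lsmooth O w ->
  lsmooth O (fun x => wedge1 a (w x)).
Proof.
move=> oO [h1 h2]; split=> [x Ox|s]; first exact/alternating_wedge1/h1.
by apply: (csmooth_sum _ _ oO) => i; exact: csmoothZ oO (h2 _).
Qed.

Lemma lsmooth_fder O v w : open O -> lsmooth O w -> lsmooth O (fder v w).
Proof.
move=> oO [h1 h2]; split=> [x Ox|s]; last exact: csmooth_cderive (h2 s).
split=> [s1 s2 a p q|s1 s2 s3 p]; rewrite /fder.
  rewrite -cderiveZ; last exact: csmooth_differentiable (h2 _) Ox.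
  rewrite -cderiveD; last 2 first.
  - apply: cdifferentiableM; first exact: cdifferentiable_cst.
    exact: csmooth_differentiable (h2 _) Ox.
  - exact: csmooth_differentiable (h2 _) Ox.
  by apply: open_cderive oO Ox _ => y Oy; exact: (h1 y Oy).1.
rewrite (open_cderive (g := fun=> 0) v oO Ox) ?cderive_cst // => y Oy.
exact: (h1 y Oy).2.
Qed.

Lemma fder_linear O w x (a : R) u v : lsmooth O w -> O x ->
  fder (a *: u + v) w x = a%:C%C *: fder u w x + fder v w x.
Proof.
move=> hw Ox; apply/funext => s; rewrite altDE altZE.
exact: cderive_linear (lsmooth_cdiff s hw Ox).
Qed.

Lemma fder_eq O v w w' x : open O -> O x -> (forall y, O y -> w y = w' y) ->
  fder v w x = fder v w' x.
Proof.
move=> oO Ox h; apply/funext => s; apply: open_cderive oO Ox _ => y Oy.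
by rewrite h.
Qed.

Lemma fderD O v w w' x : lsmooth O w -> lsmooth O w' -> O x ->
  fder v (fun y => w y + w' y) x = fder v w x + fder v w' x.
Proof.
move=> hw hw' Ox; apply/funext => s; rewrite altDE.
exact: cderiveD (lsmooth_cdiff s hw Ox) (lsmooth_cdiff s hw' Ox).
Qed.

Lemma fderZ O v (f : U -> C) w x : csmooth_on O f -> lsmooth O w -> O x ->
  fder v (fun y => f y *: w y) x = cderive f x v *: w x + f x *: fder v w x.
Proof.
move=> hf hw Ox; apply/funext => s; rewrite altDE !altZE.
exact: cderiveM (csmooth_differentiable hf Ox) (lsmooth_cdiff s hw Ox).
Qed.

Lemma fderZc O v (k : C) w x : lsmooth O w -> O x ->
  fder v (fun y => k *: w y) x = k *: fder v w x.
Proof.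
move=> hw Ox; rewrite (fderZ (f := fun=> k) v (csmooth_cst _ k) hw Ox) cderive_cst.
by rewrite scale0r add0r.
Qed.

Lemma fder_sum O v (I : Type) (r : seq I) (P : pred I) (f : I -> U -> alt) x :
  (forall i, lsmooth O (f i)) -> O x ->
  fder v (fun y => \sum_(i <- r | P i) f i y) x = \sum_(i <- r | P i) fder v (f i) x.
Proof.
move=> h Ox; apply/funext => s; rewrite alt_sumE /fder.
rewrite -cderive_sum; last by move=> i; exact: lsmooth_cdiff (h i) Ox.
by rewrite (funext (fun y => alt_sumE r P (f^~ y) s)).
Qed.

Lemma fder_wedge1 O v (a : 'rV[C]_m) w x : lsmooth O w -> O x ->
  fder v (fun y => wedge1 a (w y)) x = wedge1 a (fder v w x).
Proof.
move=> hw Ox; apply/funext => s; rewrite /fder /wedge1 cderive_sum => [|i].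
  by apply: eq_bigr => i _; rewrite cderiveZ //; exact: lsmooth_cdiff hw Ox.
apply: cdifferentiableM; [exact: cdifferentiable_cst|exact: lsmooth_cdiff hw Ox].
Qed.

(** Cartan's formula for the constant field [u], whose Lie derivative is the directional derivative
    of the coefficients. Later identities for the exterior derivative rest on it by induction on the
    list. *)
Lemma interior_ext_d u w x : interior u (local_ext_d w x) =
  fder u w x - local_ext_d (fun y => interior u (w y)) x.
Proof.
apply/funext => s; rewrite altDE altNE /interior /local_ext_d /= big_ord_recl /=.
rewrite expr0 mul1r /delete /= drop0; congr (_ + _).
rewrite -sumrN; apply: eq_bigr => i _.
by rewrite /bump /= add1n exprS !mulN1r !mulNr.
Qed.

Lemma ext_d_nil w x : local_ext_d w x [::] = 0.
Proof. by rewrite /local_ext_d big_ord0. Qed.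

Lemma ext_d_eq O w w' x : open O -> O x -> (forall y, O y -> w y = w' y) ->
  local_ext_d w x = local_ext_d w' x.
Proof.
move=> oO Ox h; apply/funext => s; apply: eq_bigr => i _; congr (_ * _).
by apply: open_cderive oO Ox _ => y Oy; rewrite h.
Qed.

Lemma ext_d_coord O w x : lsmooth O w -> O x ->
  local_ext_d w x = \sum_k wedge1 (delta_mx 0 k) (fder (delta_mx 0 k) w x).
Proof.
move=> hw Ox; apply/funext => s; rewrite alt_sumE /wedge1 exchange_big /=.
apply: eq_bigr => i _.
rewrite (cderive_sum_delta _ (lsmooth_cdiff _ hw Ox)) mulr_sumr.
apply: eq_bigr => k _; rewrite -mulrA; congr (_ * (_ * _)).
rewrite covec_sum (bigD1 k) //= big1 ?addr0; last first.
  by move=> j /negPf jk; rewrite !mxE jk andbF mul0r.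
by rewrite !mxE !eqxx mul1r.
Qed.

Lemma ext_dD O w w' x : lsmooth O w -> lsmooth O w' -> O x ->
  local_ext_d (fun y => w y + w' y) x = local_ext_d w x + local_ext_d w' x.
Proof.
move=> hw hw' Ox; apply/funext => s; rewrite altDE -big_split /=.
apply: eq_bigr => i _; rewrite -mulrDr; congr (_ * _).
exact: cderiveD (lsmooth_cdiff _ hw Ox) (lsmooth_cdiff _ hw' Ox).
Qed.

Lemma ext_dZ O (k : C) w x : lsmooth O w -> O x ->
  local_ext_d (fun y => k *: w y) x = k *: local_ext_d w x.
Proof.
move=> hw Ox; apply/funext => s; rewrite altZE mulr_sumr.
apply: eq_bigr => i _; rewrite mulrCA; congr (_ * _).
exact: cderiveZ (lsmooth_cdiff _ hw Ox).
Qed.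

Lemma ext_dN O w x : lsmooth O w -> O x ->
  local_ext_d (fun y => - w y) x = - local_ext_d w x.
Proof.
move=> hw Ox; rewrite -scaleN1r -(ext_dZ _ hw Ox); congr (local_ext_d _ x).
by apply/funext => y; rewrite scaleN1r.
Qed.

Lemma ext_d0 x : local_ext_d (fun=> 0 : alt) x = 0.
Proof. by apply/funext => s; rewrite /local_ext_d big1 // => i _; rewrite cderive_cst mulr0. Qed.

Lemma ext_d_sum O (I : Type) (r : seq I) (P : pred I) (f : I -> U -> alt) x :
  (forall i, lsmooth O (f i)) -> O x ->
  local_ext_d (fun y => \sum_(i <- r | P i) f i y) x =
  \sum_(i <- r | P i) local_ext_d (f i) x.
Proof.
move=> h Ox; apply/funext => s; rewrite alt_sumE /local_ext_d exchange_big /=.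
apply: eq_bigr => i _; rewrite -mulr_sumr -cderive_sum; last first.
  by move=> j; exact: lsmooth_cdiff (h j) Ox.
by rewrite (funext (fun y => alt_sumE r P (f^~ y) _)).
Qed.

(** By Cartan's formula a contraction of an exterior derivative is again one, up to an alternating
    term; the class used for coinduction includes such terms. *)
Lemma alternating_ext_d O w x : open O -> lsmooth O w -> O x -> alternating (local_ext_d w x).
Proof.
move=> oO hw Ox; apply: (@alternating_coind R m [set c : alt | exists c1 w',
  [/\ alternating c1, lsmooth O w' & c = c1 + local_ext_d w' x]]); last first.
  by exists 0, w; split=> //; [exact: alternating0|rewrite add0r].
move=> c [c1 [w' [h1 h2 ->]]]; split=> [a u v|u|u].
- rewrite !interiorD !interior_ext_d interior_linear // (fder_linear _ _ _ h2 Ox).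
  have -> : local_ext_d (fun y => interior (a *: u + v) (w' y)) x =
      a%:C%C *: local_ext_d (fun y => interior u (w' y)) x +
      local_ext_d (fun y => interior v (w' y)) x.
    rewrite (ext_d_eq (w' := fun y => a%:C%C *: interior u (w' y) + interior v (w' y)) oO Ox).
      have hZ := lsmoothZ (f := fun=> a%:C%C) oO (csmooth_cst _ _) (lsmooth_interior u h2).
      rewrite (ext_dD hZ (lsmooth_interior v h2) Ox).
      by rewrite (ext_dZ _ (lsmooth_interior u h2) Ox).
    by move=> y Oy; rewrite interior_linear //; exact: h2.1.
  by alt_ring.
- rewrite !interiorD interior_interior // interior_ext_d interiorD interiorN interior_ext_d.
  have -> : interior u (fder u w' x) = fder u (fun y => interior u (w' y)) x by [].
  rewrite (ext_d_eq (w' := fun=> 0) oO Ox); last first.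
    by move=> y Oy; rewrite interior_interior //; exact: h2.1.
  by rewrite ext_d0 subr0 subrr addr0.
- exists (interior u c1 + fder u w' x), (fun y => - interior u (w' y)); split.
  + apply: alternatingD; first exact: alternating_interior.
    exact: (lsmooth_fder u oO h2).1.
  + exact: lsmoothN oO (lsmooth_interior u h2).
  + by rewrite interiorD interior_ext_d (ext_dN (lsmooth_interior u h2) Ox) addrA.
Qed.

Lemma lsmooth_ext_d O w : open O -> lsmooth O w -> lsmooth O (local_ext_d w).
Proof.
move=> oO hw; split=> [x Ox|s]; first exact: alternating_ext_d oO hw Ox.
apply: (csmooth_sum _ _ oO) => i; apply: (csmoothZ _ oO); apply: csmooth_cderive; exact: hw.2.
Qed.

Lemma fder_ext_d O v w x : open O -> lsmooth O w -> O x ->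
  fder v (local_ext_d w) x = local_ext_d (fder v w) x.
Proof.
move=> oO hw Ox; apply/funext => s.
have sd (i : 'I_(size s)) : csmooth_on O
    (fun y => cderive (fun z => w z (delete i s)) y (nth 0 s i)).
  by apply: csmooth_cderive; exact: hw.2.
transitivity (\sum_(i < size s) (-1) ^+ i *
    cderive (fun y => cderive (fun z => w z (delete i s)) y (nth 0 s i)) x v).
  rewrite /fder /local_ext_d.
  rewrite (@cderive_sum R _ _ _ _ (fun (i : 'I_(size s)) y =>
    (-1) ^+ i * cderive (fun z => w z (delete i s)) y (nth 0 s i))).
    apply: eq_bigr => i _; apply: cderiveZ; exact: csmooth_differentiable (sd i) Ox.
  move=> i; apply: cdifferentiableM; first exact: cdifferentiable_cst.
  exact: csmooth_differentiable (sd i) Ox.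
apply: eq_bigr => i _.
by rewrite (cderive_comm (nth 0 s i) v oO Ox (hw.2 (delete i s))).
Qed.

(** Applying Cartan's formula twice, the two terms with a directional derivative cancel because it
    commutes with [d]; what remains is the claim for the contracted form on a shorter list. *)
Lemma ext_d_ext_d O w x : open O -> lsmooth O w -> O x ->
  local_ext_d (local_ext_d w) x = 0.
Proof.
move=> oO hw Ox; apply/funext => s.
elim: s w hw => [|u s IH] w hw; first exact: ext_d_nil.
have -> : local_ext_d (local_ext_d w) x (u :: s) =
  interior u (local_ext_d (local_ext_d w) x) s by [].
have hi := lsmooth_interior u hw.
rewrite interior_ext_d (fder_ext_d u oO hw Ox).
have -> : (fun y => interior u (local_ext_d w y)) =
   (fun y => fder u w y + - local_ext_d (fun z => interior u (w z)) y).
  by apply/funext => y; rewrite interior_ext_d.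
rewrite (ext_dD (lsmooth_fder u oO hw) (lsmoothN oO (lsmooth_ext_d oO hi)) Ox).
rewrite (ext_dN (lsmooth_ext_d oO hi) Ox) opprD opprK addrA subrr add0r.
exact: IH.
Qed.

(** The Leibniz rule for a one-form closed at [x], which is what the symmetry of its partial
    derivatives says. This case suffices for naturality, where the one-forms are differentials of
    coordinate functions. *)
Lemma ext_d_wedge1 O (a : U -> 'rV[C]_m) w x : open O -> O x ->
  (forall k, csmooth_on O (fun y => a y 0 k)) ->
  (forall j k, cderive (fun y => a y 0 j) x (delta_mx 0 k) =
     cderive (fun y => a y 0 k) x (delta_mx 0 j)) ->
  lsmooth O w ->
  local_ext_d (fun y => wedge1 (a y) (w y)) x = - wedge1 (a x) (local_ext_d w x).
Proof.
move=> oO Ox sa ca hw; apply/funext => s.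
elim: s w hw => [|u s IH] w hw.
  by rewrite ext_d_nil altNE wedge1_nil oppr0.
pose f y := covec (a y) (map_mx (real_complex R) u).
have fE y : f y = \sum_k (u 0 k)%:C%C * a y 0 k.
  by rewrite /f covec_sum; apply: eq_bigr => k _; rewrite mxE mulrC.
have sf : csmooth_on O f.
  apply: (csmooth_eq (f := fun y => \sum_k (u 0 k)%:C%C * a y 0 k) oO).
    by move=> y _; rewrite fE.
  by apply: (csmooth_sum _ _ oO) => k; exact: csmoothZ oO (sa k).
pose e k : 'rV[C]_m := delta_mx 0 k.
have wE (y : U) b : wedge1 (a y) b = \sum_k a y 0 k *: wedge1 (e k) b.
  rewrite {1}(rV_sum_deltaC (a y)).
  elim/big_rec2: _ => [|k p q _ <-]; first exact: wedge1_0l.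
  by rewrite wedge1Dl wedge1Zl.
have sw w' : lsmooth O w' -> lsmooth O (fun y => wedge1 (a y) (w' y)).
  move=> h; apply: (lsmooth_eq (w := fun y => \sum_k a y 0 k *: wedge1 (e k) (w' y)) oO).
    by move=> y _; rewrite wE.
  by apply: (lsmooth_sum _ _ oO) => k; apply: (lsmoothZ oO (sa k)); exact: lsmooth_wedge1 oO h.
have Df : fder u (fun y => wedge1 (a y) (w y)) x =
    wedge1 (\row_k cderive (fun y => a y 0 k) x u) (w x) + wedge1 (a x) (fder u w x).
  rewrite (fder_eq (w' := fun y => \sum_k a y 0 k *: wedge1 (e k) (w y)) u oO Ox); last first.
    by move=> y _; rewrite wE.
  have sk k : lsmooth O (fun y => a y 0 k *: wedge1 (e k) (w y)).
    by apply: (lsmoothZ oO (sa k)); exact: lsmooth_wedge1 oO hw.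
  rewrite (fder_sum u _ _ sk Ox).
  rewrite wE [X in _ = X + _](_ : _ =
     \sum_k cderive (fun y => a y 0 k) x u *: wedge1 (e k) (w x)); last first.
    rewrite {1}(rV_sum_deltaC (\row_k _)).
    elim/big_rec2: _ => [|k p q _ <-]; first exact: wedge1_0l.
    by rewrite wedge1Dl wedge1Zl mxE.
  rewrite -big_split /=; apply: eq_bigr => k _.
  rewrite (fderZ u (sa k) (lsmooth_wedge1 _ oO hw) Ox).
  by rewrite (fder_wedge1 _ _ hw Ox).
(* Cartan's formula for the closed form [a]: its derivative along [u] is the differential of the
   function [a(u)]. *)
have closed : \row_k cderive (fun y => a y 0 k) x u = \row_k cderive f x (delta_mx 0 k).
  apply/rowP => k; rewrite !mxE.
  rewrite (cderive_sum_delta _ (csmooth_differentiable (sa k) Ox)).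
  rewrite (open_cderive (g := fun y => \sum_k (u 0 k)%:C%C * a y 0 k) _ oO Ox (fun y _ => fE y)).
  rewrite cderive_sum; last first.
    move=> j; apply: cdifferentiableM; first exact: cdifferentiable_cst.
    exact: csmooth_differentiable (sa j) Ox.
  apply: eq_bigr => j _; rewrite cderiveZ; last exact: csmooth_differentiable (sa j) Ox.
  by rewrite ca.
have dfw : local_ext_d (fun y => f y *: w y) x =
    wedge1 (\row_k cderive f x (delta_mx 0 k)) (w x) + f x *: local_ext_d w x.
  rewrite (ext_d_coord (lsmoothZ oO sf hw) Ox) (ext_d_coord hw Ox) scaler_sumr.
  rewrite [X in _ = X + _](_ : _ =
     \sum_k cderive f x (delta_mx 0 k) *: wedge1 (e k) (w x)); last first.
    rewrite {1}(rV_sum_deltaC (\row_k _)).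
    elim/big_rec2: _ => [|k p q _ <-]; first exact: wedge1_0l.
    by rewrite wedge1Dl wedge1Zl mxE.
  rewrite -big_split /=; apply: eq_bigr => k _.
  by rewrite (fderZ _ sf hw Ox) wedge1D !wedge1Z.
have -> : local_ext_d (fun y => wedge1 (a y) (w y)) x (u :: s) =
  interior u (local_ext_d (fun y => wedge1 (a y) (w y)) x) s by [].
have -> : (- wedge1 (a x) (local_ext_d w x)) (u :: s) =
  - (interior u (wedge1 (a x) (local_ext_d w x))) s by [].
rewrite interior_ext_d interior_wedge1 Df.
have hi := lsmooth_interior u hw.
rewrite (ext_d_eq (w' := fun y => f y *: w y + - wedge1 (a y) (interior u (w y))) oO Ox); last first.
  by move=> y _; rewrite interior_wedge1.
rewrite (ext_dD (lsmoothZ oO sf hw) (lsmoothN oO (sw _ hi)) Ox) (ext_dN (sw _ hi) Ox) dfw closed.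
rewrite interior_ext_d wedge1D wedge1N -/(f x).
rewrite !(altDE, altNE) (IH _ hi) !(altDE, altNE, altZE); ring.
Qed.

End LocalForms.

Section Euler.
Variables (R : realType) (m : nat).
Notation C := R[i].
Notation alt := (seq 'rV[R]_m -> C).
Implicit Types (b : alt).

Lemma interior_sum_delta (u : 'rV[R]_m) b : alternating b ->
  interior u b = \sum_j (u 0 j)%:C%C *: interior (delta_mx 0 j) b.
Proof.
move=> hb.
have i0 : interior 0 b = 0.
  have /eqP := interior_linear 1 0 0 hb; rewrite scaler0 addr0 scale1r.
  by rewrite -subr_eq0 opprD addrA subrr sub0r oppr_eq0 => /eqP.
rewrite {1}(rV_sum_delta u); elim/big_rec2: _ => [//|j p q _ <-].
by rewrite interior_linear.
Qed.

(** In positive degree it exhibits a form as a combination of wedges of coordinate differentials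
    with forms of lower degree, which makes induction on the degree possible without a basis of
    monomials. *)
Lemma euler_identity b s : alternating b ->
  (\sum_j wedge1 (delta_mx 0 j) (interior (delta_mx 0 j) b)) s = (size s)%:R * b s.
Proof.
elim: s b => [|u s IH] b hb.
  by rewrite mul0r alt_sumE big1 // => j _; exact: wedge1_nil.
rewrite -[LHS]/(interior u (\sum_j wedge1 (delta_mx 0 j) (interior (delta_mx 0 j) b)) s).
have -> : interior u (\sum_j wedge1 (delta_mx 0 j) (interior (delta_mx 0 j) b)) =
  interior u b + \sum_j wedge1 (delta_mx 0 j) (interior (delta_mx 0 j) (interior u b)).
  have E (f : 'I_m -> alt) : interior u (\sum_j f j) = \sum_j interior u (f j).
    by apply/funext => t; rewrite /interior !alt_sumE.
  rewrite E (interior_sum_delta u hb) -big_split; apply: eq_bigr => j _ /=.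
  rewrite interior_wedge1 (interior_anti _ _ hb) wedge1N opprK; congr (_ *: _ + _).
    rewrite covec_sum (bigD1 j) //= big1 ?addr0; last first.
      by move=> k /negPf kj; rewrite !mxE kj andbF mul0r.
    by rewrite !mxE !eqxx mul1r.
  by rewrite -interior_sum_delta.
rewrite altDE IH; last exact: alternating_interior.
by rewrite /interior /= -natr1 mulrDl mul1r addrC.
Qed.

End Euler.

(** * Naturality of the exterior derivative under smooth maps *)

Section Naturality.
Variables (R : realType) (m n : nat).
Notation C := R[i].
Variables (O : set 'rV[R]_m) (O' : set 'rV[R]_n) (g : 'rV[R]_m -> 'rV[R]_n).
Hypotheses (oO : open O) (oO' : open O') (gO : forall x, O x -> O' (g x)).
Hypothesis sg : smooth_on O g.

Definition lpull (w : 'rV[R]_n -> seq 'rV[R]_n -> C) (x : 'rV[R]_m) : seq 'rV[R]_m -> C :=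
  pull_alt (jacobian g x) (w (g x)).

Lemma diff_g x : O x -> differentiable g x.
Proof. by move=> Ox; exact: (sg 1).1. Qed.

Lemma jacobianE x u k : O x -> (u *m jacobian g x) 0 k = 'D_u (fun y => g y 0 k : R^o) x.
Proof.
move=> Ox; rewrite -deriveEjacobian; last exact: diff_g.
by rewrite derive_mx ?mxE //; apply/diff_derivable/diff_g.
Qed.

Lemma jacobian_delta x j k : O x ->
  jacobian g x j k = 'D_(delta_mx 0 j) (fun y => g y 0 k : R^o) x.
Proof. by move=> Ox; rewrite -jacobianE // -rowE [RHS]mxE. Qed.

Lemma smooth_coord k : smooth_on O (fun y => g y 0 k : R^o).
Proof. by move=> i; have /Cn_mxP := sg i; exact. Qed.

Lemma interior_lpull u w x : O x -> alternating (w (g x)) ->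
  interior u (lpull w x) =
  \sum_k ('D_u (fun y => g y 0 k : R^o) x)%:C%C *: lpull (fun y => interior (delta_mx 0 k) (w y)) x.
Proof.
move=> Ox hw; rewrite interior_pull (interior_sum_delta _ hw) pull_sum.
by apply: eq_bigr => k _; rewrite jacobianE.
Qed.

Lemma lsmooth_lpull w : lsmooth O' w -> lsmooth O (lpull w).
Proof.
move=> hw; split=> [x Ox|s]; first exact/alternating_pull/hw.1/gO.
elim: s w hw => [|u s IH] w hw; first exact: csmooth_comp oO gO sg (hw.2 [::]).
apply: (csmooth_eq (f := fun x => \sum_k ('D_u (fun y => g y 0 k : R^o) x)%:C%C *
   lpull (fun y => interior (delta_mx 0 k) (w y)) x s) oO).
  move=> x Ox; rewrite -[RHS]/(interior u (lpull w x) s) interior_lpull ?alt_sumE //.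
  exact/hw.1/gO.
apply: (csmooth_sum _ _ oO) => k; apply: (csmoothM oO).
  by apply: csmooth_real => i; exact: (smooth_coord k i.+1).2.
exact/IH/lsmooth_interior.
Qed.

(** On a list [s] the exterior derivative sees only lists shorter by one, so a form may be replaced
    by another that agrees with it in this single degree. *)
Lemma ext_d_degree (p : nat) (W : set 'rV[R]_p) (f f' : 'rV[R]_p -> seq 'rV[R]_p -> C) x s :
  open W -> W x -> (forall y t, W y -> (size t).+1 = size s -> f y t = f' y t) ->
  local_ext_d f x s = local_ext_d f' x s.
Proof.
move=> oW Wx h; apply: eq_bigr => i _; congr (_ * _).
apply: open_cderive oW Wx _ => y Wy; apply: h => //.
by rewrite size_cat size_take size_drop ltn_ord -addSn subnKC.
Qed.

Lemma wedge1_degree (p : nat) (a : 'rV[C]_p) (b c : seq 'rV[R]_p -> C) s :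
  (forall t, (size t).+1 = size s -> b t = c t) -> wedge1 a b s = wedge1 a c s.
Proof.
move=> h; apply: eq_bigr => i _; congr (_ * _); apply: h.
by rewrite size_cat size_take size_drop ltn_ord -addSn subnKC.
Qed.

Lemma lpull_wedge1 (a : 'rV[C]_n) w x :
  lpull (fun y => wedge1 a (w y)) x =
  wedge1 (a *m (map_mx (real_complex R) (jacobian g x))^T) (lpull w x).
Proof. by rewrite wedge1_pull. Qed.

(** Induction on the degree. In degree zero this is the chain rule; higher up the Euler identity
    reduces to wedges of coordinate differentials with forms of lower degree, and such a
    differential pulls back to the closed form that is the differential of a component of [g]. *)
Lemma ext_d_lpull w x : lsmooth O' w -> O x ->
  local_ext_d (lpull w) x = pull_alt (jacobian g x) (local_ext_d w (g x)).
Proof.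
move=> hw Ox; apply/funext => s.
have Ogx := gO Ox.
case: s => [|u s]; first by rewrite /pull_alt !ext_d_nil.
(* Here [k] is the degree of the component of [w] that is differentiated, one less than the number
   of arguments. *)
have [k sk] : exists k, size (u :: s) = k.+1 by exists (size s).
move: (u :: s) sk => {u}s.
elim: k w hw s => [|k IH] w hw s sk.
  move: s sk => [|u [|v s]] sk; try discriminate.
  rewrite /pull_alt /local_ext_d /= !big_ord1 !expr0 !mul1r /= /delete /=.
  rewrite -deriveEjacobian; last exact: diff_g.
  rewrite -cderive_comp //; first exact: diff_g.
  exact: lsmooth_cdiff hw Ogx.
pose e k : 'rV[C]_n := delta_mx 0 k.
pose i_ k (y : 'rV[R]_n) := interior (delta_mx 0 k) (w y).
have hi j : lsmooth O' (i_ j) by exact: lsmooth_interior.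
(* By the Euler identity this agrees with [w] in degree [k.+1], the only degree that matters
   here. *)
pose w' y := (k.+1%:R : C)^-1 *: \sum_j wedge1 (e j) (i_ j y).
have kn0 : (k.+1%:R : C) != 0 by rewrite pnatr_eq0.
have ww' y t : O' y -> size t = k.+1 -> w y t = w' y t.
  move=> Oy st; rewrite /w' altZE (euler_identity _ (hw.1 y Oy)) st mulrA mulVf ?mul1r //.
have hei j : lsmooth O' (fun y => wedge1 (e j) (i_ j y)).
  exact: lsmooth_wedge1 oO' (hi j).
have sk1 (t : seq 'rV[R]_m) : (size t).+1 = size s -> size t = k.+1.
  by rewrite sk => -[].
rewrite (ext_d_degree (f' := lpull w') oO Ox); last first.
  by move=> y t Oy /sk1 st; apply: ww'; [exact: gO|rewrite size_map].
rewrite /pull_alt (ext_d_degree (f' := w') oO' Ogx); last first.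
  by move=> y t Oy; rewrite size_map => /esym; rewrite sk => -[st]; apply: ww'.
have sS := lsmooth_sum (index_enum 'I_n) xpredT oO' hei.
rewrite /w' (ext_dZ _ sS Ogx) altZE.
have -> : lpull (fun y => (k.+1%:R : C)^-1 *: \sum_j wedge1 (e j) (i_ j y)) =
    (fun y => (k.+1%:R : C)^-1 *: lpull (fun z => \sum_j wedge1 (e j) (i_ j z)) y) by [].
rewrite (ext_dZ _ (lsmooth_lpull sS) Ox) altZE; congr (_ * _).
rewrite (ext_d_sum _ _ hei Ogx) alt_sumE.
have -> : lpull (fun z => \sum_j wedge1 (e j) (i_ j z)) =
    (fun y => \sum_j lpull (fun z => wedge1 (e j) (i_ j z)) y).
  by apply/funext => y; rewrite /lpull pull_sum.
rewrite (ext_d_sum _ _ (fun j => lsmooth_lpull (hei j)) Ox) alt_sumE.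
apply: eq_bigr => j _.
pose a (y : 'rV[R]_m) := e j *m (map_mx (real_complex R) (jacobian g y))^T.
have aE y l : O y -> a y 0 l = ('D_(delta_mx 0 l) (fun z => g z 0 j : R^o) y)%:C%C.
  move=> Oy; rewrite /a /e -rowE -(jacobian_delta _ _ Oy).
  by rewrite [LHS]mxE [LHS]mxE [LHS]mxE.
have sa l : csmooth_on O (fun y => a y 0 l).
  apply: (csmooth_eq (f := fun y => ('D_(delta_mx 0 l) (fun z => g z 0 j : R^o) y)%:C%C) oO).
    by move=> y Oy; rewrite aE.
  by apply: csmooth_real => i; exact: (smooth_coord j i.+1).2.
rewrite (_ : lpull (fun z => wedge1 (e j) (i_ j z)) = fun y => wedge1 (a y) (lpull (i_ j) y)); last first.
  by apply/funext => y; rewrite lpull_wedge1.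
rewrite (ext_d_wedge1 oO Ox sa _ (lsmooth_lpull (hi j))); last first.
  move=> l l'.
  rewrite (open_cderive _ oO Ox (fun y Oy => aE y l Oy)).
  rewrite (open_cderive _ oO Ox (fun y Oy => aE y l' Oy)).
  by rewrite !cderive_real (derive_comm (delta_mx 0 l) (delta_mx 0 l') oO Ox (smooth_coord j 2)).
rewrite altNE (@wedge1_degree m _ _ (pull_alt (jacobian g x) (local_ext_d (i_ j) (g x)))); last first.
  by move=> t /sk1 st; exact: IH.
rewrite /a wedge1_pull (ext_d_wedge1 (a := fun=> e j) oO' Ogx _ _ (hi j)) //.
  by move=> l; exact: csmooth_cst.
by move=> l l'; rewrite !cderive_cst.
Qed.

End Naturality.

(** * Derived bracket and integrability *)

Section CliffordFields.
Variables (R : realType) (m : nat).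
Notation C := R[i].
Notation U := 'rV[R]_m.
Notation alt := (seq 'rV[R]_m -> C).
Notation vec := 'rV[C]_(m + m).
Implicit Types (w : U -> alt) (O : set U) (v u : U -> vec).

Definition vsmooth O v : Prop := forall a, csmooth_on O (fun x => v x 0 a).
Definition vder (p : U) v (x : U) : vec := \row_a cderive (fun y => v y 0 a) x p.
Definition eps (k : 'I_m) : vec := delta_mx 0 (rshift m k).

Lemma cliffordE_interior (v : vec) (b : alt) : clifford v b =
  interior (map_mx (@complex.Re R) (lsubmx v)) b +
  ('i%C *: interior (map_mx (@complex.Im R) (lsubmx v)) b + wedge1 (rsubmx v) b).
Proof. by rewrite cliffordE contractE addrA. Qed.

Lemma lsmooth_cliffordc O (v : vec) w : open O -> lsmooth O w ->
  lsmooth O (fun y => clifford v (w y)).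
Proof.
move=> oO hw; pose p := map_mx (@complex.Re R) (lsubmx v).
pose q := map_mx (@complex.Im R) (lsubmx v).
apply: (lsmooth_eq (w := fun y => interior p (w y) +
   ('i%C *: interior q (w y) + wedge1 (rsubmx v) (w y))) oO).
  by move=> y _; rewrite cliffordE_interior.
apply: (lsmoothD oO (lsmooth_interior p hw)); apply: (lsmoothD oO _ (lsmooth_wedge1 _ oO hw)).
exact: (lsmoothZ oO (csmooth_cst O _) (lsmooth_interior q hw)).
Qed.

Lemma fder_cliffordc O (v : vec) p w x : open O -> lsmooth O w -> O x ->
  fder p (fun y => clifford v (w y)) x = clifford v (fder p w x).
Proof.
move=> oO hw Ox; rewrite cliffordE_interior.
set a := map_mx _ _; set b := map_mx _ _.
have h1 := lsmooth_interior a hw; have h2 := lsmooth_interior b hw.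
have h3 := lsmooth_wedge1 (rsubmx v) oO hw.
have h4 := lsmoothZ oO (csmooth_cst O 'i%C) h2.
rewrite (fder_eq (w' := fun y => interior a (w y) +
   ('i%C *: interior b (w y) + wedge1 (rsubmx v) (w y))) p oO Ox); last first.
  by move=> y _; rewrite cliffordE_interior.
rewrite (fderD p h1 (lsmoothD oO h4 h3) Ox) (fderD p h4 h3 Ox) (fderZc p _ h2 Ox).
by rewrite (fder_wedge1 _ _ hw Ox).
Qed.

Lemma clifford_coord (v : vec) (b : alt) : alternating b ->
  clifford v b = \sum_a v 0 a *: clifford (delta_mx 0 a) b.
Proof.
move=> hb; rewrite {1}(rV_sum_deltaC v) (clifford_suml _ _ _ hb).
by apply: eq_bigr => a _; rewrite (cliffordZl _ _ hb).
Qed.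

Lemma lsmooth_clifford O v w : open O -> vsmooth O v -> lsmooth O w ->
  lsmooth O (fun y => clifford (v y) (w y)).
Proof.
move=> oO sv hw.
apply: (lsmooth_eq (w := fun y => \sum_a v y 0 a *: clifford (delta_mx 0 a) (w y)) oO).
  by move=> y Oy; rewrite -clifford_coord //; exact: hw.1.
apply: (lsmooth_sum _ _ oO) => a; apply: (lsmoothZ oO (sv a)).
exact: lsmooth_cliffordc oO hw.
Qed.

Lemma fder_clifford O p v w x : open O -> vsmooth O v -> lsmooth O w -> O x ->
  fder p (fun y => clifford (v y) (w y)) x =
  clifford (vder p v x) (w x) + clifford (v x) (fder p w x).
Proof.
move=> oO sv hw Ox.
rewrite (fder_eq (w' := fun y => \sum_a v y 0 a *: clifford (delta_mx 0 a) (w y)) p oO Ox); last first.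
  by move=> y Oy; rewrite -clifford_coord //; exact: hw.1.
have hc a := lsmooth_cliffordc (delta_mx 0 a) oO hw.
have hs a := lsmoothZ oO (sv a) (hc a).
rewrite (fder_sum p _ _ hs Ox).
rewrite (clifford_coord (vder p v x) (hw.1 x Ox)).
rewrite (clifford_coord (v x) ((lsmooth_fder p oO hw).1 x Ox)) -big_split /=.
apply: eq_bigr => a _; rewrite (fderZ p (sv a) (hc a) Ox) (fder_cliffordc _ p oO hw Ox).
by rewrite mxE.
Qed.

Lemma contract_0 (b : alt) : alternating b -> contract 0 b = 0.
Proof. by move=> hb; rewrite -(scale0r 0) contractZl // scale0r. Qed.

Lemma clifford_eps k (b : alt) : alternating b -> clifford (eps k) b = wedge1 (delta_mx 0 k) b.
Proof.
move=> hb; have -> : eps k = row_mx 0 (delta_mx 0 k).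
  apply/rowP => j; rewrite !mxE; case: splitP => i ji.
    by rewrite mxE (_ : j = lshift m i) ?eq_lrshift ?andbF //; apply/val_inj.
  by rewrite mxE (_ : j = rshift m i) ?eq_rshift //; apply/val_inj.
by rewrite cliffordE row_mxKl row_mxKr (contract_0 hb) add0r.
Qed.

(** The exterior derivative in the shape of a Dirac operator, so that its commutators with Clifford
    multiplications follow from the Clifford relation and the Leibniz rule. *)
Lemma ext_d_clifford O w x : open O -> lsmooth O w -> O x ->
  local_ext_d w x = \sum_k clifford (eps k) (fder (delta_mx 0 k) w x).
Proof.
move=> oO hw Ox; rewrite (ext_d_coord hw Ox); apply: eq_bigr => k _.
by rewrite clifford_eps //; exact: (lsmooth_fder _ oO hw).1.
Qed.

Lemma cpair_eps k (v : vec) : cpair (eps k) v = v 0 (lshift m k).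
Proof. by rewrite cpairE /eps -(delta_pairing_l R k) -(mulmxA (delta_mx _ _)) pairing_mxK mulmx1 -rowE !mxE. Qed.

(** The generalised Lie derivative along the section [v], that is the anticommutator of [d] with
    Clifford multiplication by [v], in coordinates. *)
Definition lie v w (x : U) : alt :=
  \sum_k (clifford (eps k) (clifford (vder (delta_mx 0 k) v x) (w x)) +
          v x 0 (lshift m k) *: fder (delta_mx 0 k) w x).

Lemma ext_d_clifford_field O v w x : open O -> vsmooth O v -> lsmooth O w -> O x ->
  local_ext_d (fun y => clifford (v y) (w y)) x = lie v w x - clifford (v x) (local_ext_d w x).
Proof.
move=> oO sv hw Ox.
rewrite (ext_d_clifford oO (lsmooth_clifford oO sv hw) Ox) (ext_d_clifford oO hw Ox).
rewrite clifford_sum -sumrB; apply: eq_bigr => k _.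
rewrite (fder_clifford _ oO sv hw Ox) (cliffordD (eps k)).
have hf := (lsmooth_fder (delta_mx 0 k) oO hw).1 x Ox.
by rewrite (clifford_rel (eps k) (v x) hf) cpair_eps addrA.
Qed.

(** The Dorfman bracket in coordinates. Unlike the Courant bracket it is not skew, but it is the one
    obtained directly by commuting [d] with two Clifford multiplications. *)
Definition dorfman v u (x : U) : vec :=
  \sum_k (cpair (vder (delta_mx 0 k) v x) (u x) *: eps k -
          u x 0 (lshift m k) *: vder (delta_mx 0 k) v x +
          v x 0 (lshift m k) *: vder (delta_mx 0 k) u x).

Lemma lie_clifford O v u w x : open O -> vsmooth O u -> lsmooth O w -> O x ->
  lie v (fun y => clifford (u y) (w y)) x =
  clifford (u x) (lie v w x) + clifford (dorfman v u x) (w x).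
Proof.
move=> oO su hw Ox; have hb := hw.1 x Ox.
rewrite clifford_sum (clifford_suml _ _ _ hb) -big_split; apply: eq_bigr => k _.
rewrite (fder_clifford _ oO su hw Ox) (clifford3 _ _ (u x) hb) cpair_eps.
set dv := vder _ v x; set du := vder _ u x; set f := fder _ w x.
rewrite (cliffordD (u x)) (cliffordZ (u x)) (cliffordDl _ _ hb) (cliffordDl _ _ hb).
rewrite (cliffordNl _ hb) !(cliffordZl _ _ hb).
have alg (V : lmodType C) (a b c d e : V) (y t z : C) :
    a + y *: b - t *: c + z *: (d + e) = (a + z *: e) + (y *: b - t *: c + z *: d).
  by rewrite scalerDr (addrC (z *: d)) [RHS]addrACA !addrA.
exact: alg.
Qed.

(** The derived bracket formula, solved for the term in which both sections act after [d]. In every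
    other term at least one of them acts before [d], or only their bracket acts. *)
Lemma derived_bracket O v u w x : open O -> vsmooth O v -> vsmooth O u -> lsmooth O w -> O x ->
  clifford (u x) (clifford (v x) (local_ext_d w x)) =
  local_ext_d (fun y => clifford (v y) (clifford (u y) (w y))) x
  + clifford (v x) (local_ext_d (fun y => clifford (u y) (w y)) x)
  - clifford (u x) (local_ext_d (fun y => clifford (v y) (w y)) x)
  - clifford (dorfman v u x) (w x).
Proof.
move=> oO sv su hw Ox.
have huw := lsmooth_clifford oO su hw.
have E1 := ext_d_clifford_field oO sv huw Ox.
have E2 := congr1 (clifford (u x)) (ext_d_clifford_field oO sv hw Ox).
have E3 := lie_clifford v oO su hw Ox.
have E4 (b c : alt) : clifford (u x) (b - c) = clifford (u x) b - clifford (u x) c.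
  by rewrite cliffordD cliffordN.
have alg (V : zmodType) (a q z X Y T W : V) :
    X = W - Y -> T = a - q -> W = a + z -> q = X + Y - T - z.
  by move=> -> -> ->; rewrite subrK opprB addrAC addrK addrCA subrr addr0.
exact: alg E1 (etrans E2 (E4 _ _)) E3.
Qed.

Lemma vsmooth_cst O (v : vec) : vsmooth O (fun=> v).
Proof. by move=> a; exact: csmooth_cst. Qed.

Lemma vsmoothD O v u : open O -> vsmooth O v -> vsmooth O u -> vsmooth O (fun y => v y + u y).
Proof.
move=> oO hv hu a; apply: (csmooth_eq (f := fun y => v y 0 a + u y 0 a) oO).
  by move=> y _; rewrite mxE.
exact: csmoothD.
Qed.

Lemma vsmoothZ O (k : C) v : open O -> vsmooth O v -> vsmooth O (fun y => k *: v y).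
Proof.
move=> oO hv a; apply: (csmooth_eq (f := fun y => k * v y 0 a) oO).
  by move=> y _; rewrite mxE.
exact: csmoothZ.
Qed.

End CliffordFields.

(** * Comparison of the Courant and Dorfman brackets *)

Section Courant.
Variables (R : realType) (m : nat).
Notation C := R[i].
Notation U := 'rV[R]_m.
Notation vec := 'rV[C]_(m + m).
Notation rvec := 'rV[R]_(m + m).
Variables (W : set U) (oW : open W).

Lemma derive_sum_mul n (f g : 'I_n -> U -> R^o) x v :
  (forall k, differentiable (f k) x) -> (forall k, differentiable (g k) x) ->
  'D_v (fun y => \sum_k f k y * g k y : R^o) x =
  \sum_k ('D_v (f k) x * g k x + f k x * 'D_v (g k) x).
Proof.
move=> df dg.
have -> : (fun y => \sum_k f k y * g k y : R^o) = \sum_k (f k * g k).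
  by apply/funext => y; rewrite fct_sumE.
rewrite derive_sum; last first.
  by move=> k; apply/diff_derivable/differentiableM.
apply: eq_bigr => k _; rewrite deriveM; [|exact: diff_derivable..].
by rewrite addrC [X in _ + X]mulrC; congr (_ + _); exact: mulrC.
Qed.

Definition cplx (Y : U -> rvec) (x : U) : vec := map_mx (real_complex R) (Y x).

Section RealFields.
Variables (Y Z : U -> rvec).
Hypotheses (sY : smooth_on W Y) (sZ : smooth_on W Z).

Lemma diff_coord (X : U -> rvec) x a : smooth_on W X -> W x ->
  differentiable (fun y => X y 0 a : R^o) x.
Proof. by move=> sX Wx; have /differentiable_mxP := (sX 1).1 x Wx; exact. Qed.

Lemma vsmooth_cplx (X : U -> rvec) : smooth_on W X -> vsmooth W (cplx X).
Proof.
move=> sX a; apply: (csmooth_eq (f := fun y => (X y 0 a)%:C%C) oW).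
  by move=> y _; rewrite mxE.
by apply: csmooth_real => n; have /(Cn_mxP _ _ oW) := sX n; exact.
Qed.

Lemma vder_cplx (X : U -> rvec) p x a :
  vder p (cplx X) x 0 a = ('D_p (fun y => X y 0 a : R^o) x)%:C%C.
Proof.
rewrite mxE -cderive_real; congr cderive; apply/funext => y; by rewrite mxE.
Qed.

Lemma derive_sub (X : U -> rvec) n (sub : rvec -> 'rV[R]_n) (h : 'I_n -> 'I_(m + m)) x v j :
  (forall r j, sub r 0 j = r 0 (h j)) -> smooth_on W X -> W x ->
  ('D_v (fun y => sub (X y)) x) 0 j =
  \sum_k v 0 k * 'D_(delta_mx 0 k) (fun y => X y 0 (h j) : R^o) x.
Proof.
move=> hs sX Wx; rewrite derive_mx; last first.
  apply/diff_derivable/differentiable_mxP => i k; rewrite ord1.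
  have -> : (fun y => sub (X y) 0 k : R^o) = (fun y => X y 0 (h k) : R^o).
    by apply/funext => y; rewrite hs.
  exact: diff_coord.
rewrite mxE.
have -> : (fun y => sub (X y) 0 j) = (fun y => X y 0 (h j) : R^o).
  by apply/funext => y; rewrite hs.
by rewrite (derive_sum_delta _ (diff_coord (h j) sX Wx)).
Qed.

Lemma local_courant_l x j : W x -> local_courant Y Z x 0 (lshift m j) =
  \sum_k (Y x 0 (lshift m k) * 'D_(delta_mx 0 k) (fun y => Z y 0 (lshift m j) : R^o) x -
          Z x 0 (lshift m k) * 'D_(delta_mx 0 k) (fun y => Y y 0 (lshift m j) : R^o) x).
Proof.
move=> Wx; rewrite row_mxEl [LHS]mxE [X in _ + X]mxE.
have hs (r : rvec) i : lsubmx r 0 i = r 0 (lshift m i) by rewrite mxE.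
rewrite (derive_sub _ _ hs sZ Wx) (derive_sub _ _ hs sY Wx) -sumrB.
by apply: eq_bigr => k _; rewrite !hs.
Qed.

Lemma local_courant_r x j : W x -> local_courant Y Z x 0 (rshift m j) =
  \sum_k (Y x 0 (lshift m k) * 'D_(delta_mx 0 k) (fun y => Z y 0 (rshift m j) : R^o) x -
          Z x 0 (lshift m k) * 'D_(delta_mx 0 k) (fun y => Y y 0 (rshift m j) : R^o) x) +
  2^-1 * \sum_k (
     'D_(delta_mx 0 j) (fun y => Y y 0 (rshift m k) : R^o) x * Z x 0 (lshift m k) -
     Y x 0 (rshift m k) * 'D_(delta_mx 0 j) (fun y => Z y 0 (lshift m k) : R^o) x +
     Z x 0 (rshift m k) * 'D_(delta_mx 0 j) (fun y => Y y 0 (lshift m k) : R^o) x -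
     'D_(delta_mx 0 j) (fun y => Z y 0 (rshift m k) : R^o) x * Y x 0 (lshift m k)).
Proof.
move=> Wx; rewrite row_mxEr.
have hs (r : rvec) i : rsubmx r 0 i = r 0 (rshift m i) by rewrite mxE.
have hl (r : rvec) i : lsubmx r 0 i = r 0 (lshift m i) by rewrite mxE.
have cE (r r' : rvec) : covec (rsubmx r) (lsubmx r') = \sum_k r 0 (rshift m k) * r' 0 (lshift m k).
  by rewrite covec_sum; apply: eq_bigr => k _; rewrite hs hl.
have D1 (A B : U -> rvec) : smooth_on W A -> smooth_on W B ->
   'D_(delta_mx 0 j) (fun y => covec (rsubmx (A y)) (lsubmx (B x)) : R^o) x =
   \sum_k 'D_(delta_mx 0 j) (fun y => A y 0 (rshift m k) : R^o) x * B x 0 (lshift m k).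
  move=> sA sB.
  have -> : (fun y => covec (rsubmx (A y)) (lsubmx (B x)) : R^o) =
     (fun y => \sum_k (A y 0 (rshift m k) : R^o) * (B x 0 (lshift m k) : R^o) : R^o).
    by apply/funext => y; rewrite cE.
  rewrite (@derive_sum_mul m (fun k y => A y 0 (rshift m k)) (fun k _ => B x 0 (lshift m k))).
  - by apply: eq_bigr => k _; rewrite derive_cst mulr0 addr0.
  - by move=> k; exact: diff_coord.
  - by move=> k; exact: differentiable_cst.
have D2 (A B : U -> rvec) : smooth_on W A -> smooth_on W B ->
   'D_(delta_mx 0 j) (fun y => covec (rsubmx (A y)) (lsubmx (B y)) : R^o) x =
   \sum_k ('D_(delta_mx 0 j) (fun y => A y 0 (rshift m k) : R^o) x * B x 0 (lshift m k) +
     A x 0 (rshift m k) * 'D_(delta_mx 0 j) (fun y => B y 0 (lshift m k) : R^o) x) /\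
   differentiable (fun y => covec (rsubmx (A y)) (lsubmx (B y)) : R^o) x.
  move=> sA sB.
  have -> : (fun y => covec (rsubmx (A y)) (lsubmx (B y)) : R^o) =
     (fun y => \sum_k (A y 0 (rshift m k) : R^o) * (B y 0 (lshift m k) : R^o) : R^o).
    by apply/funext => y; rewrite cE.
  split.
    rewrite (@derive_sum_mul m (fun k y => A y 0 (rshift m k)) (fun k y => B y 0 (lshift m k))) //.
    - by move=> k; exact: diff_coord.
    - by move=> k; exact: diff_coord.
  have -> : (fun y => \sum_k (A y 0 (rshift m k) : R^o) * (B y 0 (lshift m k) : R^o) : R^o) =
     \sum_k ((fun y => A y 0 (rshift m k) : R^o) * (fun y => B y 0 (lshift m k) : R^o)).
    by apply/funext => y; rewrite fct_sumE.
  by apply: differentiable_sum => k; apply: differentiableM; exact: diff_coord.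
have [E1 d1] := D2 Z Y sZ sY; have [E2 d2] := D2 Y Z sY sZ.
have E3 : 'D_(delta_mx 0 j) (fun y => covec (rsubmx (Z y)) (lsubmx (Y y)) -
     covec (rsubmx (Y y)) (lsubmx (Z y)) : R^o) x =
  'D_(delta_mx 0 j) (fun y => covec (rsubmx (Z y)) (lsubmx (Y y)) : R^o) x -
  'D_(delta_mx 0 j) (fun y => covec (rsubmx (Y y)) (lsubmx (Z y)) : R^o) x.
  exact: deriveB (diff_derivable d1) (diff_derivable d2).
rewrite [LHS]mxE [X in X + _]mxE [X in _ + X]mxE [X in _ * X]mxE /contract_d.
rewrite [X in X + _ + _]mxE [X in _ + X + _]mxE [X in _ + - X + _]mxE.
rewrite [X in _ + X - _ + _]mxE [X in _ - (_ + X) + _]mxE.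
rewrite [X in _ + - X - _ + _]mxE [X in _ - (_ - X) + _]mxE.
rewrite E3 E1 E2 (D1 Z Y sZ sY) (D1 Y Z sY sZ).
rewrite (derive_sub _ _ hs sZ Wx) (derive_sub _ _ hs sY Wx).
rewrite -!sumrB !mulr_sumr -!big_split /=.
apply: eq_bigr => k _; rewrite !hl.
by field.
Qed.

(** The differential of the pairing of the two sections, with 1/2 because [cpair] is twice the
    pairing. It measures the failure of the Dorfman bracket to be skew. *)
Definition pairing_corr (v u : U -> vec) (x : U) : vec :=
  row_mx 0 (2^-1 *: \row_k cderive (fun y => cpair (v y) (u y)) x (delta_mx 0 k)).

Lemma cpair_coord (v u : vec) :
  cpair v u = \sum_k (v 0 (rshift m k) * u 0 (lshift m k) + u 0 (rshift m k) * v 0 (lshift m k)).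
Proof.
rewrite /cpair !covec_sum -big_split /=; apply: eq_bigr => k _.
by rewrite !mxE.
Qed.

Lemma csmooth_cpair (v u : U -> vec) : vsmooth W v -> vsmooth W u ->
  csmooth_on W (fun y => cpair (v y) (u y)).
Proof.
move=> hv hu; apply: (csmooth_eq (f := fun y =>
  \sum_k (v y 0 (rshift m k) * u y 0 (lshift m k) + u y 0 (rshift m k) * v y 0 (lshift m k))) oW).
  by move=> y _; rewrite cpair_coord.
by apply: (csmooth_sum _ _ oW) => k; apply: (csmoothD oW); apply: (csmoothM oW).
Qed.

Lemma cderive_cpair (v u : U -> vec) x p : vsmooth W v -> vsmooth W u -> W x ->
  cderive (fun y => cpair (v y) (u y)) x p = cpair (vder p v x) (u x) + cpair (v x) (vder p u x).
Proof.
move=> hv hu Wx.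
have cd (w : U -> vec) a : vsmooth W w -> cdifferentiable (fun y => w y 0 a) x.
  by move=> hw; exact: csmooth_differentiable (hw a) Wx.
have -> : (fun y => cpair (v y) (u y)) = (fun y =>
  \sum_k (v y 0 (rshift m k) * u y 0 (lshift m k) + u y 0 (rshift m k) * v y 0 (lshift m k))).
  by apply/funext => y; rewrite cpair_coord.
rewrite cderive_sum; last first.
  by move=> k; apply: cdifferentiableD; apply: cdifferentiableM; exact: cd.
rewrite !cpair_coord -big_split /=; apply: eq_bigr => k _.
rewrite cderiveD; [|by apply: cdifferentiableM; exact: cd..].
rewrite !cderiveM; [|exact: cd..].
rewrite !mxE; ring.
Qed.

Lemma courant_dorfman x : W x -> map_mx (real_complex R) (local_courant Y Z x) =
  dorfman (cplx Y) (cplx Z) x - pairing_corr (cplx Y) (cplx Z) x.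
Proof.
move=> Wx; have vY := vsmooth_cplx sY; have vZ := vsmooth_cplx sZ.
have sE (f : 'I_m -> vec) a : (\sum_k f k) 0 a = \sum_k f k 0 a by rewrite summxE.
apply/rowP => a; rewrite [LHS]mxE [RHS]mxE [X in _ = _ + X]mxE /dorfman sE.
case: (split_ordP a) => j ->.
  have -> : pairing_corr (cplx Y) (cplx Z) x 0 (lshift m j) = 0 by rewrite row_mxEl mxE.
  rewrite subr0 (local_courant_l _ Wx) rmorph_sum.
  apply: eq_bigr => k _; rewrite rmorphB !rmorphM.
  rewrite [in RHS]mxE [X in _ = X + _]mxE [X in _ = X + _ + _]mxE [X in _ = _ + X + _]mxE.
  rewrite [X in _ = _ - X + _]mxE [X in _ = _ + X]mxE !vder_cplx.
  rewrite [X in _ = _ * X - _ + _]mxE eq_lrshift andbF mulr0 sub0r addrC.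
  by rewrite ![cplx _ _ _ _]mxE.
rewrite (local_courant_r _ Wx) rmorphD rmorph_sum [pairing_corr _ _ _ _ _]row_mxEr.
pose t k : C := cplx Y x 0 (lshift m k) * vder (delta_mx 0 k) (cplx Z) x 0 (rshift m j) -
   cplx Z x 0 (lshift m k) * vder (delta_mx 0 k) (cplx Y) x 0 (rshift m j).
have -> : \sum_k (cpair (vder (delta_mx 0 k) (cplx Y) x) (cplx Z x) *: @eps R m k -
     cplx Z x 0 (lshift m k) *: vder (delta_mx 0 k) (cplx Y) x +
     cplx Y x 0 (lshift m k) *: vder (delta_mx 0 k) (cplx Z) x) 0 (rshift m j) =
  \sum_k t k + cpair (vder (delta_mx 0 j) (cplx Y) x) (cplx Z x).
  have E k : (cpair (vder (delta_mx 0 k) (cplx Y) x) (cplx Z x) *: @eps R m k -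
     cplx Z x 0 (lshift m k) *: vder (delta_mx 0 k) (cplx Y) x +
     cplx Y x 0 (lshift m k) *: vder (delta_mx 0 k) (cplx Z) x) 0 (rshift m j) =
    t k + (k == j)%:R * cpair (vder (delta_mx 0 k) (cplx Y) x) (cplx Z x).
    rewrite [LHS]mxE [X in X + _]mxE [X in X + _ + _]mxE [X in _ + X + _]mxE.
    rewrite [X in _ - X + _]mxE [X in _ + X]mxE /t.
    rewrite [X in _ * X - _ + _]mxE eq_rshift eqxx /= eq_sym; ring.
  rewrite (eq_bigr _ (fun k _ => E k)) big_split /=; congr (_ + _).
  rewrite (bigD1 j) //= eqxx mul1r big1 ?addr0 // => k /negPf ->.
  by rewrite mul0r.
rewrite -addrA; congr (_ + _).
  apply: eq_bigr => k _; rewrite rmorphB !rmorphM /t !vder_cplx.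
  by rewrite ![cplx _ _ _ _]mxE.
rewrite rmorphM fmorphV rmorph_nat [X in _ = _ - X]mxE [X in _ = _ - _ * X]mxE.
rewrite (cderive_cpair _ vY vZ Wx) !cpair_coord rmorph_sum -big_split /=.
rewrite !mulr_sumr -sumrB; apply: eq_bigr => k _.
rewrite !(rmorphB, rmorphD, rmorphM) !vder_cplx ![cplx _ _ _ _]mxE.
have n2 : (2 : C) != 0 by rewrite pnatr_eq0.
by field.
Qed.

End RealFields.
End Courant.

(** * The exterior derivative raises the filtration by at most one step *)

Section Filtration.
Variables (R : realType) (m : nat).
Notation C := R[i].
Notation U := 'rV[R]_m.
Notation alt := (seq 'rV[R]_m -> C).
Notation vec := 'rV[C]_(m + m).
Variables (W : set U) (x0 : U) (K : U -> 'M[R]_(m + m)).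
Hypotheses (oW : open W) (Wx0 : W x0).
Hypothesis closed : forall v1 v2, in_L (K x0) v1 -> in_L (K x0) v2 ->
  exists l1 l2 : U -> vec, [/\ vsmooth W l1, vsmooth W l2,
    forall y, W y -> in_L (K y) (l1 y) /\ in_L (K y) (l2 y),
    l1 x0 = v1 /\ l2 x0 = v2 & in_L (K x0) (dorfman l1 l2 x0)].

(** The hypothesis [closed] supplies sections of L through the two given vectors, with bracket in L
    at the point. The derived bracket formula then leaves exterior derivatives of forms lower in the
    filtration, handled by strong induction, and one term without any derivative. *)
Lemma filtered_ext_d r (w : U -> alt) : lsmooth W w ->
  (forall y, W y -> filtered (K y) r (w y)) -> filtered (K x0) r.+1 (local_ext_d w x0).
Proof.
elim/ltn_ind: r w => -[|r] IH w hw fw.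
  rewrite (ext_d_eq (w' := fun=> 0) oW Wx0 fw) ext_d0; exact: filtered0.
move=> v1 h1 v2 h2.
have [l1 [l2 [s1 s2 hL [E1 E2] hB]]] := closed h1 h2.
rewrite -E1 -E2 (derived_bracket oW s1 s2 hw Wx0).
have sl1 := lsmooth_clifford oW s1 hw; have sl2 := lsmooth_clifford oW s2 hw.
have fl1 y : W y -> filtered (K y) r (clifford (l1 y) (w y)).
  by move=> Wy; exact: (fw y Wy _ (hL y Wy).1).
have fl2 y : W y -> filtered (K y) r (clifford (l2 y) (w y)).
  by move=> Wy; exact: (fw y Wy _ (hL y Wy).2).
apply: filteredD; last exact/filteredN/(fw x0 Wx0).
apply: filteredD; last first.
  by apply/filteredN/(IH r (ltnSn r) _ sl1 fl1); rewrite E2.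
apply: filteredD; last first.
  by apply: (IH r (ltnSn r) _ sl2 fl2); rewrite E1.
have sl := lsmooth_clifford oW s1 sl2.
(* The doubly contracted form drops two steps. When only one step is available it vanishes on all of
   [W], and so does its exterior derivative. *)
case: r IH fw fl1 fl2 => [|r] IH fw fl1 fl2.
  rewrite (ext_d_eq (w' := fun=> 0) oW Wx0) ?ext_d0 //.
  by move=> y Wy; rewrite (fl2 y Wy) clifford0.
apply: (IH r) sl _ => [|y Wy]; first by rewrite ltnS leqnSn.
exact: (fl2 y Wy _ (hL y Wy).1).
Qed.

End Filtration.

(** * Closure of L and its conjugate under the Dorfman bracket *)

Section Integrability.
Variables (R : realType) (m : nat).
Notation C := R[i].
Notation U := 'rV[R]_m.
Notation alt := (seq 'rV[R]_m -> C).
Notation vec := 'rV[C]_(m + m).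
Notation rvec := 'rV[R]_(m + m).
Notation toC := (map_mx (real_complex R)).
Variables (W : set U) (x0 : U) (J : U -> 'M[R]_(m + m)).
Hypotheses (oW : open W) (Wx0 : W x0).
Hypothesis sJ : smooth_on W J.
Hypothesis J2 : forall y, W y -> J y *m J y = - 1%:M.
Hypothesis Jorth : forall y, W y ->
  forall v w : rvec, pairing (v *m J y) (w *m J y) = pairing v w.
Hypothesis nijenhuis : forall Y Z : rvec,
  local_courant (fun y => Y *m J y) (fun y => Z *m J y) x0
  - local_courant (fun=> Y) (fun y => Z *m J y) x0 *m J x0
  - local_courant (fun y => Y *m J y) (fun=> Z) x0 *m J x0
  + local_courant (fun=> Y) (fun=> Z) x0 *m J x0 *m J x0 = 0.

Lemma smooth_mulJ (Y : rvec) : smooth_on W (fun y => Y *m J y).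
Proof.
move=> n; apply/(Cn_mxP _ _ oW) => i j.
apply: (Cn_eq (f := fun y => \sum_k (Y i k * J y k j : R^o)) oW).
  by move=> y _; rewrite mxE.
apply: (Cn_sum _ _ oW) => k; apply: (CnM oW); first exact: Cn_cst.
by have /(Cn_mxP _ _ oW) := sJ n; exact.
Qed.

Section Sign.
Variable e : C.
Hypothesis e2 : e * e = -1.

(** Since e^2 = -1, this is an eigenvector of [J] for [- e], smooth in the point. Keeping [e]
    abstract treats L and its conjugate at once. *)
Definition frame (Y : rvec) (y : U) : vec := toC Y + e *: toC (Y *m J y).

Lemma vsmooth_frame Y : vsmooth W (frame Y).
Proof.
apply: (vsmoothD oW (vsmooth_cst _ _)); apply: (vsmoothZ _ oW).
exact: (@vsmooth_cplx _ _ _ oW (fun y => Y *m J y) (smooth_mulJ Y)).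
Qed.

Lemma frame_eig Y y : W y -> frame Y y *m toC (J y) = - e *: frame Y y.
Proof.
move=> Wy; rewrite /frame mulmxDl -scalemxAl -!map_mxM -mulmxA J2 // mulmxN mulmx1.
rewrite map_mxN scalerN scalerDr scalerA mulNr e2 opprK scale1r addrC scaleNr.
by [].
Qed.

(** The Nijenhuis identity is stated with Courant brackets, the derived bracket with Dorfman
    brackets; on these frames the correction terms cancel because [J] is orthogonal and skew. *)
Lemma dorfman_frame Y Z : dorfman (frame Y) (frame Z) x0 *m toC (J x0) =
  - e *: dorfman (frame Y) (frame Z) x0.
Proof.
pose K (X : rvec) (y : U) := X; pose JX (X : rvec) y := X *m J y.
have sK X : smooth_on W (K X) by move=> n; exact: Cn_cst.
have sJX X : smooth_on W (JX X) by exact: smooth_mulJ.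
have vK X := vsmooth_cplx oW (sK X); have vJ X := vsmooth_cplx oW (sJX X).
have vdF p X : vder p (frame X) x0 = vder p (cplx (K X)) x0 + e *: vder p (cplx (JX X)) x0.
  apply/rowP => a; rewrite !mxE.
  have c1 := csmooth_differentiable (vK X a) Wx0.
  have c2 := csmooth_differentiable (vJ X a) Wx0.
  rewrite -(cderiveZ e _ c2) -cderiveD //; last first.
    by apply: cdifferentiableM => //; exact: cdifferentiable_cst.
  by rewrite (_ : (fun y => frame X y 0 a) = fun y => cplx (K X) y 0 a + e * cplx (JX X) y 0 a) //;
    apply/funext => y; rewrite /frame !mxE.
have dF : dorfman (frame Y) (frame Z) x0 =
    (dorfman (cplx (K Y)) (cplx (K Z)) x0 - dorfman (cplx (JX Y)) (cplx (JX Z)) x0) +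
    e *: (dorfman (cplx (JX Y)) (cplx (K Z)) x0 + dorfman (cplx (K Y)) (cplx (JX Z)) x0).
  rewrite /dorfman -sumrB -big_split /= scaler_sumr -big_split /=; apply: eq_bigr => k _.
  rewrite !vdF.
  have -> : frame Y x0 = cplx (K Y) x0 + e *: cplx (JX Y) x0 by [].
  have -> : frame Z x0 = cplx (K Z) x0 + e *: cplx (JX Z) x0 by [].
  rewrite !(cpairD, cpairZ, cpairDr, cpairZr).
  move: (vder _ _ _) (vder _ _ _) (vder _ _ _) (vder _ _ _) => a b c d.
  move: (cplx _ _) (cplx _ _) (cplx _ _) (cplx _ _) => p q r s.
  apply/rowP => i; rewrite !mxE.
  have alg (t1 t2 t3 t4 dl s0 r0 q0 p0 a0 b0 c0 d0 : C) :
      (t1 + e * t2 + e * (t3 + e * t4)) * dl - (s0 + e * r0) * (d0 + e * c0) +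
      (q0 + e * p0) * (b0 + e * a0) =
      t1 * dl - s0 * d0 + q0 * b0 - (t4 * dl - r0 * c0 + p0 * a0) +
      e * (t3 * dl - s0 * c0 + p0 * b0 + (t2 * dl - r0 * d0 + q0 * a0)).
    by ring: e2.
  exact: alg.
have pc0 X X' y : W y -> cpair (cplx (JX X) y) (cplx (K X') y) =
    - cpair (cplx (K X) y) (cplx (JX X') y).
  by move=> Wy; rewrite /cplx /JX /K !map_mxM (cpair_skew (J2 Wy) (Jorth Wy)).
have pcJ X X' y : W y -> cpair (cplx (JX X) y) (cplx (JX X') y) =
    cpair (cplx (K X) y) (cplx (K X') y).
  move=> Wy; rewrite /cplx /JX /K !map_mxM (cpair_skew (J2 Wy) (Jorth Wy)).
  have cpairNr (a b : vec) : cpair a (- b) = - cpair a b.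
    by rewrite -scaleN1r cpairZr mulN1r.
  by rewrite -mulmxA (JC2 (J2 Wy)) mulmxN mulmx1 cpairNr opprK.
(* Orthogonality of [J] near [x0]: the two pairings are the same function there. *)
have corrJ : pairing_corr (cplx (JX Y)) (cplx (JX Z)) x0 = pairing_corr (cplx (K Y)) (cplx (K Z)) x0.
  have E k : cderive (fun y => cpair (cplx (JX Y) y) (cplx (JX Z) y)) x0 (delta_mx 0 k) =
      cderive (fun y => cpair (cplx (K Y) y) (cplx (K Z) y)) x0 (delta_mx 0 k).
    by apply: (open_cderive _ oW Wx0) => y Wy; exact: pcJ.
  have E2 : (\row_k cderive (fun y => cpair (cplx (JX Y) y) (cplx (JX Z) y)) x0 (delta_mx 0 k)
      : 'rV[C]_m) = \row_k cderive (fun y => cpair (cplx (K Y) y) (cplx (K Z) y)) x0 (delta_mx 0 k).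
    by apply/rowP => k; rewrite [LHS]mxE [RHS]mxE E.
  exact: (congr1 (fun r => row_mx 0 (2^-1 *: r)) E2).
(* Skewness of [J] near [x0]: the two pairings are opposite functions there. *)
have corr0 : pairing_corr (cplx (JX Y)) (cplx (K Z)) x0 + pairing_corr (cplx (K Y)) (cplx (JX Z)) x0 = 0.
  rewrite /pairing_corr add_row_mx addr0 -scalerDr.
  have -> : \row_k cderive (fun y => cpair (cplx (JX Y) y) (cplx (K Z) y)) x0 (delta_mx 0 k) +
     \row_k cderive (fun y => cpair (cplx (K Y) y) (cplx (JX Z) y)) x0 (delta_mx 0 k) = 0 :> 'rV[C]_m.
    have cdf := csmooth_differentiable (csmooth_cpair oW (vK Y) (vJ Z)) Wx0.
    have E k : cderive (fun y => cpair (cplx (JX Y) y) (cplx (K Z) y)) x0 (delta_mx 0 k) =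
        - cderive (fun y => cpair (cplx (K Y) y) (cplx (JX Z) y)) x0 (delta_mx 0 k).
      apply: etrans (etrans (cderiveZ (-1) (delta_mx 0 k) cdf) (mulN1r _)).
      by apply: (open_cderive _ oW Wx0) => y Wy; rewrite mulN1r; exact: pc0.
    apply/rowP => k; rewrite [LHS]mxE [X in X + _]mxE [X in _ + X]mxE [RHS]mxE E.
    exact: addNr.
  by rewrite scaler0 row_mx0.
pose cou X X' := local_courant X X' x0.
have cd X X' : smooth_on W X -> smooth_on W X' ->
    dorfman (cplx X) (cplx X') x0 = toC (cou X X') + pairing_corr (cplx X) (cplx X') x0.
  by move=> s s'; rewrite (courant_dorfman oW s s' Wx0) subrK.
pose A := cou (K Y) (K Z) - cou (JX Y) (JX Z).
pose B := cou (JX Y) (K Z) + cou (K Y) (JX Z).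
have dAB : dorfman (frame Y) (frame Z) x0 = toC A + e *: toC B.
  have alg (d1 d2 d3 d4 c1 c2 c3 c4 : vec) (a1 a2 a3 a4 : rvec) :
      d1 = toC a1 + c1 -> d2 = toC a2 + c2 -> d3 = toC a3 + c3 -> d4 = toC a4 + c4 ->
      c2 = c1 -> c3 + c4 = 0 ->
      d1 - d2 + e *: (d3 + d4) = toC (a1 - a2) + e *: toC (a3 + a4).
    move=> -> -> -> -> -> h; rewrite map_mxB map_mxD (addrACA (toC a3)) h addr0.
    by rewrite opprD addrACA subrr addr0.
  exact: etrans dF (alg _ _ _ _ _ _ _ _ _ _ _ _ (cd _ _ (sK Y) (sK Z))
    (cd _ _ (sJX Y) (sJX Z)) (cd _ _ (sJX Y) (sK Z)) (cd _ _ (sK Y) (sJX Z)) corrJ corr0).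
(* This is the Nijenhuis identity with J^2 = -1 inserted. It says that A + eB is an eigenvector of
   [J] for [- e]. *)
have BJ : B *m J x0 = - A.
  have alg (c p q r : rvec) (M : 'M[R]_(m + m)) : M *m M = - 1%:M ->
      c - p *m M - q *m M + r *m M *m M = 0 -> (q + p) *m M = - (r - c).
    move=> M2; rewrite -(mulmxA r) M2 mulmxN mulmx1 mulmxDl.
    move: (p *m M) (q *m M) => {p q} p q /rowP E; apply/rowP => i.
    by have := E i; rewrite !mxE => E'; apply/eqP; rewrite -subr_eq0 -oppr_eq0 -E'; apply/eqP; ring.
  exact: alg (J2 Wx0) (nijenhuis Y Z).
have alg (a b : rvec) (M : 'M[R]_(m + m)) (d : vec) : M *m M = - 1%:M -> b *m M = - a ->
    d = toC a + e *: toC b -> d *m toC M = - e *: d.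
  move=> M2 bM ->; have aM : a *m M = b.
    by rewrite -[a]opprK -bM mulNmx -mulmxA M2 mulmxN mulmx1 opprK.
  rewrite mulmxDl -scalemxAl -!map_mxM aM bM map_mxN scalerN scalerDr scalerA mulNr e2.
  by rewrite opprK scale1r addrC scaleNr.
exact: alg (J2 Wx0) BJ dAB.
Qed.

End Sign.

(** As [J] is real, an eigenvector is determined by its real part. Extending that real part as a
    constant therefore extends [v] to a section of the eigenbundle. *)
Lemma real_frame (e : C) (v : vec) : e = 'i%C \/ e = - 'i%C -> v *m toC (J x0) = - e *: v ->
  v = frame e (map_mx (@complex.Re R) v) x0.
Proof.
move=> he E.
have ReE : map_mx (@complex.Re R) (v *m toC (J x0)) = map_mx (@complex.Re R) v *m J x0.
  apply/rowP => j; rewrite !mxE (big_morph (@complex.Re R) (@ReD R) (erefl : complex.Re 0 = 0)).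
  by apply: eq_bigr => k _; rewrite ReM !mxE /= mulr0 subr0.
rewrite /frame -ReE E; apply/rowP => j; rewrite !mxE.
by case: he => ->; case: (v 0 j) => a b; apply: complexP => /=; ring.
Qed.

Lemma L_closed v1 v2 : in_L (J x0) v1 -> in_L (J x0) v2 ->
  exists l1 l2 : U -> vec, [/\ vsmooth W l1, vsmooth W l2,
    forall y, W y -> in_L (J y) (l1 y) /\ in_L (J y) (l2 y),
    l1 x0 = v1 /\ l2 x0 = v2 & in_L (J x0) (dorfman l1 l2 x0)].
Proof.
move=> h1 h2; pose e : C := - 'i%C.
have e2 : e * e = -1 by rewrite mulrNN ii.
exists (frame e (map_mx (@complex.Re R) v1)), (frame e (map_mx (@complex.Re R) v2)); split.
- exact: vsmooth_frame.
- exact: vsmooth_frame.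
- by move=> y Wy; rewrite /in_L !frame_eig // opprK.
- by split; apply/esym/real_frame; rewrite ?opprK //; right.
- by rewrite /in_L dorfman_frame // opprK.
Qed.

Lemma Lbar_closed v1 v2 : in_L (- J x0) v1 -> in_L (- J x0) v2 ->
  exists l1 l2 : U -> vec, [/\ vsmooth W l1, vsmooth W l2,
    forall y, W y -> in_L (- J y) (l1 y) /\ in_L (- J y) (l2 y),
    l1 x0 = v1 /\ l2 x0 = v2 & in_L (- J x0) (dorfman l1 l2 x0)].
Proof.
move=> /in_L_opp/in_LbarE h1 /in_L_opp/in_LbarE h2; pose e : C := 'i%C.
have e2 : e * e = -1 by rewrite ii.
exists (frame e (map_mx (@complex.Re R) v1)), (frame e (map_mx (@complex.Re R) v2)); split.
- exact: vsmooth_frame.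
- exact: vsmooth_frame.
- by move=> y Wy; split; apply/in_L_opp/in_LbarE; rewrite frame_eig.
- by split; apply/esym/real_frame => //; left.
- by apply/in_L_opp/in_LbarE; rewrite dorfman_frame.
Qed.

End Integrability.

(** * Smooth dependence of the spinor projections on the point *)

Section SmoothSpin.
Variables (R : realType) (m : nat).
Notation C := R[i].
Notation U := 'rV[R]_m.
Notation alt := (seq 'rV[R]_m -> C).
Notation vec := 'rV[C]_(m + m).
Variables (W : set U) (J : U -> 'M[R]_(m + m)).
Hypotheses (oW : open W) (sJ : smooth_on W J).

Lemma csmooth_J a b : csmooth_on W (fun y => (J y a b)%:C%C).
Proof. by apply: csmooth_real => n; have /(Cn_mxP _ _ oW) := sJ n; exact. Qed.

Lemma vsmooth_affine (v : vec) (c : C) :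
  vsmooth W (fun y => v *m (2^-1 *: (1%:M + c *: map_mx (real_complex R) (J y)))).
Proof.
move=> a; apply: (csmooth_eq (f := fun y =>
  \sum_k v 0 k * (2^-1 * ((k == a)%:R + c * (J y k a)%:C%C))) oW).
  by move=> y _; rewrite mxE; apply: eq_bigr => k _; rewrite !mxE.
apply: (csmooth_sum _ _ oW) => k; apply: (csmoothZ _ oW); apply: (csmoothZ _ oW).
apply: (csmoothD oW); first exact: csmooth_cst.
by apply: (csmoothZ _ oW); exact: csmooth_J.
Qed.

Lemma vsmooth_projL (v : vec) : vsmooth W (fun y => v *m projL (J y)).
Proof.
have -> : (fun y => v *m projL (J y)) =
    (fun y => v *m (2^-1 *: (1%:M + (- 'i%C) *: map_mx (real_complex R) (J y)))).
  by apply/funext => y; rewrite projLE scaleNr.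
exact: vsmooth_affine.
Qed.

Lemma vsmooth_projLbar (v : vec) : vsmooth W (fun y => v *m projLbar (J y)).
Proof.
have -> : (fun y => v *m projLbar (J y)) =
    (fun y => v *m (2^-1 *: (1%:M + 'i%C *: map_mx (real_complex R) (J y)))).
  by apply/funext => y; rewrite projLbarE.
exact: vsmooth_affine.
Qed.

Lemma lsmooth_numop (w : U -> alt) : lsmooth W w -> lsmooth W (fun y => numop (J y) (w y)).
Proof.
move=> hw; rewrite (funext (fun y => numopE (J y) (w y))).
apply: (lsmooth_sum _ _ oW) => a.
apply: (lsmooth_clifford oW (vsmooth_projLbar (delta_mx 0 a))).
exact: (lsmooth_clifford oW (vsmooth_projL (delta_mx 0 a *m pairing_mx m C))).
Qed.

Lemma lsmooth_spart k (w : U -> alt) : lsmooth W w -> lsmooth W (fun y => spart (J y) k (w y)).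
Proof.
move=> hw; rewrite (funext (fun y => spartE (J y) k (w y))).
elim: (index_iota _ _) => [//|j s IH] /=.
case: (j == k); first exact: IH.
have h1 := lsmoothZ oW (csmooth_cst W (- j%:R : C)) IH.
have h2 := lsmoothD oW (lsmooth_numop IH) h1.
have h3 := lsmoothZ oW (csmooth_cst W ((k%:R - j%:R)^-1 : C)) h2.
apply: lsmooth_eq oW _ h3 => y _.
by rewrite /lagrange scaleNr.
Qed.

End SmoothSpin.

(** * The exterior derivative changes the spinor index by exactly one, in a chart *)

Section LocalDecomposition.
Variables (R : realType) (m : nat).
Notation C := R[i].
Notation U := 'rV[R]_m.
Notation alt := (seq 'rV[R]_m -> C).
Notation rvec := 'rV[R]_(m + m).
Variables (W : set U) (x0 : U) (J : U -> 'M[R]_(m + m)).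
Hypotheses (oW : open W) (Wx0 : W x0).
Hypothesis sJ : smooth_on W J.
Hypothesis J2 : forall y, W y -> J y *m J y = - 1%:M.
Hypothesis Jorth : forall y, W y ->
  forall v w : rvec, pairing (v *m J y) (w *m J y) = pairing v w.
Hypothesis nijenhuis : forall Y Z : rvec,
  local_courant (fun y => Y *m J y) (fun y => Z *m J y) x0
  - local_courant (fun=> Y) (fun y => Z *m J y) x0 *m J x0
  - local_courant (fun y => Y *m J y) (fun=> Z) x0 *m J x0
  + local_courant (fun=> Y) (fun=> Z) x0 *m J x0 *m J x0 = 0.

Lemma spart_ext_d_up k j (w : U -> alt) : lsmooth W w -> (k.+2 <= j <= m)%N ->
  spart (J x0) j (local_ext_d (fun y => spart (J y) k (w y)) x0) = 0.
Proof.
move=> hw /andP[kj jm].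
have hs := lsmooth_spart oW sJ k hw.
have km : (k <= m)%N by apply: leq_trans jm; apply: ltnW; exact: ltnW.
apply: (filtered_spart_eq0 (r := k.+2) (J2 Wx0) (Jorth Wx0)); last by rewrite kj jm.
  exact: alternating_ext_d oW hs Wx0.
apply: (filtered_ext_d oW Wx0 (L_closed oW Wx0 sJ J2 Jorth nijenhuis) hs) => y Wy.
apply: (eig_filtered (J2 Wy) (Jorth Wy)); first exact: hs.1.
exact: (numop_spart (J2 Wy) (Jorth Wy) (hw.1 y Wy) km).
Qed.

(** The filtration argument for -J, where index [k] becomes [m - k], so that lowering becomes
    raising. *)
Lemma spart_ext_d_down k j (w : U -> alt) : lsmooth W w -> (j.+2 <= k <= m)%N ->
  spart (J x0) j (local_ext_d (fun y => spart (J y) k (w y)) x0) = 0.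
Proof.
move=> hw /andP[jk km].
have hs := lsmooth_spart oW sJ k hw.
have jm : (j <= m)%N by apply: leq_trans km; apply: ltnW; exact: ltnW.
have ad := alternating_ext_d oW hs Wx0.
have J2' y (Wy : W y) := opp_square (J2 Wy).
have Jorth' y (Wy : W y) := opp_orth (Jorth Wy).
have -> : j = (m - (m - j))%N by rewrite subKn.
rewrite -(spart_opp (J2 Wx0) (Jorth Wx0) ad (leq_subr _ _)).
apply: (filtered_spart_eq0 (r := (m - k).+2) (J2' _ Wx0) (Jorth' _ Wx0)) => //.
  apply: (filtered_ext_d (K := fun y => - J y) oW Wx0
    (Lbar_closed oW Wx0 sJ J2 Jorth nijenhuis) hs) => y Wy.
  apply: (eig_filtered (J2' _ Wy) (Jorth' _ Wy)); first exact: hs.1.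
  have E := spart_opp (J2 Wy) (Jorth Wy) (hw.1 y Wy) (leq_subr k m).
  rewrite (subKn km) in E; rewrite -E.
  exact: (numop_spart (J2' _ Wy) (Jorth' _ Wy) (hw.1 y Wy) (leq_subr _ _)).
rewrite leq_subr andbT ltn_subRL; apply: (@leq_trans (k + (m - k))); last by rewrite subnKC.
by rewrite addnS -!addSn leq_add2r.
Qed.

Lemma ext_d_degree_sign (w : U -> alt) x : lsmooth W w -> W x ->
  local_ext_d (fun y => degree_sign (w y)) x = - degree_sign (local_ext_d w x).
Proof.
move=> hw Wx; apply/funext => s; rewrite altNE /degree_sign /local_ext_d mulr_sumr -sumrN.
apply: eq_bigr => i _; rewrite cderiveZ; last exact: lsmooth_cdiff hw Wx.
have sz : size s = (size (delete i s)).+1.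
  by rewrite size_cat size_take size_drop ltn_ord -addSn subnKC.
have -> : (-1) ^+ size s = - (-1) ^+ size (delete i s) :> C.
  by rewrite {1}sz exprS mulN1r.
ring.
Qed.

Lemma lsmooth_degree_sign (w : U -> alt) : lsmooth W w -> lsmooth W (fun y => degree_sign (w y)).
Proof.
move=> [h1 h2]; split=> [y Wy|s]; first exact/alternating_degree_sign/h1.
exact: csmoothZ oW (h2 s).
Qed.

(** [d] anticommutes with the sign of the degree; what needs proof is that the scalar relating
    parity to this sign, which could vary with the point, has zero derivative. *)
Lemma ext_d_parity (w : U -> alt) : lsmooth W w ->
  local_ext_d (fun y => parity (J y) (w y)) x0 = - parity (J x0) (local_ext_d w x0).
Proof.
move=> hw.
(* Reading the scalar off the constant form 1 makes it a smooth function of the point. *)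
pose c y := parity (J y) (@altone R m) [::].
have sc : csmooth_on W c.
  have h1 : lsmooth W (fun=> @altone R m).
    by split=> [y _|s]; [exact: alternating_altone|exact: csmooth_cst].
  have : lsmooth W (fun y => parity (J y) (@altone R m)).
    apply: (lsmooth_sum _ _ oW) => k; apply: (lsmoothZ oW (csmooth_cst W _)).
    exact: (lsmooth_spart oW sJ k h1).
  by case=> _ /(_ [::]).
have cP y : W y -> c y * c y = 1 /\ forall b, alternating b -> parity (J y) b = c y *: degree_sign b.
  move=> Wy; have [x x2 P] := parity_degree_sign (J2 Wy) (Jorth Wy).
  have E : c y = x.
    by rewrite /c (P _ (alternating_altone R m)) altZE /degree_sign /altone /= !mulr1.
  by rewrite E -expr2.
(* Differentiating c^2 = 1 gives 2 c dc = 0, and [c] does not vanish. *)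
have dc p : cderive c x0 p = 0.
  have cd := csmooth_differentiable sc Wx0.
  have : cderive (fun y => c y * c y) x0 p = 0.
    by rewrite (open_cderive (g := fun=> 1) p oW Wx0) ?cderive_cst // => y /cP[].
  rewrite cderiveM // mulrC -mulrDr -mulr2n => /eqP.
  rewrite mulf_eq0 mulrn_eq0 /= => /orP[/eqP c0|/eqP //].
  have := (cP x0 Wx0).1; rewrite c0 mul0r => /eqP; by rewrite eq_sym oner_eq0.
have hd := lsmooth_degree_sign hw.
rewrite (ext_d_eq (w' := fun y => c y *: degree_sign (w y)) oW Wx0); last first.
  by move=> y Wy; exact: (cP y Wy).2 (hw.1 y Wy).
have E : local_ext_d (fun y => c y *: degree_sign (w y)) x0 =
    c x0 *: local_ext_d (fun y => degree_sign (w y)) x0.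
  apply: (etrans (ext_d_coord (lsmoothZ oW sc hd) Wx0)); apply/esym.
  apply: (etrans (congr1 (fun z => c x0 *: z) (ext_d_coord hd Wx0))); apply/esym.
  rewrite [RHS]scaler_sumr; apply: eq_bigr => k _.
  have alg (V : lmodType C) (x : C) (a b : V) : x = 0 -> x *: a + b = b.
    by move=> ->; rewrite scale0r add0r.
  have F := etrans (fderZ (delta_mx 0 k) sc hd Wx0) (alg _ _ _ _ (dc _)).
  by apply: (etrans (congr1 (wedge1 _) F)); exact: wedge1Z.
rewrite E (ext_d_degree_sign hw Wx0) scalerN; congr (- _).
by rewrite (cP x0 Wx0).2 //; exact: alternating_ext_d oW hw Wx0.
Qed.

(** On the component of index [k] parity is the sign (-1)^k before and after [d], yet it
    anticommutes with [d]. *)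
Lemma spart_ext_d_same k (w : U -> alt) : lsmooth W w -> (k <= m)%N ->
  spart (J x0) k (local_ext_d (fun y => spart (J y) k (w y)) x0) = 0.
Proof.
move=> hw km; have hs := lsmooth_spart oW sJ k hw.
have ad := alternating_ext_d oW hs Wx0.
have E := ext_d_parity hs.
have F : local_ext_d (fun y => parity (J y) (spart (J y) k (w y))) x0 =
    (-1) ^+ k *: local_ext_d (fun y => spart (J y) k (w y)) x0.
  rewrite -(ext_dZ _ hs Wx0); apply: (ext_d_eq oW Wx0) => y Wy.
  rewrite {1}/parity (bigD1 (Ordinal (km : (k < m.+1)%N))) //= big1 ?addr0.
    by rewrite (spart_spart (J2 Wy) (Jorth Wy) _ (hw.1 y Wy) km) eqxx.
  move=> i ik; rewrite (spart_spart (J2 Wy) (Jorth Wy) _ (hw.1 y Wy) km).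
  case: eqP => [ki|]; last by rewrite scaler0.
  by move/eqP: ik; case; apply/val_inj.
have := congr1 (spart (J x0) k) (etrans (esym F) E).
rewrite spartZ spartN (spart_parity (J2 Wx0) (Jorth Wx0) ad km).
have alg (V : lmodType C) (x : V) : (-1) ^+ k *: x = - ((-1) ^+ k *: x) -> x = 0.
  move=> /eqP; rewrite -subr_eq0 opprK -scalerDl scaler_eq0 -mulr2n mulrn_eq0 signr_eq0 /=.
  by move/eqP.
exact: alg.
Qed.

Lemma spart_ext_d k j (w : U -> alt) : lsmooth W w -> (k <= m)%N -> (j <= m)%N ->
  j != k.+1 -> k != j.+1 ->
  spart (J x0) j (local_ext_d (fun y => spart (J y) k (w y)) x0) = 0.
Proof.
move=> hw km jm jk kj; case: (ltngtP j k) => h.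
- by apply: spart_ext_d_down => //; rewrite km andbT ltn_neqAle eq_sym kj.
- by apply: spart_ext_d_up => //; rewrite jm andbT ltn_neqAle eq_sym jk.
- by rewrite h; exact: spart_ext_d_same.
Qed.

End LocalDecomposition.

(** * Forms and maps on manifolds *)

Section Jacobian.
Variable R : realType.

Lemma jacobian_ext m n (f : 'rV[R]_m -> 'rV[R]_n) x (A : 'M[R]_(m, n)) :
  differentiable f x -> (forall u, 'D_u f x = u *m A) -> jacobian f x = A.
Proof.
move=> df h; apply/row_matrixP => i.
by rewrite !rowE -deriveEjacobian.
Qed.

Lemma jacobian_eq m n (O : set 'rV[R]_m) (f g : 'rV[R]_m -> 'rV[R]_n) x :
  open O -> O x -> (forall y, O y -> f y = g y) -> differentiable g x ->
  jacobian f x = jacobian g x.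
Proof.
move=> oO Ox fg dg.
have nfg : {near x, g =1 f}.
  by have := open_nbhs_nbhs (conj oO Ox); apply: filterS => y /fg ->.
apply: jacobian_ext => [|u]; first exact: near_differentiable nfg dg.
by rewrite -deriveEjacobian //; apply/esym/near_eq_derive.
Qed.

Lemma jacobian_comp m n p (f : 'rV[R]_m -> 'rV[R]_n) (g : 'rV[R]_n -> 'rV[R]_p) x :
  differentiable f x -> differentiable g (f x) ->
  jacobian (g \o f) x = jacobian f x *m jacobian g (f x).
Proof.
move=> df dg; apply: jacobian_ext => [|u]; first exact: differentiable_comp.
by rewrite derive_comp // !deriveEjacobian // mulmxA.
Qed.

Lemma jacobian_id m (x : 'rV[R]_m) : jacobian id x = 1%:M.
Proof.
apply: jacobian_ext => [|u]; first by apply: ex_diff; exact: is_diff_id.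
by rewrite derive_id mulmx1.
Qed.

End Jacobian.

Section Charts.
Variables (R : realType) (m : nat) (M : manifold R m).
Implicit Types (c : chart R m M) (p : M) (O : set M).

Definition chart_img c O : set 'rV[R]_m := coord c @` (dom c `&` O).

Lemma atlas_topological c : atlas c -> topological_chart c.
Proof. by move=> /atlasP[]. Qed.

Lemma chart_pointK c p : atlas c -> dom c p -> point c (coord c p) = p.
Proof. by move=> /atlas_topological[_ _ h _ _]; exact: h. Qed.

Lemma chart_imgP c O x : atlas c -> chart_img c O x ->
  [/\ dom c (point c x), O (point c x) & coord c (point c x) = x].
Proof.
by move=> hc [p [dp Op] <-]; rewrite chart_pointK.
Qed.

Lemma mem_chart_img c O p : dom c p -> O p -> chart_img c O (coord c p).
Proof. by move=> dp Op; exists p. Qed.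

Lemma open_setP (T : topologicalType) (A : set T) : (forall x, A x -> nbhs x A) -> open A.
Proof. by move=> h; rewrite openE => x /h. Qed.

Lemma open_chart_img c O : atlas c -> open O -> open (chart_img c O).
Proof.
move=> hc oO; apply: open_setP => x hx.
have [dx Ox cx] := chart_imgP hc hx.
have [_ oi _ _ cp] := atlas_topological hc.
have ix : (coord c @` dom c) x by exists (point c x).
have n1 : nbhs x (coord c @` dom c) by exact: open_nbhs_nbhs.
have n2 : nbhs x (point c @^-1` O).
  by apply: (cp x ix); exact: open_nbhs_nbhs.
apply: filterS (filterI n1 n2) => y [[q dq <-] /=].
by rewrite /preimage /= (chart_pointK hc dq) => Oq; exists q.
Qed.

Lemma compat c c' : atlas c -> atlas c' -> compatible c c'.
Proof. by move=> /atlasP[_ h]; exact: h. Qed.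

Lemma smooth_transition c c' : atlas c -> atlas c' ->
  smooth_on (chart_img c (dom c')) (coord c' \o point c).
Proof. by move=> hc hc'; have [] := compat hc hc'. Qed.

Lemma open_dom c : atlas c -> open (dom c).
Proof. by move=> /atlas_topological[]. Qed.

Lemma diff_transition c c' p : atlas c -> atlas c' -> dom c p -> dom c' p ->
  differentiable (coord c' \o point c) (coord c p).
Proof.
move=> hc hc' dp dp'; apply: (smooth_transition hc hc' 1).1.
exact: mem_chart_img.
Qed.

Definition trans_jac c c' p : 'M[R]_m := jacobian (coord c' \o point c) (coord c p).

Lemma trans_jac_comp c c' c'' p : atlas c -> atlas c' -> atlas c'' ->
  dom c p -> dom c' p -> dom c'' p ->
  trans_jac c c'' p = trans_jac c c' p *m trans_jac c' c'' p.
Proof.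
move=> h h' h'' d d' d''.
have E : (coord c' \o point c) (coord c p) = coord c' p.
  exact: (congr1 (coord c') (chart_pointK h d)).
have df := diff_transition h h' d d'.
have dg : differentiable (coord c'' \o point c') ((coord c' \o point c) (coord c p)).
  by rewrite E; exact: diff_transition.
have H : trans_jac c c'' p =
    jacobian ((coord c'' \o point c') \o (coord c' \o point c)) (coord c p).
  apply: (jacobian_eq (open_chart_img h (open_dom h')) (mem_chart_img d d')).
    move=> x /(chart_imgP h)[dx d'x _].
    exact: (congr1 (coord c'') (esym (chart_pointK h' d'x))).
  exact: differentiable_comp.
rewrite H; apply: etrans (jacobian_comp df dg) _.
by rewrite E.
Qed.

Lemma trans_jac_id c p : atlas c -> dom c p -> trans_jac c c p = 1%:M.
Proof.
move=> h d; rewrite /trans_jac -(jacobian_id (coord c p)).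
apply: (jacobian_eq (open_chart_img h (open_dom h)) (mem_chart_img d d)).
  by move=> x /(chart_imgP h)[_ _].
by apply: ex_diff; exact: is_diff_id.
Qed.

Lemma to_pref_self p : to_pref (chart_at p) p = 1%:M.
Proof. exact: (trans_jac_id (chart_at_atlas p) (chart_at_dom p)). Qed.

Lemma to_pref_trans c c' p : atlas c -> atlas c' -> dom c p -> dom c' p ->
  to_pref c p = trans_jac c c' p *m to_pref c' p.
Proof.
move=> h h' d d'; exact: (trans_jac_comp h h' (chart_at_atlas p) d d' (chart_at_dom p)).
Qed.

Lemma trans_jac_inv c c' p : atlas c -> atlas c' -> dom c p -> dom c' p ->
  trans_jac c c' p *m trans_jac c' c p = 1%:M.
Proof.
by move=> h h' d d'; exact: etrans (esym (trans_jac_comp h h' h d d' d)) (trans_jac_id h d).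
Qed.

Lemma trans_jac_unit c c' p : atlas c -> atlas c' -> dom c p -> dom c' p ->
  trans_jac c c' p \in unitmx.
Proof. by move=> h h' d d'; have [u _] := mulmx1_unit (trans_jac_inv h h' d d'); exact: u. Qed.

Lemma to_pref_unit c p : atlas c -> dom c p -> to_pref c p \in unitmx.
Proof.
by move=> h d; exact: (trans_jac_unit h (chart_at_atlas p) d (chart_at_dom p)).
Qed.

End Charts.

(** * Independence of the exterior derivative from the chart *)

Section Forms.
Variables (R : realType) (m : nat) (M : manifold R m).
Notation C := R[i].
Notation form := (M -> seq 'rV[R]_m -> C).
Implicit Types (c : chart R m M) (p : M) (O : set M) (w : form).

Lemma local_formE w c p : atlas c -> dom c p ->
  local_form w c (coord c p) = pull_alt (to_pref c p) (w p).
Proof. by move=> h d; rewrite /local_form chart_pointK. Qed.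

Lemma lsmooth_local_form O w c : smooth_form O w -> atlas c ->
  lsmooth (chart_img c O) (local_form w c).
Proof.
move=> [h1 h2] hc; split=> [x /(chart_imgP hc)[_ Ox _]|s]; last exact: h2.
exact/alternating_pull/h1.
Qed.

Lemma local_form_trans w c c' x : atlas c -> atlas c' -> chart_img c (dom c') x ->
  local_form w c x = lpull (coord c' \o point c) (local_form w c') x.
Proof.
move=> h h' [p [d d'] <-].
have E : (coord c' \o point c) (coord c p) = coord c' p.
  exact: (congr1 (coord c') (chart_pointK h d)).
apply: etrans (local_formE w h d) _.
apply: etrans _ (congr1 (fun y => pull_alt (trans_jac c c' p) (local_form w c' y)) (esym E)).
apply: etrans _ (congr1 (pull_alt (trans_jac c c' p)) (esym (local_formE w h' d'))).
rewrite (to_pref_trans h h' d d'); exact: (esym (pull_pull _ _ _)).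
Qed.

Lemma chart_imgS c O O' : O `<=` O' -> chart_img c O `<=` chart_img c O'.
Proof. by move=> s x [p [dp Op] <-]; exists p => //; split=> //; exact: s. Qed.

Lemma transition_img c c' O x : atlas c -> atlas c' ->
  chart_img c (dom c' `&` O) x -> chart_img c' O ((coord c' \o point c) x).
Proof. by move=> h h' [p [d [d' Op]] <-]; rewrite /= chart_pointK //; exists p. Qed.

Lemma ext_d_trans O w c c' p : open O -> smooth_form O w -> atlas c -> atlas c' ->
  dom c p -> dom c' p -> O p ->
  local_ext_d (local_form w c) (coord c p) =
  pull_alt (trans_jac c c' p) (local_ext_d (local_form w c') (coord c' p)).
Proof.
move=> oO sw h h' d d' Op.
have oI : open (chart_img c (dom c' `&` O)).
  by apply: open_chart_img => //; apply: openI => //; exact: open_dom.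
have xI : chart_img c (dom c' `&` O) (coord c p) by exists p.
have st : smooth_on (chart_img c (dom c' `&` O)) (coord c' \o point c).
  move=> n; apply: Cn_subset (smooth_transition h h' n); by apply: chart_imgS; exact: subIsetl.
have E : (coord c' \o point c) (coord c p) = coord c' p.
  exact: (congr1 (coord c') (chart_pointK h d)).
have H1 : local_ext_d (local_form w c) (coord c p) =
    local_ext_d (lpull (coord c' \o point c) (local_form w c')) (coord c p).
  apply: (ext_d_eq oI xI) => x hx; apply: (local_form_trans w h h').
  by apply: chart_imgS hx; exact: subIsetl.
apply: etrans H1 _.
apply: etrans (ext_d_lpull oI (open_chart_img h' oO) (fun x => transition_img h h') st
  (lsmooth_local_form sw h') xI) _.
exact: (congr1 (fun y => pull_alt (trans_jac c c' p) (local_ext_d (local_form w c') y)) E).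
Qed.

(** [ext_d] uses the preferred chart at each point, which need not vary continuously; hence the need
    to compute it in one fixed chart around a point. *)
Lemma ext_d_chart O w c p : open O -> smooth_form O w -> atlas c -> dom c p -> O p ->
  local_ext_d (local_form w c) (coord c p) = pull_alt (to_pref c p) (ext_d w p).
Proof.
move=> oO sw h d Op; exact: (ext_d_trans oO sw h (chart_at_atlas p) d (chart_at_dom p) Op).
Qed.

Lemma local_form_ext_d O w c x : open O -> smooth_form O w -> atlas c -> chart_img c O x ->
  local_form (ext_d w) c x = local_ext_d (local_form w c) x.
Proof.
move=> oO sw h [p [d Op] <-].
apply: etrans (local_formE (ext_d w) h d) _.
exact: (esym (ext_d_chart oO sw h d Op)).
Qed.

Lemma smooth_ext_d O w : open O -> smooth_form O w -> smooth_form O (ext_d w).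
Proof.
move=> oO sw; split=> [p Op|c s hc].
  have hc := chart_at_atlas p.
  apply: alternating_ext_d (open_chart_img hc oO) (lsmooth_local_form sw hc) _.
  by apply: mem_chart_img => //; exact: chart_at_dom.
have oI := open_chart_img hc oO.
apply: csmooth_eq oI _ ((lsmooth_ext_d oI (lsmooth_local_form sw hc)).2 s).
move=> x hx; exact: (congr1 (fun b => b s) (esym (local_form_ext_d oO sw hc hx))).
Qed.

Lemma local_form_eq O w w' c x : atlas c -> (forall p, O p -> w p = w' p) ->
  chart_img c O x -> local_form w c x = local_form w' c x.
Proof. by move=> hc ww /(chart_imgP hc)[_ Ox _]; rewrite /local_form ww. Qed.

Lemma ext_d_form_eq O w w' p : open O -> O p -> (forall q, O q -> w q = w' q) ->
  ext_d w p = ext_d w' p.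
Proof.
move=> oO Op ww; have hc := chart_at_atlas p.
apply: (ext_d_eq (open_chart_img hc oO)).
  by apply: mem_chart_img => //; exact: chart_at_dom.
by move=> x; exact: local_form_eq.
Qed.

Lemma smooth_form_eq O w w' : open O -> (forall q, O q -> w q = w' q) ->
  smooth_form O w -> smooth_form O w'.
Proof.
move=> oO ww [h1 h2]; split=> [p Op|c s hc]; first by rewrite -ww //; exact: h1.
apply: csmooth_eq (open_chart_img hc oO) _ (h2 c s hc) => x hx.
exact: (congr1 (fun b => b s) (local_form_eq hc ww hx)).
Qed.

Lemma ext_d_ext_d_form O w p : open O -> smooth_form O w -> O p -> ext_d (ext_d w) p = 0.
Proof.
move=> oO sw Op; have hc := chart_at_atlas p.
have oI := open_chart_img hc oO.
have xI : chart_img (chart_at p) O (coord (chart_at p) p).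
  by apply: mem_chart_img => //; exact: chart_at_dom.
rewrite /ext_d; apply: etrans (ext_d_ext_d oI (lsmooth_local_form sw hc) xI).
by apply: (ext_d_eq oI xI) => x hx; exact: (local_form_ext_d oO sw hc hx).
Qed.

Lemma smooth_formD O w w' : open O -> smooth_form O w -> smooth_form O w' ->
  smooth_form O (fun p => w p + w' p).
Proof.
move=> oO [h1 h2] [k1 k2]; split=> [p Op|c s hc].
  by apply: alternatingD; [exact: h1|exact: k1].
exact: csmoothD (open_chart_img hc oO) (h2 c s hc) (k2 c s hc).
Qed.

Lemma smooth_formZ O (k : C) w : open O -> smooth_form O w ->
  smooth_form O (fun p => k *: w p).
Proof.
move=> oO [h1 h2]; split=> [p Op|c s hc]; first exact/alternatingZ/h1.
exact: csmoothZ (open_chart_img hc oO) (h2 c s hc).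
Qed.

Lemma smooth_form0 O : smooth_form O (fun _ : M => 0 : seq 'rV[R]_m -> C).
Proof.
by split=> [p _|c s hc]; [exact: alternating0|exact: csmooth_cst].
Qed.

Section At.
Variables (O : set M) (p : M).
Hypotheses (oO : open O) (Op : O p).

Let xI : chart_img (chart_at p) O (coord (chart_at p) p).
Proof. by apply: mem_chart_img => //; exact: chart_at_dom. Qed.

Lemma ext_dD_form w w' : smooth_form O w -> smooth_form O w' ->
  ext_d (fun p => w p + w' p) p = ext_d w p + ext_d w' p.
Proof.
move=> sw sw'; have hc := chart_at_atlas p.
exact: (ext_dD (lsmooth_local_form sw hc) (lsmooth_local_form sw' hc) xI).
Qed.

Lemma ext_dZ_form (k : C) w : smooth_form O w -> ext_d (fun p => k *: w p) p = k *: ext_d w p.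
Proof.
move=> sw; have hc := chart_at_atlas p.
exact: (ext_dZ k (lsmooth_local_form sw hc) xI).
Qed.

End At.

(** One chart around each point suffices, since transition maps pull smooth local forms back to
    smooth ones. *)
Lemma smooth_form_local O w : open O -> (forall p, O p -> alternating (w p)) ->
  (forall p, O p -> exists c (W : set M), [/\ atlas c, dom c p, open W, W p &
     lsmooth (chart_img c W) (local_form w c)]) ->
  smooth_form O w.
Proof.
move=> oO ha hl; split=> // c s hc; apply: csmooth_pointwise => x hx.
have [d Op cx] := chart_imgP hc hx.
have [c' [W [hc' d' oW Wp sW]]] := hl _ Op.
have oI : open (chart_img c (dom c' `&` W)).
  by apply: open_chart_img => //; apply: openI => //; exact: open_dom.
exists (chart_img c (dom c' `&` W)); last first.
  by rewrite -cx; apply: mem_chart_img.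
have st : smooth_on (chart_img c (dom c' `&` W)) (coord c' \o point c).
  move=> n; apply: Cn_subset (smooth_transition hc hc' n); exact: chart_imgS.
have := (lsmooth_lpull oI (fun x => transition_img hc hc') st sW).2 s.
apply: csmooth_eq oI _ => y hy; rewrite (local_form_trans _ hc hc') //.
exact: chart_imgS hy.
Qed.

End Forms.

Lemma open_preimage_in (X Y : topologicalType) (O : set X) (W : set Y) (f : X -> Y) :
  open O -> (forall p, O p -> {for p, continuous f}) -> open W -> open (O `&` f @^-1` W).
Proof.
move=> oO cf oW; apply: open_setP => p [Op Wp].
apply: filterI; first exact: open_nbhs_nbhs.
by apply: (cf p Op); exact: open_nbhs_nbhs.
Qed.

(** * Differentials of maps between manifolds, in arbitrary charts *)

Section MapJacobian.
Variable R : realType.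

Definition map_jac m n (M : manifold R m) (N : manifold R n) (f : M -> N)
    (c : chart R m M) (c' : chart R n N) (p : M) : 'M[R]_(m, n) :=
  jacobian (coord c' \o f \o point c) (coord c p).

Lemma smooth_map_id m (M : manifold R m) (O : set M) : smooth_map O id.
Proof.
split=> [p _|c c' h h' k]; first exact: id.
apply: Cn_subset (smooth_transition h h' k) => x [p [[d _] d'] <-].
by exists p.
Qed.

Lemma smooth_map_subset m n (M : manifold R m) (N : manifold R n) (O O' : set M)
    (f : M -> N) : O' `<=` O -> smooth_map O f -> smooth_map O' f.
Proof.
move=> s [h1 h2]; split=> [p /s|c c' h h' k]; first exact: h1.
apply: Cn_subset (h2 c c' h h' k) => x [p [[d Op] d'] <-].
by exists p => //; split=> //; split=> //; exact: s.
Qed.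

Section Map.
Variables (m n : nat) (M : manifold R m) (N : manifold R n) (O : set M) (f : M -> N).
Hypotheses (oO : open O) (sf : smooth_map O f).

Let dm (c' : chart R n N) := O `&` f @^-1` dom c'.

Lemma open_map_dom (c' : chart R n N) : atlas c' -> open (O `&` f @^-1` dom c').
Proof. by move=> h'; apply: (open_preimage_in oO sf.1); exact: open_dom. Qed.

Lemma smooth_expr c c' : atlas c -> atlas c' ->
  smooth_on (chart_img c (dm c')) (coord c' \o f \o point c).
Proof.
move=> h h' k; apply: Cn_subset (sf.2 c c' h h' k) => x [p [d [Op d']] <-].
by exists p.
Qed.

Lemma diff_expr c c' p : atlas c -> atlas c' -> dom c p -> O p -> dom c' (f p) ->
  differentiable (coord c' \o f \o point c) (coord c p).
Proof.
move=> h h' d Op d'; have [D _] := smooth_expr h h' 1.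
by apply: D; exists p.
Qed.

Lemma exprE c (c' : chart R n N) p : atlas c -> dom c p ->
  (coord c' \o f \o point c) (coord c p) = coord c' (f p).
Proof. by move=> h d; exact: (congr1 (fun q => coord c' (f q)) (chart_pointK h d)). Qed.

End Map.

Section Comp.
Variables (m n k : nat) (M : manifold R m) (N : manifold R n) (P : manifold R k).
Variables (O : set M) (O' : set N) (f : M -> N) (g : N -> P).
Hypotheses (oO : open O) (sf : smooth_map O f).
Hypothesis sg : smooth_map O' g.

Lemma map_jac_comp c c' c'' p : atlas c -> atlas c' -> atlas c'' ->
  dom c p -> O p -> dom c' (f p) -> O' (f p) -> dom c'' (g (f p)) ->
  map_jac (g \o f) c c'' p = map_jac f c c' p *m map_jac g c' c'' (f p).
Proof.
move=> h h' h'' d Op d' Op' d''.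
have E := exprE f c' h d.
have df := diff_expr sf h h' d Op d'.
have dg : differentiable (coord c'' \o g \o point c') ((coord c' \o f \o point c) (coord c p)).
  by rewrite E; exact: (diff_expr sg h' h'' d' Op' d'').
have H : map_jac (g \o f) c c'' p =
    jacobian ((coord c'' \o g \o point c') \o (coord c' \o f \o point c)) (coord c p).
  have oI := open_chart_img h (open_map_dom oO sf h').
  have xI : chart_img c (O `&` f @^-1` dom c') (coord c p) by exists p.
  apply: (jacobian_eq oI xI).
    move=> x /(chart_imgP h)[dx [_ d'x] _].
    exact: (congr1 (fun y => coord c'' (g y)) (esym (chart_pointK h' d'x))).
  exact: differentiable_comp.
rewrite H; apply: etrans (jacobian_comp df dg) _.
by rewrite E.
Qed.

Lemma tangent_map_comp p : O p -> O' (f p) ->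
  tangent_map (g \o f) p = tangent_map f p *m tangent_map g (f p).
Proof.
move=> Op Op'; exact: (map_jac_comp (chart_at_atlas p) (chart_at_atlas (f p))
  (chart_at_atlas (g (f p))) (chart_at_dom p) Op (chart_at_dom (f p)) Op' (chart_at_dom (g (f p)))).
Qed.

End Comp.

Section Map.
Variables (m n : nat) (M : manifold R m) (N : manifold R n) (O : set M) (f : M -> N).
Hypotheses (oO : open O) (sf : smooth_map O f).

(** The chain rule for [id \o f] and for [f \o id], with the identity maps read between a chart and
    a preferred chart. *)
Lemma map_jac_chart c c' p : atlas c -> atlas c' -> dom c p -> O p -> dom c' (f p) ->
  map_jac f c c' p *m to_pref c' (f p) = to_pref c p *m tangent_map f p.
Proof.
move=> h h' d Op d'.
have sN : smooth_map [set: N] id := smooth_map_id (setT : set _).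
have sM : smooth_map [set: M] id := smooth_map_id (setT : set _).
have H1 := map_jac_comp oO sf sN h h' (chart_at_atlas (f p)) d Op d' I
  (chart_at_dom (f p)).
have H2 := map_jac_comp openT sM sf h (chart_at_atlas p) (chart_at_atlas (f p)) d I
  (chart_at_dom p) Op (chart_at_dom (f p)).
exact: etrans (esym H1) H2.
Qed.

Lemma tangent_map_eq (g : M -> N) p : O p -> (forall q, O q -> f q = g q) ->
  tangent_map f p = tangent_map g p.
Proof.
move=> Op fg; rewrite /tangent_map -(fg p Op); apply/esym.
have hc := chart_at_atlas p.
apply: (jacobian_eq (open_chart_img hc oO) (mem_chart_img (chart_at_dom p) Op)).
  move=> x /(chart_imgP hc)[_ Ox _].
  exact: (congr1 (coord (chart_at (f p))) (esym (fg _ Ox))).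
exact: (diff_expr sf hc (chart_at_atlas (f p)) (chart_at_dom p) Op (chart_at_dom (f p))).
Qed.

End Map.

Lemma tangent_map_id m (M : manifold R m) (p : M) : tangent_map id p = 1%:M.
Proof. exact: (trans_jac_id (chart_at_atlas p) (chart_at_dom p)). Qed.

End MapJacobian.

(** * Pull-back of forms along smooth maps of manifolds *)

Section Pullback.
Variables (R : realType) (m n : nat) (M : manifold R m) (N : manifold R n).
Variables (O : set M) (O' : set N) (f : M -> N).
Hypotheses (oO : open O) (oO' : open O') (sf : smooth_map O f).
Hypothesis fO : forall p, O p -> O' (f p).
Implicit Type w : N -> seq 'rV[R]_n -> R[i].

Definition mpull (f : M -> N) w p : seq 'rV[R]_m -> R[i] := pull_alt (tangent_map f p) (w (f p)).

Lemma local_form_mpull w c c' x : atlas c -> atlas c' ->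
  chart_img c (O `&` f @^-1` dom c') x ->
  local_form (mpull f w) c x = lpull (coord c' \o f \o point c) (local_form w c') x.
Proof.
move=> h h' [p [d [Op d']] <-].
apply: etrans (local_formE (mpull f w) h d) _.
apply: etrans _ (congr1 (fun y => pull_alt (map_jac f c c' p) (local_form w c' y))
  (esym (exprE f c' h d))).
apply: etrans _ (congr1 (pull_alt (map_jac f c c' p)) (esym (local_formE w h' d'))).
apply: etrans (pull_pull _ _ _) _.
apply: etrans _ (esym (pull_pull _ _ _)).
exact: (congr1 (fun A => pull_alt A (w (f p))) (esym (map_jac_chart oO sf h h' d Op d'))).
Qed.

Lemma expr_img c c' x : atlas c -> atlas c' -> chart_img c (O `&` f @^-1` dom c') x ->
  chart_img c' O' ((coord c' \o f \o point c) x).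
Proof.
move=> h h' [p [d [Op d']] <-]; rewrite (exprE f c' h d).
by exists (f p) => //; split=> //; exact: fO.
Qed.

Lemma smooth_mpull w : smooth_form O' w -> smooth_form O (mpull f w).
Proof.
move=> sw; apply: smooth_form_local => // [p Op|p Op].
  exact/alternating_pull/sw.1/fO.
pose c := chart_at p; pose c' := chart_at (f p).
have hc : atlas c := chart_at_atlas p.
have hc' : atlas c' := chart_at_atlas (f p).
have oD := open_map_dom oO sf hc'.
exists c, (O `&` f @^-1` dom c'); split=> //; first exact: chart_at_dom.
  by split=> //; exact: chart_at_dom.
have oI := open_chart_img hc oD.
have L := lsmooth_lpull oI (fun x => expr_img hc hc') (smooth_expr sf hc hc')
  (lsmooth_local_form sw hc').
split=> [x hx|s].
  by rewrite (local_form_mpull w hc hc' hx); exact: L.1.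
apply: csmooth_eq oI _ (L.2 s) => x hx.
exact: (congr1 (fun b => b s) (esym (local_form_mpull w hc hc' hx))).
Qed.

Lemma ext_d_mpull w p : smooth_form O' w -> O p -> ext_d (mpull f w) p = mpull f (ext_d w) p.
Proof.
move=> sw Op.
pose c := chart_at p; pose c' := chart_at (f p).
have hc : atlas c := chart_at_atlas p.
have hc' : atlas c' := chart_at_atlas (f p).
have oI := open_chart_img hc (open_map_dom oO sf hc').
have xI : chart_img c (O `&` f @^-1` dom c') (coord c p).
  by exists p => //; split; [exact: chart_at_dom|split=> //; exact: chart_at_dom].
have H1 : ext_d (mpull f w) p =
    local_ext_d (lpull (coord c' \o f \o point c) (local_form w c')) (coord c p).
  by apply: (ext_d_eq oI xI) => x hx; exact: (local_form_mpull w hc hc').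
apply: etrans H1 _.
apply: etrans (ext_d_lpull oI (open_chart_img hc' oO') (fun x => expr_img hc hc')
  (smooth_expr sf hc hc') (lsmooth_local_form sw hc') xI) _.
exact: (congr1 (fun y => pull_alt (tangent_map f p) (local_ext_d (local_form w c') y))
  (exprE f c' hc (chart_at_dom p))).
Qed.

End Pullback.

(** * Generalized complex structures on manifolds *)

Section GenPush.
Variables (R : realType) (m : nat).
Implicit Types A B : 'M[R]_m.

Lemma invmx_eq n (A B : 'M[R]_n) : A *m B = 1%:M -> invmx A = B.
Proof. by move=> AB; have [uA _] := mulmx1_unit AB; rewrite -[B](mulKmx uA) AB mulmx1. Qed.

Lemma gen_push_unit A : A \in unitmx -> gen_push A \in unitmx.
Proof. by move=> uA; have [] := mulmx1_unit (gen_push_inv uA). Qed.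

Lemma invmx_gen_push A : A \in unitmx -> invmx (gen_push A) = gen_push (invmx A).
Proof. by move=> uA; apply: invmx_eq; exact: gen_push_inv. Qed.

Lemma gen_push1 : gen_push 1%:M = 1%:M :> 'M[R]_(m + m).
Proof. by rewrite /gen_push invmx1 trmx1 -scalar_mx_block. Qed.

Lemma gen_pushM A B : A \in unitmx -> B \in unitmx ->
  gen_push (A *m B) = gen_push A *m gen_push B.
Proof.
move=> uA uB; have -> : gen_push A *m gen_push B =
    block_mx (A *m B) 0 0 ((invmx A)^T *m (invmx B)^T).
  by rewrite /gen_push mulmx_block !mulmx0 !mul0mx !addr0 !add0r.
rewrite /gen_push -trmx_mul; congr (block_mx _ _ _ _^T); apply: invmx_eq.
by rewrite mulmxA mulmxK // mulmxV.
Qed.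

Lemma mul_gen_push A (v : 'rV[R]_(m + m)) :
  v *m gen_push A = row_mx (lsubmx v *m A) (rsubmx v *m (invmx A)^T).
Proof. by rewrite /gen_push -{1}[v]hsubmxK mul_row_block !mulmx0 addr0 add0r. Qed.

Lemma pairing_gen_push A (v w : 'rV[R]_(m + m)) : A \in unitmx ->
  pairing (v *m gen_push A) (w *m gen_push A) = pairing v w.
Proof.
move=> uA; rewrite !mul_gen_push /pairing !row_mxKl !row_mxKr.
have E (a X : 'rV[R]_m) : covec (a *m (invmx A)^T) (X *m A) = covec a X.
  rewrite /covec trmx_mul -mulmxA (mulmxA (invmx A)^T) -trmx_mul.
  by rewrite mulmxV // trmx1 mul1mx.
by rewrite !E.
Qed.

End GenPush.

Section CourantGerm.
Variables (R : realType) (m : nat).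
Notation U := 'rV[R]_m.

Lemma open_derive (V : normedModType R) (O : set U) (f g : U -> V) x v : open O -> O x ->
  (forall y, O y -> f y = g y) -> 'D_v f x = 'D_v g x.
Proof.
move=> oO Ox fg; apply: near_eq_derive.
by have := open_nbhs_nbhs (conj oO Ox); apply: filterS => y /fg.
Qed.

Lemma local_courant_eq (O : set U) (Y Y' Z Z' : U -> 'rV[R]_(m + m)) x : open O -> O x ->
  (forall y, O y -> Y y = Y' y) -> (forall y, O y -> Z y = Z' y) ->
  local_courant Y Z x = local_courant Y' Z' x.
Proof.
move=> oO Ox YY ZZ; rewrite /local_courant /contract_d.
have D (n : nat) (f g : U -> 'rV[R]_n) v : (forall y, O y -> f y = g y) ->
  'D_v f x = 'D_v g x by exact: open_derive.
have r (f g : U -> R^o) : (forall y, O y -> f y = g y) ->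
  \row_k 'D_(delta_mx 0 k) f x = \row_k 'D_(delta_mx 0 k) g x :> 'rV[R]_m.
  by move=> fg; apply/rowP => k; rewrite !mxE; exact: (open_derive _ oO Ox fg).
have Yx := YY x Ox; have Zx := ZZ x Ox; rewrite Yx Zx.
rewrite (D _ (fun y => lsubmx (Z y)) (fun y => lsubmx (Z' y))); last by move=> y /ZZ ->.
rewrite (D _ (fun y => lsubmx (Y y)) (fun y => lsubmx (Y' y))); last by move=> y /YY ->.
rewrite (D _ (fun y => rsubmx (Z y)) (fun y => rsubmx (Z' y))); last by move=> y /ZZ ->.
rewrite (D _ (fun y => rsubmx (Y y)) (fun y => rsubmx (Y' y))); last by move=> y /YY ->.
rewrite (r (fun y => covec (rsubmx (Z y)) (lsubmx (Y' x)))
  (fun y => covec (rsubmx (Z' y)) (lsubmx (Y' x)))); last by move=> y /ZZ ->.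
rewrite (r (fun y => covec (rsubmx (Y y)) (lsubmx (Z' x)))
  (fun y => covec (rsubmx (Y' y)) (lsubmx (Z' x)))); last by move=> y /YY ->.
rewrite (r (fun y => covec (rsubmx (Z y)) (lsubmx (Y y)) - covec (rsubmx (Y y)) (lsubmx (Z y)))
  (fun y => covec (rsubmx (Z' y)) (lsubmx (Y' y)) - covec (rsubmx (Y' y)) (lsubmx (Z' y)))).
  by [].
by move=> y Oy; rewrite (YY y Oy) (ZZ y Oy).
Qed.

End CourantGerm.

Section SmoothJacobian.
Variables (R : realType) (m n p : nat).

Lemma Cn_mulmx k (U : normedModType R) (O : set U) q r s (A : U -> 'M[R]_(q, r))
    (B : U -> 'M[R]_(r, s)) : open O -> Cn k O A -> Cn k O B -> Cn k O (fun x => A x *m B x).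
Proof.
move=> oO hA hB; apply/(Cn_mxP _ _ oO) => i j.
have hA' := (Cn_mxP _ _ oO).1 hA; have hB' := (Cn_mxP _ _ oO).1 hB.
apply: (Cn_eq (f := fun x => \sum_t (A x i t * B x t j : R^o)) oO).
  by move=> x _; rewrite mxE.
by apply: (Cn_sum _ _ oO) => t; apply: (CnM oO (hA' _ _) (hB' _ _)).
Qed.

Lemma smooth_jacobian (O : set 'rV[R]_m) (g : 'rV[R]_m -> 'rV[R]_n) : open O ->
  smooth_on O g -> smooth_on O (jacobian g : 'rV[R]_m -> 'M[R]_(m, n)).
Proof.
move=> oO sg k; apply/(Cn_mxP _ _ oO) => i j.
apply: (Cn_eq (f := fun x => 'D_(delta_mx 0 i) (fun y => g y 0 j : R^o) x) oO).
  by move=> x Ox; rewrite (jacobian_delta sg).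
exact: (smooth_coord oO sg j k.+1).2.
Qed.

(** The inverse is supplied as a smooth function, so matrix inversion is never differentiated. For
    transition maps it is the Jacobian of the inverse transition. *)
Lemma smooth_gen_push (U : normedModType R) (O : set U) (A B : U -> 'M[R]_m) : open O ->
  smooth_on O A -> smooth_on O B -> (forall x, O x -> invmx (A x) = B x) ->
  smooth_on O (fun x => gen_push (A x)).
Proof.
move=> oO sA sB AB k; apply: (Cn_eq (f := fun x => block_mx (A x) 0 0 (B x)^T) oO).
  by move=> x Ox; rewrite /gen_push AB.
have hA := (Cn_mxP _ _ oO).1 (sA k); have hB := (Cn_mxP _ _ oO).1 (sB k).
have E (i j : 'I_m) (x : U) : (B x)^T i j = B x j i by rewrite mxE.
apply/(Cn_mxP _ _ oO) => i j; case: (split_ordP i) => i' ->; case: (split_ordP j) => j' ->.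
- by apply: (Cn_eq (f := fun x => A x i' j' : R^o) oO) => // x _; rewrite block_mxEul.
- by apply: (Cn_eq (f := fun=> 0 : R^o) oO) => [x _|]; [rewrite block_mxEur mxE|exact: Cn_cst].
- by apply: (Cn_eq (f := fun=> 0 : R^o) oO) => [x _|]; [rewrite block_mxEdl mxE|exact: Cn_cst].
- by apply: (Cn_eq (f := fun x => B x j' i' : R^o) oO) => // x _; rewrite block_mxEdr E.
Qed.

End SmoothJacobian.

Lemma smooth_trans_jac (R : realType) m (M : manifold R m) (c c' : chart R m M) :
  atlas c -> atlas c' ->
  smooth_on (chart_img c' (dom c)) (fun x => trans_jac c c' (point c' x)).
Proof.
move=> hc hc'; have oD := open_chart_img hc' (open_dom hc).
have oD' := open_chart_img hc (open_dom hc').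
have s1 := smooth_transition hc' hc.
have sj := smooth_jacobian oD' (smooth_transition hc hc').
move=> k; apply/(Cn_mxP _ _ oD) => i j.
apply: (Cn_comp (O' := chart_img c (dom c')) (f := coord c \o point c')
  (g := fun z => (jacobian (coord c' \o point c) z : 'M[R]_m) i j : R^o) oD _ (s1 k)).
  by move=> x /(chart_imgP hc')[d' d _]; exists (point c' x).
have H := (Cn_mxP _ _ oD').1 (sj k); exact: H.
Qed.

(** * Spinor components of forms under a generalized complex structure on a manifold *)

Section GenComplexSpin.
Variables (R : realType) (m : nat) (N : manifold R m) (O : set N) (J : N -> 'M[R]_(m + m)).
Hypotheses (oO : open O) (hJ : gen_complex O J).
Notation C := R[i].
Notation rvec := 'rV[R]_(m + m).
Implicit Types (c : chart R m N) (p : N) (w : N -> seq 'rV[R]_m -> C).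

Lemma gen_square p : O p -> J p *m J p = - 1%:M.
Proof. by have [_ h _ _] := hJ; exact: h. Qed.

Lemma gen_orth p : O p -> forall v w : rvec, pairing (v *m J p) (w *m J p) = pairing v w.
Proof. by have [_ _ h _] := hJ => Op v w; exact: h. Qed.

Let P c p := gen_push (to_pref c p).

Let Pu c p : atlas c -> dom c p -> P c p \in unitmx.
Proof. by move=> hc d; exact: (gen_push_unit (to_pref_unit hc d)). Qed.

Lemma local_endoE c p : atlas c -> dom c p ->
  local_endo J c (coord c p) = P c p *m J p *m invmx (P c p).
Proof. by move=> hc d; rewrite /local_endo chart_pointK. Qed.

Lemma local_endo_push c p : atlas c -> dom c p ->
  local_endo J c (coord c p) *m P c p = P c p *m J p.
Proof. by move=> hc d; rewrite (local_endoE hc d) mulmxKV // Pu. Qed.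

Lemma local_endo_square c x : atlas c -> chart_img c O x ->
  local_endo J c x *m local_endo J c x = - 1%:M.
Proof.
move=> hc [p [d Op] <-]; rewrite (local_endoE hc d).
rewrite -!mulmxA (mulmxA (invmx _)) mulVmx ?Pu // mul1mx (mulmxA (J p)) (gen_square Op).
by rewrite mulNmx mul1mx mulmxN mulmxV // Pu.
Qed.

Lemma local_endo_orth c x : atlas c -> chart_img c O x -> forall v w : rvec,
  pairing (v *m local_endo J c x) (w *m local_endo J c x) = pairing v w.
Proof.
move=> hc [p [d Op] <-] v w; have u := to_pref_unit hc d.
rewrite (local_endoE hc d) /P invmx_gen_push // !mulmxA.
rewrite pairing_gen_push ?unitmx_inv // (gen_orth Op) pairing_gen_push //.
Qed.

Lemma local_form_spart k w c x : smooth_form O w -> (k <= m)%N -> atlas c -> chart_img c O x ->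
  local_form (fun p => spart (J p) k (w p)) c x = spart (local_endo J c x) k (local_form w c x).
Proof.
move=> sw km hc hx; have sq := local_endo_square hc hx; have orth := local_endo_orth hc hx.
case: hx sq orth => p [d Op] <- sq orth.
apply: etrans (local_formE (fun p => spart (J p) k (w p)) hc d) _.
apply: etrans _ (congr1 (spart (local_endo J c (coord c p)) k) (esym (local_formE w hc d))).
apply/esym; exact: (spart_pull (to_pref_unit hc d) (local_endo_push hc d) sq orth
  (gen_square Op) (gen_orth Op) (sw.1 p Op) km).
Qed.

Lemma smooth_local_endo c : atlas c -> smooth_on (chart_img c O) (local_endo J c).
Proof. by have [h _ _ _] := hJ; exact: h. Qed.

Lemma smooth_spart k w : smooth_form O w -> (k <= m)%N ->
  smooth_form O (fun p => spart (J p) k (w p)).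
Proof.
move=> sw km; split=> [p Op|c s hc]; first exact/alternating_spart/sw.1.
have oI := open_chart_img hc oO.
have H := lsmooth_spart oI (smooth_local_endo hc) k (lsmooth_local_form sw hc).
apply: csmooth_eq oI _ (H.2 s) => x hx.
exact: (congr1 (fun b => b s) (esym (local_form_spart sw km hc hx))).
Qed.

(** The section with constant coordinates [Y] in the chart [c]. Integrability, being assumed for
    sections over all open subsets, may be tested on it. *)
Let frame c (Y : rvec) p : rvec := Y *m P c p.

Let local_frame c Y x : atlas c -> chart_img c (O `&` dom c) x ->
  local_section (frame c Y) c x = Y.
Proof.
move=> hc [p [d [Op _]] <-]; rewrite /local_section /frame chart_pointK // mulmxK //.
exact: Pu.
Qed.

Let local_frameJ c Y x : atlas c -> chart_img c (O `&` dom c) x ->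
  local_section (fun p => frame c Y p *m J p) c x = Y *m local_endo J c x.
Proof.
move=> hc [p [d [Op _]] <-]; rewrite (local_endoE hc d) /local_section /frame.
by rewrite chart_pointK // !mulmxA.
Qed.

Let smooth_frame c Y : atlas c -> smooth_section (O `&` dom c) (frame c Y).
Proof.
move=> hc c' hc'.
have oD : open (chart_img c' (O `&` dom c)).
  by apply: open_chart_img hc' _; apply: openI => //; exact: open_dom.
have s1 : smooth_on (chart_img c' (O `&` dom c)) (coord c \o point c').
  by move=> k; apply: Cn_subset (smooth_transition hc' hc k); apply: chart_imgS; exact: subIsetr.
have s2 : smooth_on (chart_img c' (O `&` dom c))
    (fun x => trans_jac c c' (point c' x)).
  by move=> k; apply: Cn_subset (smooth_trans_jac hc hc' k); apply: chart_imgS; exact: subIsetr.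
have s3 := smooth_gen_push oD s2 (smooth_jacobian oD s1).
have E x : chart_img c' (O `&` dom c) x ->
    invmx (jacobian (coord c' \o point c) (coord c (point c' x))) =
    jacobian (coord c \o point c') x.
  move=> /(chart_imgP hc')[d' [_ d] cx]; rewrite -{2}cx.
  exact: (invmx_eq (trans_jac_inv hc hc' d d')).
move=> k; apply: (Cn_eq (f := fun x => Y *m gen_push
    (jacobian (coord c' \o point c) (coord c (point c' x)))) oD).
  move=> x /(chart_imgP hc')[d' [_ d] cx]; rewrite /local_section /frame /P.
  have -> : to_pref c (point c' x) = trans_jac c c' (point c' x) *m to_pref c' (point c' x).
    exact: (to_pref_trans hc hc' d d').
  rewrite gen_pushM; [|exact: (trans_jac_unit hc hc' d d')|exact: (to_pref_unit hc' d')].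
  by rewrite -mulmxA mulmxK // Pu.
apply: (Cn_mulmx oD); first exact: Cn_cst.
exact: (s3 E k).
Qed.

(** Integrability is applied over the domain of the preferred chart at [p], where the change of
    coordinates at [p] is the identity, so the global bracket is the local one. *)
Lemma local_nijenhuis p (Y Z : rvec) : O p ->
  let Jc := local_endo J (chart_at p) in let x := coord (chart_at p) p in
  local_courant (fun y => Y *m Jc y) (fun y => Z *m Jc y) x
  - local_courant (fun=> Y) (fun y => Z *m Jc y) x *m Jc x
  - local_courant (fun y => Y *m Jc y) (fun=> Z) x *m Jc x
  + local_courant (fun=> Y) (fun=> Z) x *m Jc x *m Jc x = 0.
Proof.
move=> Op Jc x.
set c := chart_at p in Jc x *.
have hc : atlas c := chart_at_atlas p.
have dc : dom c p := chart_at_dom p.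
have oW : open (O `&` dom c) by apply: openI => //; exact: open_dom.
have oI := open_chart_img hc oW.
have xI : chart_img c (O `&` dom c) x by exists p.
have [_ _ _ h] := hJ.
have := h _ _ _ oW (@subIsetl _ _ _) (smooth_frame Y hc) (smooth_frame Z hc) p (conj Op dc).
have Jp : Jc x = J p.
  by rewrite /Jc (local_endoE hc dc) /P to_pref_self gen_push1 invmx1 mul1mx mulmx1.
rewrite /= /courant -/c Jp.
have e1 := fun y hy => @local_frame c Y y hc hy.
have e2 := fun y hy => @local_frame c Z y hc hy.
have e3 := fun y hy => @local_frameJ c Y y hc hy.
have e4 := fun y hy => @local_frameJ c Z y hc hy.
rewrite (local_courant_eq oI xI e3 e4) (local_courant_eq oI xI e1 e4).
by rewrite (local_courant_eq oI xI e3 e2) (local_courant_eq oI xI e1 e2).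
Qed.

Lemma spart_ext_d_form k j w p : smooth_form O w -> (k <= m)%N -> (j <= m)%N ->
  j != k.+1 -> k != j.+1 -> O p ->
  spart (J p) j (ext_d (fun q => spart (J q) k (w q)) p) = 0.
Proof.
move=> sw km jm jk kj Op.
pose c := chart_at p.
have hc : atlas c := chart_at_atlas p.
have dc : dom c p := chart_at_dom p.
have oI := open_chart_img hc oO.
have xI : chart_img c O (coord c p) by exists p.
have Jp : local_endo J c (coord c p) = J p.
  by rewrite (local_endoE hc dc) /P to_pref_self gen_push1 invmx1 mul1mx mulmx1.
have H := spart_ext_d oI xI (smooth_local_endo hc) (fun y hy => local_endo_square hc hy)
  (fun y hy => local_endo_orth hc hy) (fun Y Z => @local_nijenhuis p Y Z Op)
  (lsmooth_local_form sw hc) km jm jk kj.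
apply: etrans H; rewrite Jp; congr (spart _ _ _).
by apply: (ext_d_eq oI xI) => x hx; exact: (local_form_spart sw km hc hx).
Qed.

End GenComplexSpin.

(** * Smooth maps and local diffeomorphisms *)

Section SmoothMaps.
Variable R : realType.

Lemma smooth_comp_mx (U : normedModType R) n k (O : set U) (O' : set 'rV[R]_n)
    (f : U -> 'rV[R]_n) (g : 'rV[R]_n -> 'rV[R]_k) : open O -> open O' ->
  (forall x, O x -> O' (f x)) -> smooth_on O f -> smooth_on O' g ->
  smooth_on O (fun x => g (f x)).
Proof.
move=> oO oO' fO sf sg r; apply/(Cn_mxP _ _ oO) => i j.
have H := (Cn_mxP _ _ oO').1 (sg r) i j.
exact: (Cn_comp oO fO (sf r) H).
Qed.

Lemma smooth_eq (U V : normedModType R) (O : set U) (f g : U -> V) : open O ->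
  (forall x, O x -> f x = g x) -> smooth_on O f -> smooth_on O g.
Proof. by move=> oO fg sf k; exact: (Cn_eq oO fg (sf k)). Qed.

Lemma smooth_subset (U V : normedModType R) (O O' : set U) (g : U -> V) :
  O' `<=` O -> smooth_on O g -> smooth_on O' g.
Proof. by move=> s sg k; exact: (Cn_subset s (sg k)). Qed.

Section Local.
Variables (m n : nat) (M : manifold R m) (N : manifold R n).

Lemma smooth_map_local (O : set M) (f : M -> N) : open O ->
  (forall p, O p -> {for p, continuous f}) ->
  (forall p, O p -> exists c c' (W : set M), [/\ atlas c, atlas c', dom c p, dom c' (f p) &
     [/\ open W, W p & smooth_on (chart_img c W) (coord c' \o f \o point c)]]) ->
  smooth_map O f.
Proof.
move=> oO cf hl; split=> // d d' hd hd' k; apply/Cn_pointwise => x [p [[dp Op] d'p] <-].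
have [c [c' [W [hc hc' cp c'p [oW Wp sW]]]]] := hl p Op.
pose Z := (O `&` f @^-1` (dom c' `&` dom d')) `&` (W `&` dom c).
have oZ : open Z.
  apply: openI; last by apply: openI => //; exact: open_dom.
  by apply: (open_preimage_in oO cf); apply: openI; exact: open_dom.
have Zp : Z p by [].
have oI := open_chart_img hd oZ.
have s1 : smooth_on (chart_img d Z) (coord c \o point d).
  apply: smooth_subset (smooth_transition hd hc).
  by apply: chart_imgS => q [_ []].
have s2 : smooth_on (chart_img c Z) (coord c' \o f \o point c).
  by apply: smooth_subset sW; apply: chart_imgS => q [_ []].
have s3 : smooth_on (chart_img c' (dom d')) (coord d' \o point c') := smooth_transition hc' hd'.
have i1 y : chart_img d Z y -> chart_img c Z (coord c (point d y)).
  by move=> [q [dq Zq] <-]; rewrite chart_pointK //; exists q => //; split=> //; case: Zq => _ [].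
have i2 y : chart_img d Z y -> chart_img c' (dom d') (coord c' (f (point c (coord c (point d y))))).
  move=> [q [dq Zq] <-]; rewrite (chart_pointK hd dq) chart_pointK //; last by case: Zq => _ [].
  by case: Zq => -[_ [c'q d'q]] _; exists (f q).
have s12 := smooth_comp_mx oI (open_chart_img hc oZ) i1 s1 s2.
have s := smooth_comp_mx oI (open_chart_img hc' (open_dom hd')) i2 s12 s3.
apply: (@Cn_subset _ _ _ k (chart_img d Z)); first by move=> y ->; exists p.
apply: (smooth_eq oI _ s) => y [q [dq Zq] <-] /=.
case: Zq => -[_ [c'q d'q]] [_ cq].
by rewrite (chart_pointK hd dq) (chart_pointK hc cq) (chart_pointK hc' c'q).
Qed.

Lemma smooth_map_eq (O : set M) (f g : M -> N) : open O -> (forall p, O p -> f p = g p) ->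
  smooth_map O f -> smooth_map O g.
Proof.
move=> oO fg sf.
have cg p : O p -> {for p, continuous g}.
  move=> Op.
  have nfg : {near p, f =1 g} by have := open_nbhs_nbhs (conj oO Op); apply: filterS => q /fg.
  rewrite /prop_for /continuous_at -(fg p Op).
  exact: cvg_trans (near_eq_cvg nfg) (sf.1 p Op).
split=> // c c' hc hc'.
have -> : coord c @` (dom c `&` O `&` g @^-1` dom c') =
    coord c @` (dom c `&` O `&` f @^-1` dom c').
  by apply/seteqP; split=> x [p [[d Op] d'] <-]; exists p => //; split=> //;
    move: d'; rewrite /preimage /= fg.
have oI : open (chart_img c (O `&` f @^-1` dom c')) := open_chart_img hc (open_map_dom oO sf hc').
have E : coord c @` (dom c `&` O `&` f @^-1` dom c') = chart_img c (O `&` f @^-1` dom c').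
  by rewrite /chart_img setIA.
rewrite E; apply: (smooth_eq oI _ (smooth_expr sf hc hc')) => x [p [d [Op _]] <-] /=.
by rewrite (chart_pointK hc d) fg.
Qed.

End Local.

Lemma smooth_map_comp m n k (M : manifold R m) (N : manifold R n) (P : manifold R k)
    (O : set M) (O' : set N) (f : M -> N) (g : N -> P) : open O -> open O' ->
  smooth_map O f -> smooth_map O' g -> smooth_map (O `&` f @^-1` O') (g \o f).
Proof.
move=> oO oO' sf sg; have oZ := open_preimage_in oO sf.1 oO'.
apply: smooth_map_local => // [p [Op Op']|p [Op Op']].
  by apply: continuous_comp; [exact: sf.1|exact: sg.1].
pose c := chart_at p; pose c' := chart_at (f p); pose c'' := chart_at (g (f p)).
have hc : atlas c := chart_at_atlas p.
have hc' : atlas c' := chart_at_atlas (f p).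
have hc'' : atlas c'' := chart_at_atlas (g (f p)).
have oW' := open_map_dom oO' sg hc''.
have oW : open (O `&` f @^-1` (dom c' `&` (O' `&` g @^-1` dom c''))).
  by apply: (open_preimage_in oO sf.1); apply: openI => //; exact: open_dom.
exists c, c'', (O `&` f @^-1` (dom c' `&` (O' `&` g @^-1` dom c''))); split=> //.
- exact: chart_at_dom.
- exact: (chart_at_dom (g (f p))).
split=> //.
  split=> //; split; first exact: (chart_at_dom (f p)).
  by split=> //; exact: (chart_at_dom (g (f p))).
have oI := open_chart_img hc oW.
have s1 : smooth_on (chart_img c (O `&` f @^-1` (dom c' `&` (O' `&` g @^-1` dom c''))))
    (coord c' \o f \o point c).
  by apply: smooth_subset (smooth_expr sf hc hc'); apply: chart_imgS => q [? []].
have i1 y : chart_img c (O `&` f @^-1` (dom c' `&` (O' `&` g @^-1` dom c''))) y ->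
    chart_img c' (O' `&` g @^-1` dom c'') (coord c' (f (point c y))).
  by move=> [q [dq [Oq [c'q h]]] <-]; rewrite (chart_pointK hc dq); exists (f q).
have s := smooth_comp_mx oI (open_chart_img hc' oW') i1 s1 (smooth_expr sg hc' hc'').
apply: (smooth_eq oI _ s) => y [q [dq [Oq [c'q h]]] <-] /=.
by rewrite (chart_pointK hc dq) (chart_pointK hc' c'q).
Qed.

Section LocalDiffeo.
Variables (m : nat) (N : manifold R m).
Implicit Types (O W : set N) (f g h : N -> N).

Lemma local_diffeo_id O : open O -> local_diffeo O id.
Proof.
move=> oO; split=> //; first by rewrite image_id.
  exact: smooth_map_id.
by exists id => //; exact: smooth_map_id.
Qed.

(** The image of [W] is open as the preimage of [W] under the continuous inverse, within the open
    image of [O]. *)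
Lemma local_diffeo_subset O W h : open W -> W `<=` O -> local_diffeo O h -> local_diffeo W h.
Proof.
move=> oW WO [oO oI sh [h' sh' h'h]].
have E : h @` W = h @` O `&` h' @^-1` W.
  apply/seteqP; split=> [_ [y Wy <-]|_ [[y Oy <-]]].
    by split; [exists y => //; exact: WO|rewrite /preimage /= h'h //; exact: WO].
  by rewrite /preimage /= h'h // => Wy; exists y.
split=> //.
- by rewrite E; exact: (open_preimage_in oI sh'.1).
- exact: smooth_map_subset sh.
exists h' => [|y /WO]; last exact: h'h.
by apply: smooth_map_subset sh'; exact: image_subset.
Qed.

Lemma local_diffeo_eq O g h : (forall y, O y -> g y = h y) -> local_diffeo O g -> local_diffeo O h.
Proof.
move=> gh [oO oI sg [g' sg' g'g]].
have E : h @` O = g @` O by apply: eq_imagel => y /gh.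
split=> //; [by rewrite E|exact: smooth_map_eq sg|].
by rewrite E; exists g' => // y Oy; rewrite -gh //; exact: g'g.
Qed.

Lemma local_diffeo_comp O W g h : local_diffeo O g -> local_diffeo W h ->
  local_diffeo (O `&` g @^-1` W) (h \o g).
Proof.
move=> lg lh; have [oO oI sg [g' sg' g'g]] := lg; have [oW oJ sh [h' sh' h'h]] := lh.
have oZ : open (O `&` g @^-1` W) := open_preimage_in oO sg.1 oW.
have [_ oA _ _] := local_diffeo_subset oZ (@subIsetl _ _ _) lg.
have E : (h \o g) @` (O `&` g @^-1` W) = h @` (g @` (O `&` g @^-1` W)).
  by rewrite image_comp.
have AW : g @` (O `&` g @^-1` W) `<=` W by move=> _ [y [_ ?] <-].
have [_ oB _ _] := local_diffeo_subset oA AW lh.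
have si : smooth_map (h @` W `&` h' @^-1` (g @` O)) (g' \o h').
  exact: smooth_map_comp oJ oI sh' sg'.
split=> //; first by rewrite E.
  exact: smooth_map_comp oO oW sg sh.
exists (g' \o h') => [|y [Oy Wy]] /=; last by rewrite h'h // g'g.
apply: smooth_map_subset si => _ [y [Oy Wy] <-]; split; first by exists (g y).
by rewrite /preimage /= h'h //; exists y.
Qed.

Lemma local_diffeo_inv O h h' : local_diffeo O h -> (forall y, O y -> h' (h y) = y) ->
  local_diffeo (h @` O) h'.
Proof.
move=> [oO oI sh [g sg gh]] h'h.
have E : h' @` (h @` O) = O.
  apply/seteqP; split=> [_ [_ [y Oy <-] <-]|y Oy]; first by rewrite h'h.
  by exists (h y); [exists y|exact: h'h].
split=> //; first by rewrite E.
  by apply: smooth_map_eq sg => // _ [y Oy <-]; rewrite gh // h'h.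
by exists h; [rewrite E|move=> _ [y Oy <-]; rewrite h'h].
Qed.

Lemma tangent_map_inv O h h' y : local_diffeo O h -> (forall z, O z -> h' (h z) = z) -> O y ->
  tangent_map h y *m tangent_map h' (h y) = 1%:M.
Proof.
move=> lh h'h Oy; have [oO _ sh _] := lh.
have [_ _ sh' _] := local_diffeo_inv lh h'h.
have hy : (h @` O) (h y) by exists y.
rewrite -(tangent_map_comp oO sh sh' Oy hy) -(tangent_map_id y).
by apply/esym/(tangent_map_eq oO (@smooth_map_id _ _ _ O) Oy) => z /h'h.
Qed.

End LocalDiffeo.
End SmoothMaps.

(** * Submersions and foliations *)

Section Projections.
Variables (R : realType) (m l : nat).

Lemma smooth_id (U : normedModType R) (O : set U) : smooth_on O (id : U -> U).
Proof.
case=> [|k] /=; first by move=> x _; exact: id.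
split=> [x _|v]; first by apply: ex_diff; exact: is_diff_id.
have -> : (fun x : U => 'D_v id x) = fun=> v by apply/funext => x; exact: derive_id.
exact: Cn_cst.
Qed.

Definition first_proj : 'M[R]_(m + l, m) := col_mx 1%:M 0.
Definition first_incl : 'M[R]_(m, m + l) := row_mx 1%:M 0.

Lemma mul_first_proj (u : 'rV[R]_(m + l)) : u *m first_proj = lsubmx u.
Proof. by rewrite -{1}[u]hsubmxK mul_row_col mulmx1 mulmx0 addr0. Qed.

Lemma first_inclK : first_incl *m first_proj = 1%:M.
Proof. by rewrite mul_row_col mulmx1 mulmx0 addr0. Qed.

Lemma smooth_lsubmx (O : set 'rV[R]_(m + l)) : open O ->
  smooth_on O (lsubmx : 'rV[R]_(m + l) -> 'rV[R]_m).
Proof.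
move=> oO k; apply/(Cn_mxP _ _ oO) => i j.
have H := (Cn_mxP _ _ oO).1 (@smooth_id _ O k) i (lshift l j).
by apply: (Cn_eq oO _ H) => x _; rewrite mxE.
Qed.

Lemma smooth_row_mx (r : 'rV[R]_l) (O : set 'rV[R]_m) : open O ->
  smooth_on O (fun z : 'rV[R]_m => row_mx z r : 'rV[R]_(m + l)).
Proof.
move=> oO k; apply/(Cn_mxP _ _ oO) => i j.
have H := (Cn_mxP _ _ oO).1 (@smooth_id _ O k) i.
case: (split_ordP j) => j' ->.
  by apply: (Cn_eq oO _ (H j')) => x _; rewrite row_mxEl.
by apply: (Cn_eq oO _ (@Cn_cst _ _ _ k O (r i j' : R^o))) => x _; rewrite row_mxEr.
Qed.

Lemma continuous_row_mx (r : 'rV[R]_l) :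
  continuous (fun z : 'rV[R]_m => row_mx z r : 'rV[R]_(m + l)).
Proof. by move=> z; exact: (Cn_continuous (smooth_row_mx r openT 0)). Qed.

Lemma jacobian_lsubmx (x : 'rV[R]_(m + l)) :
  jacobian (lsubmx : 'rV[R]_(m + l) -> 'rV[R]_m) x = first_proj.
Proof.
have cl : continuous (lsubmx : 'rV[R]_(m + l) -> 'rV[R]_m).
  by move=> y; exact: (Cn_continuous (smooth_lsubmx openT 0)).
have dl := linear_differentiable x cl.
apply: jacobian_ext => // u.
by rewrite mul_first_proj deriveE // diff_lin.
Qed.

End Projections.

Section Submersion.
Variables (R : realType) (m l : nat) (M : manifold R (m + l)) (N : manifold R m).
Variables (O : set M) (f : M -> N).
Hypotheses (oO : open O) (sub : submersion_on O f).
Notation C := R[i].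

Definition adapted (c : chart R (m + l) M) (c' : chart R m N) : Prop :=
  [/\ atlas c, atlas c', dom c `<=` O &
      forall x, dom c x -> dom c' (f x) /\ coord c' (f x) = lsubmx (coord c x)].

Lemma adapted_at p : O p -> exists c c', adapted c c' /\ dom c p.
Proof. by move=> /sub[c [c' [h1 h2 h3 h4 h5]]]; exists c, c'. Qed.

Lemma continuous_submersion p : O p -> {for p, continuous f}.
Proof.
move=> /adapted_at[c [c' [[hc hc' cO H] cp]]].
have n1 : nbhs p (dom c) by apply: open_nbhs_nbhs; split=> //; exact: open_dom.
have E : {near p, (point c' \o (lsubmx \o coord c)) =1 f}.
  by apply: filterS n1 => q /H[d' e] /=; rewrite -e chart_pointK.
have [_ _ _ cc _] := atlas_topological hc.
have [_ _ _ _ cc'] := atlas_topological hc'.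
have [d' e] := H p cp.
rewrite /prop_for /continuous_at.
have -> : f p = (point c' \o (lsubmx \o coord c)) p by rewrite /= -e chart_pointK.
apply: cvg_trans (near_eq_cvg E) _.
have c2 : {for p, continuous (lsubmx \o coord c)}.
  apply: continuous_comp; first exact: cc.
  exact: (Cn_continuous (smooth_lsubmx openT 0)).
apply: continuous_comp c2 _; apply: cc'.
by rewrite /= -e; exists (f p).
Qed.

Lemma adapted_expr c c' x : adapted c c' -> chart_img c [set: M] x ->
  (coord c' \o f \o point c) x = lsubmx x.
Proof. by move=> [hc hc' cO H] [p [d _] <-]; have [_ e] := H p d; rewrite /= chart_pointK. Qed.

Lemma smooth_submersion : smooth_map O f.
Proof.
apply: smooth_map_local => // [p|p Op]; first exact: continuous_submersion.
have [c [c' [A cp]]] := adapted_at Op; have [hc hc' cO H] := A.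
exists c, c', setT; split=> //; first exact: (H p cp).1.
split=> //; first exact: openT.
have oI := open_chart_img hc (openT : open [set: M]).
by apply: (smooth_eq oI _ (smooth_lsubmx oI)) => x hx; rewrite (adapted_expr A hx).
Qed.

Lemma adapted_jac c c' p : adapted c c' -> dom c p -> map_jac f c c' p = first_proj R m l.
Proof.
move=> A d; have [hc hc' cO H] := A.
have oI := open_chart_img hc (openT : open [set: M]).
have xI : chart_img c [set: M] (coord c p) by exists p.
rewrite -(jacobian_lsubmx (coord c p)).
apply: (jacobian_eq oI xI) => [x|]; first exact: adapted_expr.
exact: (smooth_lsubmx oI 1).1.
Qed.

Lemma adapted_tangent c c' p : adapted c c' -> dom c p ->
  first_proj R m l *m to_pref c' (f p) = to_pref c p *m tangent_map f p.
Proof.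
move=> A d; have [hc hc' cO H] := A; rewrite -(adapted_jac A d).
exact: (map_jac_chart oO smooth_submersion hc hc' d (cO p d) (H p d).1).
Qed.

Lemma vertical_coord c c' p (u : 'rV[R]_(m + l)) : adapted c c' -> dom c p ->
  ((u *m to_pref c p) *m tangent_map f p = 0) <-> lsubmx u = 0.
Proof.
move=> A d; have [hc hc' cO H] := A.
rewrite -mulmxA -(adapted_tangent A d) mulmxA mul_first_proj; split=> [E|->]; last exact: mul0mx.
by rewrite -[lsubmx u](mulmxK (to_pref_unit hc' (H p d).1)) E mul0mx.
Qed.

(** In adapted charts the differential is a coordinate projection, split by the inclusion of the
    first factor. The splitting makes pull-back of forms along the submersion injective. *)
Lemma tangent_section p : O p -> exists S : 'M[R]_(m, m + l), S *m tangent_map f p = 1%:M.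
Proof.
move=> /adapted_at[c [c' [A cp]]]; have [hc hc' cO H] := A.
exists (invmx (to_pref c' (f p)) *m first_incl R m l *m to_pref c p).
rewrite -(mulmxA _ (to_pref c p)) -(adapted_tangent A cp) mulmxA -(mulmxA (invmx _)) first_inclK mulmx1.
exact: mulVmx (to_pref_unit hc' (H p cp).1).
Qed.

Lemma pull_left_inv_inj n k (A : 'M[R]_(n, k)) (S : 'M[R]_(k, n)) (b b' : seq 'rV[R]_k -> C) :
  S *m A = 1%:M -> pull_alt A b = pull_alt A b' -> b = b'.
Proof. by move=> SA /(congr1 (pull_alt S)); rewrite !pull_pull SA !pull_1. Qed.

Lemma pull_tangent_inj p (b b' : seq 'rV[R]_m -> C) : O p ->
  pull_alt (tangent_map f p) b = pull_alt (tangent_map f p) b' -> b = b'.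
Proof. by move=> /tangent_section[S SA]; exact: pull_left_inv_inj SA. Qed.

Lemma open_submersion_image (W : set M) : open W -> W `<=` O -> open (f @` W).
Proof.
move=> oW WO; apply: open_setP => _ [p Wp <-].
have [c [c' [A cp]]] := adapted_at (WO p Wp); have [hc hc' cO H] := A.
have [d' e] := H p cp.
(* Freezing the last coordinates at their values at [p] gives a continuous local section of the
   submersion near [f p]. *)
set r := rsubmx (coord c p).
have oI := open_chart_img hc oW.
have oZ : open ((fun z : 'rV[R]_m => row_mx z r : 'rV[R]_(m + l)) @^-1` chart_img c W).
  by apply: open_comp oI => z _; exact: continuous_row_mx.
have oV : open (dom c' `&` coord c' @^-1`
    ((fun z : 'rV[R]_m => row_mx z r : 'rV[R]_(m + l)) @^-1` chart_img c W)).
  apply: open_preimage_in oZ; first exact: open_dom.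
  by have [_ _ _ cc _] := atlas_topological hc'.
have n1 := open_nbhs_nbhs (conj oV _).
apply: filterS (n1 (f p) _).
  move=> y [cy [q [dq Wq] eq]]; exists q => //.
  have [d'q e'] := H q dq.
  by rewrite -(chart_pointK hc' d'q) e' eq row_mxKl chart_pointK.
split=> //; rewrite /preimage /= e /r hsubmxK.
by exists p.
Qed.

Section Basic.
Variables (w : M -> seq 'rV[R]_(m + l) -> C) (c : chart R (m + l) M) (c' : chart R m N).
Hypotheses (sw : smooth_form [set: M] w) (A : adapted c c').
Hypothesis hw : forall q v s, dom c q -> v *m tangent_map f q = 0 ->
  w q (v :: s) = 0 /\ ext_d w q (v :: s) = 0.

Let hc : atlas c. Proof. by case: A. Qed.
Let oI : open (chart_img c [set: M]). Proof. by apply: open_chart_img => //; exact: openT. Qed.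

Lemma interior_vertical u x : chart_img c [set: M] x -> lsubmx u = 0 ->
  interior u (local_form w c x) = 0.
Proof.
move=> [p [d _] <-] u0; rewrite (local_formE w hc d); apply/funext => s.
exact: (hw _ d ((vertical_coord _ A d).2 u0)).1.
Qed.

Lemma interior_ext_d_vertical u x : chart_img c [set: M] x -> lsubmx u = 0 ->
  interior u (local_ext_d (local_form w c) x) = 0.
Proof.
move=> [p [d _] <-] u0; rewrite (ext_d_chart openT sw hc d I); apply/funext => s.
exact: (hw _ d ((vertical_coord _ A d).2 u0)).2.
Qed.

Lemma fder_vertical u x : chart_img c [set: M] x -> lsubmx u = 0 ->
  fder u (local_form w c) x = 0.
Proof.
move=> hx u0; have := interior_ext_d u (local_form w c) x.
rewrite (interior_ext_d_vertical hx u0).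
have -> : local_ext_d (fun y => interior u (local_form w c y)) x = 0.
  rewrite -(ext_d0 x); apply: (ext_d_eq oI hx) => y hy; exact: interior_vertical.
by rewrite subr0.
Qed.

(** For vertical [u], Cartan's formula kills the derivative of the form along [u]; the form is
    constant on straight segments of a fibre inside a coordinate ball. *)
Lemma vertical_constant p : dom c p -> \forall q \near p,
  dom c q /\ (f q = f p -> local_form w c (coord c q) = local_form w c (coord c p)).
Proof.
move=> d; have hx : chart_img c [set: M] (coord c p) by exists p.
have [e /= e0 he] := (nbhs_ballP _ _).1 (open_nbhs_nbhs (conj oI hx)).
have [_ _ _ cc _] := atlas_topological hc.
have n1 : nbhs p (coord c @^-1` ball (coord c p) e).
  by apply: (cc p d); exact: nbhsx_ballx.
have n2 : nbhs p (dom c) by apply: open_nbhs_nbhs; split=> //; exact: open_dom.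
apply: filterS (filterI n1 n2) => q [hq dq]; split; first exact: dq.
move=> fqp.
set v := coord c q - coord c p.
have v0 : lsubmx v = 0.
  have [_ _ _ H] := A.
  by rewrite /v raddfB /= -(H q dq).2 -(H p d).2 fqp subrr.
have seg t : 0 <= t <= 1 -> chart_img c [set: M] (coord c p + t *: v).
  move=> /andP[t0 t1]; apply: he; rewrite -ball_normE /= opprD addNKr normrN normrZ ger0_norm //.
  apply: le_lt_trans (ler_piMl (normr_ge0 _) t1) _.
  by move: hq; rewrite /preimage /= -ball_normE /= distrC.
have E : coord c q = coord c p + v by rewrite /v addrC subrK.
apply: etrans (congr1 (local_form w c) E) _.
apply/funext => s; apply: (cconst_segment (g := fun x => local_form w c x s)) => t ht.
  exact: (lsmooth_cdiff s (lsmooth_local_form sw hc) (seg t ht)).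
exact: (congr1 (fun b => b s) (fder_vertical (seg t ht) v0)).
Qed.

End Basic.
End Submersion.

(** A level set in [A] is relatively open and relatively closed. The target carries no topology, as
    it will be a space of alternating forms. *)
Lemma connected_locally_constant (T : topologicalType) (Y : Type) (A : set T) (g : T -> Y) :
  connected A -> (forall p, A p -> \forall q \near p, A q -> g q = g p) ->
  forall p q, A p -> A q -> g p = g q.
Proof.
move=> cA lc p q Ap Aq.
pose B := [set x | A x /\ g x = g p].
suff E : A = B by move: Aq; rewrite E => -[_ ->].
apply/esym; apply: cA; first by exists p.
- exists ([set x | A x -> g x = g p]°); first exact: open_interior.
  apply/seteqP; split=> x [Ax h]; split=> //.
    by rewrite /interior /=; apply: filterS (lc x Ax) => y h' /h' ->.
  by have := nbhs_singleton h; exact.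
- exists (~` [set x | A x -> g x <> g p]°).
    by apply: open_closedC; exact: open_interior.
  apply/seteqP; split=> x [Ax h]; split=> //.
    by move=> h'; have := nbhs_singleton h'; move=> /(_ Ax).
  apply: contrapT => ne; apply: h; rewrite /interior /=.
  by apply: filterS (lc x Ax) => y h' /h' ->.
Qed.

Section Horizontal.
Variables (R : realType).
Notation C := R[i].

Lemma interior0 m (b : seq 'rV[R]_m -> C) : alternating b -> interior 0 b = 0.
Proof.
move=> hb; have := interior_linear 1 0 0 hb; rewrite scaler0 addr0 scale1r.
have alg (V : zmodType) (x : V) : x = x + x -> x = 0.
  by move=> /eqP; rewrite -subr_eq0 opprD addrA subrr sub0r oppr_eq0 => /eqP.
exact: alg.
Qed.

(** The map [A *m S] differs from the identity by vectors in the kernel of [A], which such a form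
    does not see, in any argument. *)
Lemma horizontal_pull n k (A : 'M[R]_(n, k)) (S : 'M[R]_(k, n)) (b : seq 'rV[R]_n -> C) :
  S *m A = 1%:M -> alternating b -> (forall v, v *m A = 0 -> interior v b = 0) ->
  pull_alt A (pull_alt S b) = b.
Proof.
move=> SA hb hor; rewrite pull_pull; apply/funext => s; rewrite /pull_alt.
elim: s b hb hor => [//|v s IH] b hb hor /=.
have e : interior (v *m (A *m S)) b = interior v b.
  have hv : interior (v *m (A *m S) - v) b = 0.
    by apply: hor; rewrite mulmxBl -!mulmxA SA mulmx1 subrr.
  have := interior_linear 1 (v *m (A *m S) - v) v hb.
  by rewrite scale1r subrK hv scaler0 add0r.
apply: etrans (congr1 (fun b => b _) e) _.
apply: IH => [|u hu]; first exact: alternating_interior.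
by rewrite interior_anti // hor //; apply/funext => t; rewrite altNE /interior oppr0.
Qed.

End Horizontal.

Lemma smooth_form_cover (R : realType) m (M : manifold R m) (O : set M)
    (w : M -> seq 'rV[R]_m -> R[i]) : open O ->
  (forall p, O p -> exists W, [/\ open W, W p & smooth_form W w]) -> smooth_form O w.
Proof.
move=> oO h; apply: smooth_form_local => // p Op; have [W [oW Wp sW]] := h p Op.
  exact: sW.1.
have hc := chart_at_atlas p.
exists (chart_at p), W; split=> //; first exact: chart_at_dom.
exact: lsmooth_local_form.
Qed.

(** * Basic forms and invariant forms on the transversals *)

Section Foliation.
Variables (R : realType) (m l : nat) (M : manifold R (m + l)) (F : foliation M).
Notation C := R[i].
Notation f := (@fol_f R m l M F).
Notation V := (@fol_V R m l M F).
Notation form := (M -> seq 'rV[R]_(m + l) -> C).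
Notation family := (fol_I F -> fol_T0 F -> seq 'rV[R]_m -> C).
Implicit Types (i j : fol_I F) (w : family) (b : form) (p : M).

Let oV i : open (V i) := fol_open i.
Let sub i : submersion_on (V i) (f i). Proof. exact: fol_submersion. Qed.
Arguments sub : clear implicits.
Let sf i : smooth_map (V i) (f i) := smooth_submersion (oV i) (sub i).

Lemma transversal_open i : open (transversal i).
Proof. exact: (open_submersion_image (sub i) (oV i)). Qed.

Lemma mem_transversal i p : V i p -> transversal i (f i p).
Proof. by move=> Vp; exists p. Qed.

Lemma holonomy_diffeo i j p : V i p -> V j p ->
  local_diffeo (f i @` (V i `&` V j)) (fol_gamma i j).
Proof. by move=> Vi Vj; apply: fol_gamma_diffeo; exists p. Qed.

Lemma tangent_gamma i j p : V i p -> V j p ->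
  tangent_map (f j) p = tangent_map (f i) p *m tangent_map (fol_gamma i j) (f i p).
Proof.
move=> Vi Vj; have [_ _ sg _] := holonomy_diffeo Vi Vj.
have oIJ : open (V i `&` V j) by apply: openI.
have si : smooth_map (V i `&` V j) (f i) := smooth_map_subset (@subIsetl _ _ _) (sf i).
have sj : smooth_map (V i `&` V j) (f j) := smooth_map_subset (@subIsetr _ _ _) (sf j).
have H := tangent_map_comp oIJ si sg (conj Vi Vj) (ex_intro2 _ _ p (conj Vi Vj) erefl).
apply: etrans _ H; apply: (tangent_map_eq oIJ sj (conj Vi Vj)) => q [Vi' Vj'].
exact: fol_gammaE.
Qed.

Lemma tangent_gamma_unit i j p : V i p -> V j p ->
  tangent_map (fol_gamma i j) (f i p) \in unitmx.
Proof.
move=> Vi Vj; have [S] := tangent_section (oV j) (sub j) Vj.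
by rewrite (tangent_gamma Vi Vj) mulmxA => /mulmx1_unit[].
Qed.

(** Invariance expressed on M: the pull-backs agree on overlaps. It is equivalent to holonomy
    invariance but involves no induction over the pseudogroup, and so is easier to preserve under
    constructions. *)
Definition consistent w : Prop :=
  (forall i, smooth_form (transversal i) (w i)) /\
  forall i j p, V i p -> V j p -> mpull (f i) (w i) p = mpull (f j) (w j) p.

Section Consistent.
Variable w : family.
Hypothesis hw : consistent w.

Lemma to_basicE i p : V i p -> to_basic w p = mpull (f i) (w i) p.
Proof. by move=> Vp; apply: hw.2 Vp; case: cid. Qed.

Lemma smooth_mpull_fol i : smooth_form (V i) (mpull (f i) (w i)).
Proof. exact: (smooth_mpull (oV i) (sf i) (@mem_transversal i) (hw.1 i)). Qed.

Lemma ext_d_mpull_fol i p : V i p -> ext_d (mpull (f i) (w i)) p = mpull (f i) (ext_d (w i)) p.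
Proof.
exact: (ext_d_mpull (oV i) (transversal_open i) (sf i) (@mem_transversal i) (hw.1 i)).
Qed.

Lemma smooth_to_basic : smooth_form [set: M] (to_basic w).
Proof.
apply: smooth_form_cover => [|p _]; first exact: openT.
have [i Vp] := fol_cover F p; exists (V i); split; [exact: oV|exact: Vp|].
by apply: (smooth_form_eq (oV i) _ (smooth_mpull_fol i)) => q Vq; exact: (esym (to_basicE Vq)).
Qed.

Lemma ext_d_to_basicE i p : V i p -> ext_d (to_basic w) p = mpull (f i) (ext_d (w i)) p.
Proof.
move=> Vp; apply: etrans _ (ext_d_mpull_fol Vp).
by apply: (ext_d_form_eq (oV i) Vp) => q; exact: to_basicE.
Qed.

Lemma consistent_ext_d : consistent (fun i => ext_d (w i)).
Proof.
split=> [i|i j p Vi Vj]; first exact: (smooth_ext_d (transversal_open i) (hw.1 i)).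
exact: etrans (esym (ext_d_to_basicE Vi)) (ext_d_to_basicE Vj).
Qed.

Lemma ext_d_to_basic : ext_d (to_basic w) = to_basic (F := F) (fun i => ext_d (w i)).
Proof.
apply/funext => p; have [i Vp] := fol_cover F p; apply: etrans (ext_d_to_basicE Vp) _.
by rewrite /to_basic; apply: consistent_ext_d.2 Vp _; case: cid.
Qed.

Lemma basic_to_basic : basic F (to_basic w).
Proof.
split=> [|W X _ _ hX p s Wp]; first exact: smooth_to_basic.
have [i Vp] := fol_cover F p; have Ty := mem_transversal Vp.
rewrite (to_basicE Vp) (ext_d_to_basicE Vp) /mpull /pull_alt /= (hX p i Wp Vp).
set t := [seq _ | _ <- _].
split; first exact: (congr1 (fun a => a t) (interior0 ((hw.1 i).1 _ Ty))).
have sd := smooth_ext_d (transversal_open i) (hw.1 i).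
exact: (congr1 (fun a => a t) (interior0 (sd.1 _ Ty))).
Qed.

End Consistent.

Lemma to_basic_inj w w' : consistent w -> consistent w' -> to_basic w = to_basic w' ->
  forall i y, transversal i y -> w i y = w' i y.
Proof.
move=> hw hw' e i _ [p Vp <-]; apply: (pull_tangent_inj (oV i) (sub i) Vp).
have := congr1 (fun b => b p) e.
by rewrite (to_basicE hw Vp) (to_basicE hw' Vp).
Qed.

Lemma to_basic_eq w w' : (forall i y, transversal i y -> w i y = w' i y) ->
  to_basic w = to_basic w'.
Proof.
move=> e; apply/funext => p; rewrite /to_basic e //; case: cid => i /= Vp.
exact: mem_transversal.
Qed.

Lemma consistent_gamma w i j p : consistent w -> V i p -> V j p ->
  pull_alt (tangent_map (fol_gamma i j) (f i p)) (w j (fol_gamma i j (f i p))) = w i (f i p).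
Proof.
move=> hw Vi Vj; apply: (pull_tangent_inj (oV i) (sub i) Vi).
rewrite pull_pull -(tangent_gamma Vi Vj) -(fol_gammaE Vi Vj).
exact/esym/(hw.2 i j).
Qed.

Lemma invariant_consistent w : invariant_form w -> consistent w.
Proof.
move=> [h1 h2]; split; first exact: h1.
move=> i j p Vi Vj.
have ne : V i `&` V j !=set0 by exists p.
have E := h2 _ _ _ _ (hol_gen ne) (f i p) (ex_intro2 _ _ p (conj Vi Vj) erefl).
apply: etrans (congr1 (pull_alt (tangent_map (f i) p)) (esym E)) _.
apply: etrans (pull_pull _ _ _) _; rewrite -(tangent_gamma Vi Vj).
exact: (congr1 (fun y => pull_alt (tangent_map (f j) p) (w j y)) (esym (fol_gammaE Vi Vj))).
Qed.

(** Invariance spreads from the generators by induction on the generation of the pseudogroup. The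
    chain rule for composites and inverses needs smoothness, so the induction also carries openness,
    the position of domain and image, and a local diffeomorphism around each point; this last clause
    is local so as to survive gluing. *)
Lemma holonomy_consistent w i j (O : set (fol_T0 F)) h : consistent w -> holonomy i j O h ->
  [/\ open O, O `<=` transversal i, forall y, O y -> transversal j (h y),
      forall y, O y -> exists A, [/\ A `<=` O, A y & local_diffeo A h] &
      forall y, O y -> pull_alt (tangent_map h y) (w j (h y)) = w i y].
Proof.
move=> hw; elim=> {i j O h}.
- move=> i j [p [Vi Vj]]; have lg := holonomy_diffeo Vi Vj; have [og _ _ _] := lg.
  split=> //.
  + by move=> _ [q [Vq _] <-]; exact: mem_transversal.
  + move=> _ [q [Vi' Vj'] <-]; rewrite -(fol_gammaE Vi' Vj'); exact: mem_transversal.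
  + by move=> y hy; exists (f i @` (V i `&` V j)); split.
  + by move=> _ [q [Vi' Vj'] <-]; exact: consistent_gamma.
- move=> i; split=> //; first exact: transversal_open.
  + move=> y hy; exists (transversal i); split=> //.
    exact/local_diffeo_id/transversal_open.
  + by move=> y _; rewrite tangent_map_id pull_1.
- move=> i j k O O' h h' _ [oO Oi Oj dO eO] _ [oO' O'j O'k dO' eO'].
  have ch y : O y -> {for y, continuous h}.
    by move=> /dO[A [_ Ay [_ _ sA _]]]; exact: sA.1.
  split.
  + exact: open_preimage_in.
  + by move=> y [/Oi].
  + by move=> y [_ /O'k].
  + move=> y [/dO[A [AO Ay lA]] /dO'[A' [AO' Ay' lA']]].
    exists (A `&` h @^-1` A'); split=> //; last exact: local_diffeo_comp.
    by move=> z [/AO ? /AO'].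
  + move=> y [Oy Oy']; have [A [AO Ay [oA _ sA _]]] := dO y Oy.
    have [A' [AO' Ay' [_ _ sA' _]]] := dO' _ Oy'.
    apply: etrans (congr1 (fun B => pull_alt B (w k (h' (h y))))
      (tangent_map_comp oA sA sA' Ay Ay')) _.
    apply: etrans (esym (pull_pull _ _ _)) _.
    apply: etrans (congr1 (pull_alt (tangent_map h y)) (eO' _ Oy')) _.
    exact: eO.
- move=> i j O h h' _ [oO Oi Oj dO eO] h'h.
  split.
  + apply: open_setP => _ [y Oy <-]; have [A [AO Ay [_ oI _ _]]] := dO y Oy.
    have hy : (h @` A) (h y) by exists y.
    by apply: filterS (open_nbhs_nbhs (conj oI hy)); exact: image_subset.
  + by move=> _ [y Oy <-]; exact: Oj.
  + by move=> _ [y Oy <-]; rewrite h'h //; exact: Oi.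
  + move=> _ [y Oy <-]; have [A [AO Ay lA]] := dO y Oy.
    exists (h @` A); split; [exact: image_subset|by exists y|].
    by apply: local_diffeo_inv lA _ => z /AO; exact: h'h.
  + move=> _ [y Oy <-]; have [A [AO Ay lA]] := dO y Oy.
    have E := tangent_map_inv lA (fun z Az => h'h z (AO z Az)) Ay.
    apply: etrans (congr1 (fun z => pull_alt (tangent_map h' (h y)) (w i z)) (h'h y Oy)) _.
    apply: etrans (congr1 (pull_alt (tangent_map h' (h y))) (esym (eO y Oy))) _.
    by apply: etrans (pull_pull _ _ _) _; rewrite (mulmx1C E) pull_1.
- move=> i j O h O_ h_ oO _ _ IH Oy_ eh.
  split=> //.
  + by move=> y Oy; have [_ s _ _ _] := IH y Oy; exact/s/Oy_.
  + move=> y Oy; have [_ _ t _ _] := IH y Oy; rewrite (eh y y) //; last exact: Oy_.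
    exact/t/Oy_.
  + move=> y Oy; have [_ _ _ d _] := IH y Oy; have [A [AO Ay lA]] := d y (Oy_ y Oy).
    have [oA _ _ _] := lA.
    exists (A `&` O); split=> //.
    apply: (local_diffeo_eq (g := h_ y)) => [z [/AO Az Oz]|]; first by rewrite (eh y z).
    by apply: local_diffeo_subset lA => //; exact: openI.
  + move=> y Oy; have [_ _ _ d e] := IH y Oy; have [A [AO Ay [oA _ sA _]]] := d y (Oy_ y Oy).
    have oAO : open (A `&` O) by exact: openI.
    have E : tangent_map (h_ y) y = tangent_map h y.
      apply: (tangent_map_eq oAO (smooth_map_subset (@subIsetl _ _ _) sA) (conj Ay Oy)).
      by move=> z [/AO Az Oz]; rewrite (eh y z).
    apply: etrans (congr1 (fun B => pull_alt B (w j (h y))) (esym E)) _.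
    apply: etrans (congr1 (fun z => pull_alt (tangent_map (h_ y) y) (w j z))
      (eh y y Oy Oy (Oy_ y Oy))) _.
    exact/e/Oy_.
Qed.

Lemma consistent_invariant w : consistent w -> invariant_form w.
Proof.
move=> hw; split=> [|i j O h hh]; first exact: hw.1.
by have [_ _ _ _] := holonomy_consistent hw hh.
Qed.

Section Basic.
Variable b : form.
Hypothesis hb : basic F b.

(** [basic] only tests vector fields. A vertical vector is extended with constant coordinates in an
    adapted chart; the extension is killed by the differential of [f i], and of the other
    submersions through the maps gamma. *)
Lemma basic_vertical i p v s : V i p -> v *m tangent_map (f i) p = 0 ->
  b p (v :: s) = 0 /\ ext_d b p (v :: s) = 0.
Proof.
move=> Vp v0; have [c [c' [A cp]]] := adapted_at (sub i) Vp; have [hc hc' cV H] := A.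
pose u := v *m invmx (to_pref c p).
have uv : u *m to_pref c p = v by rewrite mulmxKV // to_pref_unit.
have u0 : lsubmx u = 0 by apply/(vertical_coord (oV i) (sub i) u A cp); rewrite uv.
pose X q := u *m to_pref c q.
have sX : smooth_vfield (dom c) X.
  move=> d hd; have oD := open_chart_img hd (open_dom hc).
  move=> k; apply: (Cn_eq (f := fun x => u *m trans_jac c d (point d x)) oD).
    move=> x /(chart_imgP hd)[dx cx _]; rewrite /X (to_pref_trans hc hd cx dx).
    by rewrite mulmxA mulmxK // to_pref_unit.
  apply: (Cn_mulmx oD); first exact: Cn_cst.
  exact: smooth_trans_jac.
have tX : tangent_to_leaves F (dom c) X.
  move=> q j cq Vq; rewrite (tangent_gamma (cV q cq) Vq) mulmxA.
  by rewrite (vertical_coord (oV i) (sub i) u A cq).2 // mul0mx.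
have := hb.2 (dom c) X (open_dom hc) sX tX p s cp.
by rewrite /X uv.
Qed.

Lemma basic_descends i p : V i p ->
  exists2 a, alternating a & b p = pull_alt (tangent_map (f i) p) a.
Proof.
move=> Vp; have [S SA] := tangent_section (oV i) (sub i) Vp.
have ab : alternating (b p) by apply: hb.1.1.
exists (pull_alt S (b p)); first exact: alternating_pull.
rewrite horizontal_pull // => v hv; apply/funext => s.
exact: (basic_vertical s Vp hv).1.
Qed.

(** The transverse form through which [b] factors at a point is unique, hence defines a function
    along the fibre; it is locally constant, and fibres are connected. *)
Lemma basic_fibre_constant i p q a : V i p -> V i q -> f i p = f i q ->
  b p = pull_alt (tangent_map (f i) p) a -> b q = pull_alt (tangent_map (f i) q) a.
Proof.
move=> Vp Vq pq.
pose g q := if pselect (exists a, b q = pull_alt (tangent_map (f i) q) a) is left ex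
  then projT1 (cid ex) else a.
have gE r : V i r -> b r = pull_alt (tangent_map (f i) r) (g r).
  move=> Vr; rewrite /g; case: pselect => [ex|[]]; first by case: cid.
  by have [a' _ ea] := basic_descends Vr; exists a'.
have fib : connected (V i `&` f i @^-1` [set f i q]) := @fol_fibres _ _ _ _ F i (f i q).
have gc : g p = g q.
  apply: (connected_locally_constant fib) => // r [Vr fr].
  have [c [c' [A cr]]] := adapted_at (sub i) Vr; have [hc hc' cV H] := A.
  have hv t v s : dom c t -> v *m tangent_map (f i) t = 0 ->
      b t (v :: s) = 0 /\ ext_d b t (v :: s) = 0.
    by move=> ct; exact: basic_vertical (cV t ct).
  apply: filterS (vertical_constant (oV i) (sub i) hb.1 A hv cr) => t [ct lt] [Vt ft].
  have ftr : f i t = f i r by rewrite ft fr.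
  (* Along one fibre in this chart the matrix is the same at all points and has a left inverse, so
     equal chart expressions of [b] give equal transverse forms. *)
  have E s : dom c s -> local_form b c (coord c s) =
      pull_alt (first_proj R m l *m to_pref c' (f i s)) (g s).
    move=> cs; rewrite (local_formE b hc cs) (gE s (cV s cs)) pull_pull.
    by rewrite (adapted_tangent (oV i) (sub i) A cs).
  have := lt ftr; rewrite (E t ct) (E r cr) ftr.
  apply: (pull_left_inv_inj (S := invmx (to_pref c' (f i r)) *m first_incl R m l)).
  rewrite mulmxA -(mulmxA _ (first_incl R m l)) first_inclK mulmx1.
  exact: mulVmx (to_pref_unit hc' (H r cr).1).
move=> ep; apply: etrans (gE q Vq) _.
have e : g p = a by apply: (pull_tangent_inj (oV i) (sub i) Vp); exact: etrans (esym (gE p Vp)) ep.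
exact: (congr1 (pull_alt (tangent_map (f i) q)) (etrans (esym gc) e)).
Qed.

Definition descent : family := fun i y =>
  if pselect (exists2 a, alternating a &
    forall p, V i p -> f i p = y -> b p = pull_alt (tangent_map (f i) p) a) is left ex
  then projT1 (cid2 ex) else 0.

Lemma descentP i p : V i p -> alternating (descent i (f i p)) /\
  b p = mpull (f i) (descent i) p.
Proof.
move=> Vp; rewrite /mpull /descent; case: pselect => [ex|[]].
  by case: cid2 => a /= ha e; split=> //; exact: e.
have [a ha ea] := basic_descends Vp; exists a; first exact: ha.
by move=> q Vq e; exact: (basic_fibre_constant Vp Vq (esym e) ea).
Qed.

(** In adapted charts the descended form is [b] restricted to the slice through [p] on which the
    last coordinates are frozen. *)
Lemma smooth_descent i : smooth_form (transversal i) (descent i).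
Proof.
apply: smooth_form_local; first exact: transversal_open.
  by move=> _ [p Vp <-]; exact: (descentP Vp).1.
move=> _ [p Vp <-]; have [c [c' [A cp]]] := adapted_at (sub i) Vp; have [hc hc' cV H] := A.
set r := rsubmx (coord c p).
pose inc (z : 'rV[R]_m) : 'rV[R]_(m + l) := row_mx z r.
have oI : open (chart_img c [set: M]) by apply: open_chart_img => //; exact: openT.
have oZ : open (inc @^-1` chart_img c [set: M]).
  by apply: open_comp oI => z _; exact: continuous_row_mx.
pose W := dom c' `&` coord c' @^-1` (inc @^-1` chart_img c [set: M]).
have oW : open W.
  apply: open_preimage_in oZ; first exact: open_dom.
  by have [_ _ _ cc _] := atlas_topological hc'.
have [c'p e] := H p cp.
exists c', W; split; [exact: hc'|exact: c'p|exact: oW| |].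
  by split; first exact: c'p; rewrite /preimage /= e /inc /r hsubmxK; exists p.
have oIW := open_chart_img hc' oW.
have ZI z : chart_img c' W z -> chart_img c [set: M] (inc z) by move=> [y [_ [_ hy]] <-].
have E z : chart_img c' W z ->
    local_form (descent i) c' z = pull_alt (first_incl R m l) (local_form b c (inc z)).
  move=> hz; have [q [cq _] iq] := ZI z hz.
  have zq : coord c' (f i q) = z by rewrite (H q cq).2 iq /inc row_mxKl.
  rewrite -iq -zq; apply: etrans (local_formE (descent i) hc' (H q cq).1) _.
  apply: etrans _ (congr1 (pull_alt _) (esym (local_formE b hc cq))).
  apply: etrans _ (congr1 (fun a => pull_alt _ (pull_alt _ a)) (esym (descentP (cV q cq)).2)).
  apply: etrans _ (esym (pull_pull _ _ _)); apply: etrans _ (esym (pull_pull _ _ _)).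
  have e1 : first_incl R m l *m to_pref c q *m tangent_map (f i) q = to_pref c' (f i q).
    by rewrite -mulmxA -(adapted_tangent (oV i) (sub i) A cq) mulmxA first_inclK mul1mx.
  exact: (congr1 (fun B => pull_alt B (descent i (f i q))) (esym e1)).
split=> [z hz|s].
  rewrite (E z hz); apply: alternating_pull.
  exact: (lsmooth_local_form hb.1 hc).1 (ZI z hz).
have S := csmooth_comp oIW ZI (smooth_row_mx r oIW)
  ((lsmooth_local_form hb.1 hc).2 [seq v *m first_incl R m l | v <- s]).
apply: csmooth_eq oIW _ S => z hz.
exact: (congr1 (fun a => a s) (esym (E z hz))).
Qed.

Lemma consistent_descent : consistent descent.
Proof.
split=> [i|i j p Vi Vj]; first exact: smooth_descent.
exact: etrans (esym (descentP Vi).2) (descentP Vj).2.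
Qed.

Lemma to_basic_descent : to_basic descent = b.
Proof.
apply/funext => p; have [i Vp] := fol_cover F p.
exact: etrans (to_basicE consistent_descent Vp) (esym (descentP Vp).2).
Qed.

(** The descent proves that the choice in [of_basic] is made from a nonempty set. *)
Lemma of_basicP : consistent (of_basic (F := F) b) /\ to_basic (of_basic (F := F) b) = b.
Proof.
rewrite /of_basic; case: pselect => [ex|[]].
  case: cid => w /= [hw e]; split; last exact: e.
  exact: invariant_consistent.
exists descent; split; last exact: to_basic_descent.
exact: (consistent_invariant consistent_descent).
Qed.

End Basic.
End Foliation.

(** * The ddJ-lemma for a graded differential *)

Section QuasiIso.
Variables (V : zmodType) (d : V -> V) (A B : set V).
Hypothesis AB : A `<=` B.
Hypotheses (A0 : A 0) (AD : forall x y, A x -> A y -> A (x + y)) (AN : forall x, A x -> A (- x)).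
Hypotheses (B0 : B 0) (BD : forall x y, B x -> B y -> B (x + y)) (BN : forall x, B x -> B (- x)).
Hypothesis dD : forall x y, B x -> B y -> d (x + y) = d x + d y.

Let d0 : d 0 = 0.
Proof. by have := dD B0 B0; rewrite addr0 => /eqP; rewrite -subr_eq0 opprD addNKr oppr_eq0 => /eqP. Qed.

Let dN x : B x -> d (- x) = - d x.
Proof. by move=> Bx; apply/eqP; rewrite -addr_eq0 -dD ?addNr ?d0 //; exact: BN. Qed.

Lemma mem_class (D : set V) a x : add_exact d D [set a] x <-> exists2 e, D e & x = a + d e.
Proof.
split=> [[c -> [e De <-]]|[e De ->]]; first by exists e.
by exists a => //; exists e.
Qed.

Lemma class_eq (D : set V) a b : (forall x, D x -> B x) -> (forall x y, D x -> D y -> D (x + y)) ->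
  (forall x, D x -> D (- x)) -> (exists2 e, D e & a = b + d e) ->
  add_exact d D [set a] = add_exact d D [set b].
Proof.
move=> DB DD DN [e De ->]; apply/seteqP; split=> x /mem_class[e' De' ->]; apply/mem_class.
  by exists (e + e'); [exact: DD|rewrite dD ?addrA //; exact: DB].
exists (- e + e'); first by apply: DD => //; exact: DN.
rewrite dD; [|by apply/BN/DB|exact: DB].
by rewrite dN ?addrA ?addrK //; exact: DB.
Qed.

Lemma class_inv (D : set V) a b : D 0 -> add_exact d D [set a] = add_exact d D [set b] ->
  exists2 e, D e & a = b + d e.
Proof.
move=> D0 E; apply/mem_class; rewrite -E; apply/mem_class.
by exists 0 => //; rewrite d0 addr0.
Qed.

Lemma add_exact_class a : add_exact d B (add_exact d A [set a]) = add_exact d B [set a].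
Proof.
apply/seteqP; split=> [_ [c /mem_class[e Ae ->] [e' Be' <-]]|x /mem_class[e Be ->]].
  apply/mem_class; exists (e + e'); first by apply: BD => //; exact: AB.
  by rewrite dD ?addrA //; exact: AB.
exists a; last by exists e.
by apply/mem_class; exists 0 => //; rewrite d0 addr0.
Qed.

Lemma quasi_isoP : inclusion_quasi_iso d A B <->
  (forall b, A (d b) -> B b -> d (d b) = 0 -> exists2 c, A c & d b = d c) /\
  (forall a, B a -> d a = 0 -> exists a' e, [/\ A a', B e, d a' = 0 & a = a' + d e]).
Proof.
split=> [[hf hi hs]|[inj surj]].
  split=> [b Ab Bb ddb|a Ba da].
    have c1 : cohomology d A (add_exact d A [set d b]) by exists (d b).
    have c2 : cohomology d A (add_exact d A [set 0]) by exists 0.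
    have e : add_exact d B (add_exact d A [set d b]) = add_exact d B (add_exact d A [set 0]).
      by rewrite !add_exact_class; apply: class_eq => //; exists b => //; rewrite add0r.
    have := hi _ _ (mem_set c1) (mem_set c2) e.
    move=> /(class_inv A0)[c Ac ->]; rewrite add0r.
    by exists c => //; rewrite add0r.
  have [|_ [a' [Aa' da'] <-] e] := hs (add_exact d B [set a]); first by exists a.
  move: e; rewrite add_exact_class => /esym/(class_inv B0)[e Be ->].
  by exists a', e.
split.
- move=> _ [a [Aa da] <-]; rewrite add_exact_class; exists a => //; split=> //; exact: AB.
- move=> x y /set_mem[a [Aa da] <-] /set_mem[b [Ab db] <-].
  rewrite !add_exact_class => /(class_inv B0)[e Be ab].
  have de : d e = a - b by rewrite ab addrC addKr.
  have Ade : A (d e) by rewrite de; apply: AD => //; exact: AN.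
  have dde : d (d e) = 0.
    by rewrite de dD ?dN ?da ?db ?subr0 //; [exact: AB|exact: AB|exact/BN/AB].
  have [c Ac ec] := inj e Ade Be dde.
  by apply: class_eq => //; exists c => //; rewrite -ec.
- move=> _ [a [Ba da] <-]; have [a' [e [Aa' Be da' ->]]] := surj a Ba da.
  exists (add_exact d A [set a']); first by exists a'.
  by rewrite add_exact_class; apply/esym/class_eq => //; exists e.
Qed.

End QuasiIso.

(** * Differentials that change a finite grading by one *)

Section Graded.
Variables (R : realType) (V : lmodType R[i]) (B : set V) (d : V -> V) (n : nat) (P : nat -> V -> V).
Notation C := R[i].
Hypothesis B0 : B 0.
Hypothesis B_lin : forall (a : C) x y, B x -> B y -> B (a *: x + y).
Hypothesis dB : forall x, B x -> B (d x).
Hypothesis d_lin : forall (a : C) x y, B x -> B y -> d (a *: x + y) = a *: d x + d y.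
Hypothesis dd : forall x, B x -> d (d x) = 0.
Hypothesis PB : forall k x, (k <= n)%N -> B x -> B (P k x).
Hypothesis P_lin : forall k (a : C) x y, (k <= n)%N -> B x -> B y ->
  P k (a *: x + y) = a *: P k x + P k y.
Hypothesis PP : forall j k x, (j <= n)%N -> (k <= n)%N -> B x ->
  P j (P k x) = if k == j then P k x else 0.
Hypothesis Psum : forall x, B x -> x = \sum_(k < n.+1) P k x.
Hypothesis Pd : forall j k x, (j <= n)%N -> (k <= n)%N -> j != k.+1 -> k != j.+1 -> B x ->
  P j (d (P k x)) = 0.

Lemma B_D x y : B x -> B y -> B (x + y).
Proof. by move=> Bx By; have := B_lin 1 Bx By; rewrite scale1r. Qed.

Lemma B_Z (a : C) x : B x -> B (a *: x).
Proof. by move=> Bx; have := B_lin a Bx B0; rewrite addr0. Qed.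

Lemma B_N x : B x -> B (- x).
Proof. by rewrite -scaleN1r; exact: B_Z. Qed.

Lemma B_sum (I : Type) (r : seq I) (f : I -> V) : (forall i, B (f i)) -> B (\sum_(i <- r) f i).
Proof. by move=> h; elim/big_rec: _ => // i x _; exact: B_D. Qed.

(** Basic forms are a subset of all functions rather than a type of their own, so operators are
    linear only on that subset. *)
Definition lin_on (g : V -> V) : Prop :=
  (forall x, B x -> B (g x)) /\ (forall (a : C) x y, B x -> B y -> g (a *: x + y) = a *: g x + g y).

Section Lin.
Variable g : V -> V.
Hypothesis hg : lin_on g.

Lemma lin_onD x y : B x -> B y -> g (x + y) = g x + g y.
Proof. by move=> Bx By; have := hg.2 1 x y Bx By; rewrite !scale1r. Qed.

Lemma lin_on0 : g 0 = 0.
Proof.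
by have := lin_onD B0 B0; rewrite addr0 => /eqP; rewrite -subr_eq0 opprD addNKr oppr_eq0 => /eqP.
Qed.

Lemma lin_onZ (a : C) x : B x -> g (a *: x) = a *: g x.
Proof. by move=> Bx; have := hg.2 a x 0 Bx B0; rewrite !addr0 lin_on0 addr0. Qed.

Lemma lin_onN x : B x -> g (- x) = - g x.
Proof. by move=> Bx; rewrite -scaleN1r lin_onZ // scaleN1r. Qed.

Lemma lin_on_sum (I : Type) (r : seq I) (f : I -> V) : (forall i, B (f i)) ->
  g (\sum_(i <- r) f i) = \sum_(i <- r) g (f i).
Proof.
move=> h; elim: r => [|i r IH]; first by rewrite !big_nil lin_on0.
by rewrite !big_cons lin_onD ?IH //; exact: B_sum.
Qed.

End Lin.

Lemma lin_on_comp g h : lin_on g -> lin_on h -> lin_on (g \o h).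
Proof.
move=> [g1 g2] [h1 h2]; split=> [x Bx|a x y Bx By] /=; first exact/g1/h1.
by rewrite h2 // g2 //; exact: h1.
Qed.

Lemma lin_on_bigsum (I : Type) (r : seq I) (g : I -> V -> V) : (forall i, lin_on (g i)) ->
  lin_on (fun x => \sum_(i <- r) g i x).
Proof.
move=> h; split=> [x Bx|a x y Bx By]; first by apply: B_sum => i; exact: (h i).1.
rewrite scaler_sumr -big_split; apply: eq_bigr => i _; exact: (h i).2.
Qed.

Lemma lin_onZf (z : C) g : lin_on g -> lin_on (fun x => z *: g x).
Proof.
move=> [h1 h2]; split=> [x Bx|a x y Bx By]; first exact/B_Z/h1.
by rewrite h2 // scalerDr !scalerA mulrC.
Qed.

Lemma lin_d : lin_on d. Proof. by split. Qed.

Lemma lin_P k : (k <= n)%N -> lin_on (P k).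
Proof. by move=> kn; split=> [x|a x y]; [exact: PB|exact: P_lin]. Qed.

(** The component delbar, since index [k] stands for U^{q-k}; [lower] is del. *)
Definition raise x := \sum_(k < n) P k.+1 (d (P k x)).
Definition lower x := \sum_(k < n) P k (d (P k.+1 x)).
Definition twist (z : C) x := \sum_(k < n.+1) z ^+ k *: P k x.

Let ord_le (k : 'I_n.+1) : (k <= n)%N. Proof. by rewrite -ltnS. Qed.
Let ord_lt (k : 'I_n) : (k <= n)%N. Proof. exact: ltnW. Qed.

Lemma lin_raise : lin_on raise.
Proof.
apply: lin_on_bigsum => k; apply: (lin_on_comp (lin_P (ltn_ord k))).
exact: (lin_on_comp lin_d (lin_P (ord_lt k))).
Qed.

Lemma lin_lower : lin_on lower.
Proof.
apply: lin_on_bigsum => k; apply: (lin_on_comp (lin_P (ord_lt k))).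
exact: (lin_on_comp lin_d (lin_P (ltn_ord k))).
Qed.

Lemma lin_twist z : lin_on (twist z).
Proof. by apply: lin_on_bigsum => k; apply: lin_onZf; exact: lin_P. Qed.

Lemma twist_P z j x : (j <= n)%N -> B x -> twist z (P j x) = z ^+ j *: P j x.
Proof.
move=> jn Bx; rewrite /twist (bigD1 (Ordinal (jn : (j < n.+1)%N))) //= PP // eqxx.
rewrite big1 ?addr0 // => k kj; rewrite PP //; case: eqP => [e|]; last by rewrite scaler0.
by case/eqP: kj; exact/val_inj.
Qed.

Lemma P_twist z j x : (j <= n)%N -> B x -> P j (twist z x) = z ^+ j *: P j x.
Proof.
move=> jn Bx; rewrite /twist (lin_on_sum (lin_P jn)); last by move=> k; apply/B_Z/PB.
rewrite (bigD1 (Ordinal (jn : (j < n.+1)%N))) //= (lin_onZ (lin_P jn)); last exact: PB.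
rewrite PP // eqxx big1 ?addr0 // => k kj.
rewrite (lin_onZ (lin_P jn)) ?PP //; last exact: PB.
case: eqP => [e|]; last by rewrite scaler0.
by case/eqP: kj; exact/val_inj.
Qed.

Lemma sum_adjacent (G : nat -> nat -> V) :
  (forall j k, (j <= n)%N -> (k <= n)%N -> j != k.+1 -> k != j.+1 -> G j k = 0) ->
  \sum_(j < n.+1) \sum_(k < n.+1) G j k = \sum_(k < n) G k.+1 k + \sum_(k < n) G k k.+1.
Proof.
move=> G0.
have E (j k : 'I_n.+1) : G j k = (if j == k.+1 :> nat then G j k else 0) +
    (if k == j.+1 :> nat then G j k else 0).
  case: eqP => [e|/eqP h1]; case: eqP => [e'|/eqP h2]; rewrite ?addr0 ?add0r //.
    have h1 : (k < j)%N by rewrite e.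
    have h2 : (j < k)%N by rewrite e'.
    by move: (ltn_trans h1 h2); rewrite ltnn.
  exact: G0.
have S (H : nat -> V) (a : nat) : \sum_(j < n.+1) (if j == a :> nat then H j else 0) =
    if (a < n.+1)%N then H a else 0.
  case: ltnP => an; last first.
    by rewrite big1 // => j _; case: eqP => // e; move: (ltn_ord j); rewrite e ltnNge an.
  rewrite (bigD1 (Ordinal an)) //= eqxx big1 ?addr0 // => j ja; case: eqP => // e.
  by case/eqP: ja; exact/val_inj.
rewrite (eq_bigr (fun j : 'I_n.+1 => \sum_(k < n.+1) (if j == k.+1 :> nat then G j k else 0) +
  \sum_(k < n.+1) (if k == j.+1 :> nat then G j k else 0))); last first.
  by move=> j _; rewrite -big_split; apply: eq_bigr => k _; exact: E.
rewrite big_split /=; congr (_ + _).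
  rewrite exchange_big /= big_ord_recr /= (S (fun j => G j n)) ltnn addr0.
  by apply: eq_bigr => k _; rewrite (S (fun j => G j k)) /= ltnS ltn_ord.
rewrite big_ord_recr /= (S (fun k => G n k)) ltnn addr0.
by apply: eq_bigr => j _; rewrite (S (fun k => G j k)) /= ltnS ltn_ord.
Qed.

Lemma d_split x : B x -> d x = raise x + lower x.
Proof.
move=> Bx; rewrite [LHS](Psum (dB Bx)).
have E : d x = \sum_(k < n.+1) d (P k x).
  rewrite {1}[x](Psum Bx) (lin_on_sum lin_d) // => k; exact: PB.
rewrite E (eq_bigr (fun j : 'I_n.+1 => \sum_(k < n.+1) P j (d (P k x)))).
  by apply: (sum_adjacent (G := fun j k => P j (d (P k x)))) => j k jn kn h1 h2; exact: Pd.
by move=> j _; rewrite (lin_on_sum (lin_P (ord_le j))) // => k; exact/dB/PB.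
Qed.

Lemma twist_raise z x : B x -> twist z (raise x) = z *: raise (twist z x).
Proof.
move=> Bx; rewrite /raise (lin_on_sum (lin_twist z)); last first.
  by move=> k; apply: PB => //; apply/dB/PB.
rewrite scaler_sumr; apply: eq_bigr => k _.
have kn := ord_lt k; have kS := ltn_ord k.
rewrite twist_P //; last exact/dB/PB.
rewrite P_twist // (lin_onZ lin_d); last exact: PB.
by rewrite (lin_onZ (lin_P kS)) ?scalerA -?exprS //; exact/dB/PB.
Qed.

Lemma twist_lower z x : B x -> z *: twist z (lower x) = lower (twist z x).
Proof.
move=> Bx; rewrite /lower (lin_on_sum (lin_twist z)); last first.
  by move=> k; apply: PB => //; apply/dB/PB.
rewrite scaler_sumr; apply: eq_bigr => k _.
have kn := ord_lt k; have kS := ltn_ord k.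
rewrite twist_P //; last exact/dB/PB.
rewrite P_twist // (lin_onZ lin_d); last exact: PB.
by rewrite (lin_onZ (lin_P kn)) ?scalerA -?exprS //; exact/dB/PB.
Qed.

Lemma twist_twist z y x : B x -> twist z (twist y x) = twist (z * y) x.
Proof.
move=> Bx; rewrite {1}/twist; apply: eq_bigr => k _.
by rewrite P_twist // scalerA exprMn.
Qed.

Lemma twist1 x : B x -> twist 1 x = x.
Proof.
by move=> Bx; rewrite [RHS](Psum Bx); apply: eq_bigr => k _; rewrite expr1n scale1r.
Qed.

Lemma twistK z x : z != 0 -> B x -> twist z (twist z^-1 x) = x.
Proof. by move=> z0 Bx; rewrite twist_twist // mulfV // twist1. Qed.

(** For nonzero [z] this is the conjugate of [d] by [twist z]. It specialises to [d] at 1 and to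
    [dmix] at i. *)
Definition mix (z : C) x := z *: raise x + z^-1 *: lower x.

Lemma lin_mix z : lin_on (mix z).
Proof.
have [h1 h2] := lin_onZf z lin_raise; have [k1 k2] := lin_onZf z^-1 lin_lower.
split=> [x Bx|a x y Bx By]; first by apply: B_D; [exact: h1|exact: k1].
by rewrite /mix h2 // k2 // scalerDr addrACA.
Qed.

Lemma mix1 x : B x -> mix 1 x = d x.
Proof. by move=> Bx; rewrite /mix invr1 !scale1r d_split. Qed.

Lemma mix_twist y z x : z != 0 -> B x -> twist z (mix y x) = mix (y * z) (twist z x).
Proof.
move=> z0 Bx; have Br := lin_raise.1 x Bx; have Bl := lin_lower.1 x Bx.
rewrite /mix (lin_onD (lin_twist z)); [|exact: B_Z|exact: B_Z].
rewrite !(lin_onZ (lin_twist z)) // twist_raise // -twist_lower // !scalerA.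
by rewrite invfM -mulrA mulVf // mulr1.
Qed.

Lemma mix_mix z x : z != 0 -> B x -> mix z (mix z x) = 0.
Proof.
move=> z0 Bx; have Bt := (lin_twist z^-1).1 x Bx.
have E y : B y -> twist z (d y) = mix z (twist z y).
  by move=> By; rewrite -mix1 // mix_twist // mul1r.
rewrite -{1}[x](twistK z0 Bx) -E // -E; last exact: dB.
by rewrite dd // lin_on0 //; exact: lin_twist.
Qed.

Lemma mix_mixE y z x : B x -> mix y (mix z x) = (y * z) *: raise (raise x) +
  (y * z^-1) *: raise (lower x) + (y^-1 * z) *: lower (raise x) +
  (y^-1 * z^-1) *: lower (lower x).
Proof.
move=> Bx; have Br := lin_raise.1 x Bx; have Bl := lin_lower.1 x Bx.
rewrite {1}/mix /mix (lin_onD lin_raise); [|exact: B_Z|exact: B_Z].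
rewrite (lin_onD lin_lower); [|exact: B_Z|exact: B_Z].
rewrite !(lin_onZ lin_raise) // !(lin_onZ lin_lower) // !scalerDr !scalerA.
by rewrite !addrA.
Qed.

(* [mix z] squares to zero for every [z != 0], so the three coefficients of the Laurent
   polynomial [mix z (mix z x)] in [z] vanish. *)
Lemma squares_eq0 x : B x -> [/\ raise (raise x) = 0, lower (lower x) = 0 &
  raise (lower x) + lower (raise x) = 0].
Proof.
move=> Bx; set a := raise (raise x); set c := lower (lower x); set b := _ + _.
have E z : z != 0 -> (z * z) *: a + b + (z^-1 * z^-1) *: c = 0.
  move=> z0; have := mix_mix z0 Bx; rewrite (mix_mixE z z Bx) mulfV // mulVf // !scale1r.
  by rewrite -(addrA _ (raise _)).
have i0 : 'i%C != 0 :> C by rewrite neq0Ci.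
have n2 : (2 : C) != 0 by rewrite pnatr_eq0.
(* Three values of [z] suffice: 1 and i give b + (a + c) = 0 and b - (a + c) = 0, and 2 then
   separates [a] from [c], because 16 differs from 1. *)
have e1 : b + (a + c) = 0.
  by have := E 1 (oner_neq0 _); rewrite invr1 !mul1r !scale1r -addrA addrCA.
have e2 : b = a + c.
  apply: subr0_eq; have := E 'i%C i0.
  by rewrite -invfM -expr2 sqr_i invrN invr1 !scaleN1r -addrA addrCA -opprD.
have ac : a + c = 0.
  by move/eqP: e1; rewrite e2 -mulr2n -scaler_nat scaler_eq0 (negbTE n2) => /eqP.
have b0 : b = 0 by rewrite e2.
have ca : c = - a by apply/eqP; rewrite -addr_eq0 addrC ac.
have a0 : a = 0.
  have := E 2 n2; rewrite b0 addr0 ca scalerN -scalerBl => /eqP.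
  rewrite scaler_eq0 => /orP[|/eqP //].
  rewrite subr_eq0 => /eqP/(congr1 (fun t => t * (2 * 2))).
  rewrite -invfM mulVf ?mulf_neq0 // -!natrM => /eqP.
  by rewrite (eqr_nat C 16 1).
by rewrite a0 ca a0 oppr0.
Qed.

Definition dmix x := 'i%C *: (raise x - lower x).

Let i0 : 'i%C != 0 :> C. Proof. by rewrite neq0Ci. Qed.

Lemma dmixE x : dmix x = mix 'i%C x.
Proof. by rewrite /dmix /mix scalerBr invCi scaleNr. Qed.

Lemma lin_dmix : lin_on dmix.
Proof. by rewrite (funext dmixE); exact: lin_mix. Qed.

Lemma dmix_dmix x : B x -> dmix (dmix x) = 0.
Proof. by move=> Bx; rewrite !dmixE mix_mix. Qed.

Lemma d_dmix x : B x -> d (dmix x) = - dmix (d x).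
Proof.
move=> Bx; have [a0 c0 b0] := squares_eq0 Bx.
have Bm := (lin_mix 'i%C).1 x Bx.
rewrite -(mix1 Bx) !dmixE -(mix1 Bm) !mix_mixE // a0 c0 !scaler0 !add0r !addr0.
have ev : lower (raise x) = - raise (lower x) by apply/eqP; rewrite -addr_eq0 addrC b0.
by rewrite ev !scalerN -!scalerBl -scaleNr opprB invr1 !mul1r !mulr1.
Qed.

Lemma twist_d x : B x -> twist 'i%C (d x) = dmix (twist 'i%C x).
Proof. by move=> Bx; rewrite -(mix1 Bx) mix_twist // mul1r dmixE. Qed.

Lemma twist_dmix x : B x -> twist 'i%C (dmix x) = - d (twist 'i%C x).
Proof.
move=> Bx; rewrite dmixE mix_twist // -expr2 sqr_i.
have Bt := (lin_twist 'i%C).1 x Bx.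
by rewrite -(mix1 Bt) /mix invrN invr1 !scaleN1r !scale1r opprD.
Qed.

Definition ddmix_lemma : Prop :=
  [set d (dmix x) | x in B] = [set d x | x in B] `&` [set x | B x /\ dmix x = 0] /\
  [set d x | x in B] `&` [set x | B x /\ dmix x = 0] =
  [set x | B x /\ d x = 0] `&` [set dmix x | x in B].

Lemma ddmix_quasi_iso :
  ddmix_lemma <-> inclusion_quasi_iso d [set x | B x /\ dmix x = 0] B.
Proof.
have dmix0 : dmix 0 = 0 := lin_on0 lin_dmix.
have d0 : d 0 = 0 := lin_on0 lin_d.
have Bdm : forall x, B x -> B (dmix x) := lin_dmix.1.
have Bt : forall x, B x -> B (twist 'i%C x) := (lin_twist 'i%C).1.
have Bt' : forall x, B x -> B (twist 'i%C^-1 x) := (lin_twist _).1.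
have tK x : B x -> twist 'i%C (twist 'i%C^-1 x) = x := @twistK _ x i0.
have t'K x : B x -> twist 'i%C^-1 (twist 'i%C x) = x.
  by move=> Bx; rewrite twist_twist // mulVf // twist1.
have t0 z : twist z 0 = 0 := lin_on0 (lin_twist z).
have d_t' x : B x -> d (twist 'i%C^-1 x) = twist 'i%C^-1 (dmix x).
  move=> Bx; have := twist_d (Bt' x Bx); rewrite tK // => <-.
  by rewrite t'K //; exact/dB/Bt'.
have dmix_t' x : B x -> dmix (twist 'i%C^-1 x) = - twist 'i%C^-1 (d x).
  move=> Bx; rewrite -(t'K (dmix (twist 'i%C^-1 x))); last exact/Bdm/Bt'.
  rewrite twist_dmix ?tK //; last exact: Bt'.
  by rewrite (lin_onN (lin_twist _)) //; exact: dB.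
have KD x y : B x /\ dmix x = 0 -> B y /\ dmix y = 0 -> B (x + y) /\ dmix (x + y) = 0.
  move=> [Bx ex] [By ey]; split; first exact: B_D.
  by rewrite (lin_onD lin_dmix) // ex ey addr0.
have KN x : B x /\ dmix x = 0 -> B (- x) /\ dmix (- x) = 0.
  by move=> [Bx ex]; split; [exact: B_N|rewrite (lin_onN lin_dmix) // ex oppr0].
have qP := @quasi_isoP V d [set x | B x /\ dmix x = 0] B (fun x h => h.1) (conj B0 dmix0)
  KD KN B0 B_D B_N (lin_onD lin_d).
split=> [[E1 E2]|/qP[inj surj]].
  apply/qP; split=> [b [Bdb db] Bb _|a Ba da].
    have : ([set d x | x in B] `&` [set x | B x /\ dmix x = 0]) (d b).
      by split; [exists b|split].
    rewrite -E1 => -[e Be <-]; exists (dmix e) => //.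
    by split; [exact: Bdm|exact: dmix_dmix].
  have : ([set x | B x /\ d x = 0] `&` [set dmix x | x in B]) (dmix a).
    split; last by exists a.
    by split; [exact: Bdm|rewrite d_dmix // da dmix0 oppr0].
  rewrite -E2 -E1 => -[e Be ea].
  have Bde := dB Be.
  exists (a + d e), (- e); split.
  - split; first exact: B_D.
    by rewrite (lin_onD lin_dmix) // -ea d_dmix // addNr.
  - exact: B_N.
  - by rewrite (lin_onD lin_d) // da dd // addr0.
  - by rewrite (lin_onN lin_d) // addrK.
have E1 : [set d (dmix x) | x in B] = [set d x | x in B] `&` [set x | B x /\ dmix x = 0].
  apply/seteqP; split=> [_ [x Bx <-]|_ [[b Bb <-] [Bdb edb]]].
    have Bm := Bdm x Bx; split; first by exists (dmix x).
    split; first exact: dB.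
    by have := d_dmix Bm; rewrite dmix_dmix // d0 => /esym/eqP; rewrite oppr_eq0 => /eqP.
  have [c [Bc ec] ->] := inj b (conj Bdb edb) Bb (dd Bb).
  have [|x' [e [[Bx' ex'] Be dx' ex]]] := surj (twist 'i%C^-1 c) (Bt' c Bc).
    by rewrite d_t' // ec t0.
  exists (twist 'i%C e); first exact: Bt.
  have -> : c = twist 'i%C x' + dmix (twist 'i%C e).
    by rewrite -[LHS]tK // ex (lin_onD (lin_twist _)) ?twist_d //; exact: dB.
  rewrite (lin_onD lin_d); [|exact: Bt|exact/Bdm/Bt].
  by rewrite -[d (twist _ x')]opprK -twist_dmix // ex' t0 oppr0 add0r.
split; first exact: E1.
apply/seteqP; split=> [a|a [[Ba da] [b Bb eb]]].
  rewrite -E1 => -[e Be <-]; split; first by split; [exact/dB/Bdm|exact/dd/Bdm].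
  exists (- d e); first exact/B_N/dB.
  by rewrite (lin_onN lin_dmix) ?d_dmix //; exact: dB.
subst a.
have Bt'b := Bt' b Bb.
(* The first equality is applied to the inverse twist of [dmix b]: it is exact by this identity, and
   killed by [dmix] because [dmix b] is closed. Twisting back gives the preimage. *)
have ex : twist 'i%C^-1 (dmix b) = d (twist 'i%C^-1 b) by rewrite d_t'.
have : [set d (dmix x) | x in B] (twist 'i%C^-1 (dmix b)).
  rewrite E1; split; first by exists (twist 'i%C^-1 b).
  by split; [exact: Bt'|rewrite dmix_t' // da t0 oppr0].
move=> [e Be ee]; split; last by split=> //; exact: dmix_dmix.
exists (dmix (twist 'i%C e)); first exact/Bdm/Bt.
have Bm := Bdm e Be.
rewrite -(tK (dmix b)) // -ee twist_d // twist_dmix // (lin_onN lin_dmix) ?d_dmix //.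
  exact: Bt.
exact/dB/Bt.
Qed.

End Graded.

(** * Spinor decomposition of basic forms *)

Section DelSpart.
Variables (R : realType) (m : nat) (N : manifold R m) (O : set N) (J : N -> 'M[R]_(m + m)).
Hypotheses (oO : open O) (hJ : gen_complex O J).
Variable w : N -> seq 'rV[R]_m -> R[i].
Hypothesis sw : smooth_form O w.

(** The inner projection is differentiated, so it is replaced on the whole open set and not only at
    [p]. *)
Lemma spin_proj_ext_d j k p : (j <= m)%N -> (k <= m)%N -> O p ->
  spin_proj (J p) j (ext_d (fun x => spin_proj (J x) k (w x)) p) =
  spart (J p) j (ext_d (fun x => spart (J x) k (w x)) p).
Proof.
move=> jm km Op.
have E : ext_d (fun x => spin_proj (J x) k (w x)) p = ext_d (fun x => spart (J x) k (w x)) p.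
  apply: (ext_d_form_eq oO Op) => q Oq.
  exact: (spin_projE (gen_square hJ Oq) (gen_orth hJ Oq) (sw.1 q Oq) km).
rewrite E; apply: (spin_projE (gen_square hJ Op) (gen_orth hJ Op) _ jm).
exact: (smooth_ext_d oO (smooth_spart oO hJ sw km)).1.
Qed.

Lemma delE p : O p -> del J w p =
  \sum_(k < m) spart (J p) k (ext_d (fun x => spart (J x) k.+1 (w x)) p).
Proof.
move=> Op; apply/funext => s; rewrite /del alt_sumE; apply: eq_bigr => k _.
exact: (congr1 (fun a => a s) (spin_proj_ext_d (ltnW (ltn_ord k)) (ltn_ord k) Op)).
Qed.

Lemma delbarE p : O p -> delbar J w p =
  \sum_(k < m) spart (J p) k.+1 (ext_d (fun x => spart (J x) k (w x)) p).
Proof.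
move=> Op; apply/funext => s; rewrite /delbar alt_sumE; apply: eq_bigr => k _.
exact: (congr1 (fun a => a s) (spin_proj_ext_d (ltn_ord k) (ltnW (ltn_ord k)) Op)).
Qed.

End DelSpart.

Section BasicSpin.
Variables (R : realType) (m l : nat) (M : manifold R (m + l)) (F : foliation M).
Variable J : fol_I F -> fol_T0 F -> 'M[R]_(m + m).
Hypothesis hJ : transverse_gen_complex J.
Notation C := R[i].
Notation form := (M -> seq 'rV[R]_(m + l) -> C).
Notation family := (fol_I F -> fol_T0 F -> seq 'rV[R]_m -> C).
Implicit Types (i j : fol_I F) (w : family) (b : form) (p : M).

Let oT i : open (transversal i) := transversal_open (F := F) i.

Lemma consistent0 : consistent (fun (_ : fol_I F) _ => 0 : seq 'rV[R]_m -> C).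
Proof. by split=> [i|i j p _ _]; [exact: smooth_form0|]. Qed.

Lemma consistent_lin (a : C) w w' : consistent w -> consistent w' ->
  consistent (fun i y => a *: w i y + w' i y).
Proof.
move=> [h1 h2] [k1 k2]; split=> [i|i j p Vi Vj].
  apply: (smooth_formD (oT i) _ (k1 i)); exact: (smooth_formZ a (oT i) (h1 i)).
have e1 := h2 i j p Vi Vj; have e2 := k2 i j p Vi Vj.
apply: etrans (_ : a *: mpull (fol_f i) (w i) p + mpull (fol_f i) (w' i) p = _); first by [].
by rewrite e1 e2.
Qed.

Lemma to_basic_sum (I : Type) (r : seq I) (g : I -> family) :
  to_basic (F := F) (fun i y => \sum_(k <- r) g k i y) = \sum_(k <- r) to_basic (g k).
Proof.
apply/funext => p; rewrite fct_sumE /to_basic; exact: pull_sum.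
Qed.

Definition family_spart k w : family := fun i y => spart (J i y) k (w i y).

(** Only the generators of the pseudogroup enter: [J] is invariant under them, and the projections
    are equivariant. *)
Lemma consistent_spart k w : consistent w -> (k <= m)%N -> consistent (family_spart k w).
Proof.
move=> hw km; split=> [i|i j p Vi Vj]; first exact: (smooth_spart (oT i) (hJ.1 i) (hw.1 i) km).
have ne : fol_V i `&` fol_V j !=set0 by exists p.
have Oy : (fol_f i @` (fol_V i `&` fol_V j)) (fol_f i p) by exists p.
have Ti := mem_transversal Vi; have Tj := mem_transversal Vj.
have JA := hJ.2 _ _ _ _ (hol_gen ne) _ Oy.
have gE := fol_gammaE Vi Vj.
have u := tangent_gamma_unit Vi Vj.
have Tj' : transversal j (fol_gamma i j (fol_f i p)) by rewrite -gE.
have E := spart_pull u JA (gen_square (hJ.1 i) Ti) (gen_orth (hJ.1 i) Ti)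
  (gen_square (hJ.1 j) Tj') (gen_orth (hJ.1 j) Tj') ((hw.1 j).1 _ Tj') km.
apply/esym; rewrite /mpull (tangent_gamma Vi Vj).
apply: etrans (esym (pull_pull _ _ _)) _; congr (pull_alt _ _).
rewrite gE; apply: etrans (esym E) _.
exact: (congr1 (spart (J i (fol_f i p)) k) (consistent_gamma hw Vi Vj)).
Qed.

Definition basic_spart k b : form := to_basic (family_spart k (of_basic (F := F) b)).

(** A consistent family is determined on the transversals by its basic form, so the family chosen by
    [of_basic] may be replaced by any other. All properties of [basic_spart] are reduced to
    pointwise ones in this way. *)
Lemma basic_spartE k w : consistent w -> (k <= m)%N ->
  basic_spart k (to_basic w) = to_basic (family_spart k w).
Proof.
move=> hw km; apply: to_basic_eq => i y Ty; congr (spart _ _ _).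
have [hw' e] := of_basicP (basic_to_basic hw).
exact: (to_basic_inj hw' hw e).
Qed.

Lemma basicP b : basic F b -> exists2 w, consistent w & b = to_basic (F := F) w.
Proof. by move=> /of_basicP[hw e]; exists (of_basic (F := F) b). Qed.

Lemma spart_lin k (K : 'M[R]_(m + m)) (a : C) x y :
  spart K k (a *: x + y) = a *: spart K k x + spart K k y.
Proof. by rewrite spartD spartZ. Qed.

Let B := basic F.

Let B0 : B 0.
Proof. exact: (basic_to_basic consistent0). Qed.

Let B_lin (a : C) x y : B x -> B y -> B (a *: x + y).
Proof.
move=> /basicP[w hw ->] /basicP[w' hw' ->].
exact: (basic_to_basic (consistent_lin a hw hw')).
Qed.

Let dB x : B x -> B (ext_d x).
Proof.
move=> /basicP[w hw ->]; rewrite ext_d_to_basic //.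
exact/basic_to_basic/consistent_ext_d.
Qed.

Let d_lin (a : C) x y : B x -> B y -> ext_d (a *: x + y) = a *: ext_d x + ext_d y.
Proof.
move=> [sx _] [sy _]; apply/funext => p.
have oM : open [set: M] := openT.
have Ip : [set: M] p by [].
have e1 := ext_dD_form Ip (smooth_formZ a oM sx) sy.
have e2 := congr1 (fun z => z + ext_d y p) (ext_dZ_form Ip a sx).
exact: etrans e1 e2.
Qed.

Let dd x : B x -> ext_d (ext_d x) = 0.
Proof. by move=> [sx _]; apply/funext => p; exact: (@ext_d_ext_d_form _ _ _ setT x p openT sx I). Qed.

Let PB k x : (k <= m)%N -> B x -> B (basic_spart k x).
Proof.
move=> km /basicP[w hw ->]; rewrite basic_spartE //.
exact/basic_to_basic/consistent_spart.
Qed.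

Let P_lin k (a : C) x y : (k <= m)%N -> B x -> B y ->
  basic_spart k (a *: x + y) = a *: basic_spart k x + basic_spart k y.
Proof.
move=> km /basicP[w hw ->] /basicP[w' hw' ->].
apply: etrans (basic_spartE (consistent_lin a hw hw') km) _.
apply: etrans _ (esym (congr2 (fun u v => a *: u + v) (basic_spartE hw km) (basic_spartE hw' km))).
apply: (to_basic_eq (w' := fun i y => a *: family_spart k w i y + family_spart k w' i y)).
by move=> i z Tz; exact: spart_lin.
Qed.

Let PP (j k : nat) x : (j <= m)%N -> (k <= m)%N -> B x ->
  basic_spart j (basic_spart k x) = if k == j then basic_spart k x else 0.
Proof.
move=> jm km /basicP[w hw ->]; have hs := consistent_spart hw km.
rewrite (basic_spartE hw km) (basic_spartE hs jm).
have E i y : transversal i y -> spart (J i y) j (spart (J i y) k (w i y)) =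
    if k == j then spart (J i y) k (w i y) else 0.
  move=> Ty; exact: (spart_spart (gen_square (hJ.1 i) Ty) (gen_orth (hJ.1 i) Ty) _
    ((hw.1 i).1 _ Ty) km).
case: (k == j) E => E; first exact: to_basic_eq.
exact: (to_basic_eq (w' := fun _ _ => 0) E).
Qed.

Let Psum x : B x -> x = \sum_(k < m.+1) basic_spart k x.
Proof.
move=> /basicP[w hw ->].
rewrite (eq_bigr (fun k : 'I_m.+1 => to_basic (family_spart k w))); last first.
  by move=> k _; apply: basic_spartE => //; rewrite -ltnS.
rewrite -to_basic_sum; apply: to_basic_eq => i y Ty.
exact: (spart_total (gen_square (hJ.1 i) Ty) (gen_orth (hJ.1 i) Ty) ((hw.1 i).1 _ Ty)).
Qed.

Let ext_d_spart (j k : nat) w : consistent w -> (j <= m)%N -> (k <= m)%N ->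
  basic_spart j (ext_d (basic_spart k (to_basic w))) =
  to_basic (family_spart j (fun i => ext_d (family_spart k w i))).
Proof.
move=> hw jm km; have hs := consistent_spart hw km.
rewrite (basic_spartE hw km) (ext_d_to_basic hs).
exact: (basic_spartE (consistent_ext_d hs) jm).
Qed.

Let Pd (j k : nat) x : (j <= m)%N -> (k <= m)%N -> j != k.+1 -> k != j.+1 -> B x ->
  basic_spart j (ext_d (basic_spart k x)) = 0.
Proof.
move=> jm km h1 h2 /basicP[w hw ->]; rewrite (ext_d_spart hw jm km).
apply: (to_basic_eq (w' := fun _ _ => 0)) => i y Ty.
exact: (spart_ext_d_form (oT i) (hJ.1 i) (hw.1 i) km jm h1 h2 Ty).
Qed.

(** [dJ] works with families on the transversals and [dmix] with basic forms; the comparison is made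
    componentwise, [raise] matching [delbar] and [lower] matching [del]. *)
Lemma dJE b : basic F b -> dJ J b = dmix (@ext_d R _ M) m basic_spart b.
Proof.
move=> hb; have [hw e] := of_basicP hb.
set w := of_basic b in hw e *.
pose up (k : 'I_m) := family_spart k.+1 (fun i => ext_d (family_spart k w i)).
pose dn (k : 'I_m) := family_spart k (fun i => ext_d (family_spart k.+1 w i)).
have Eu : raise (@ext_d R _ M) m basic_spart b =
    to_basic (F := F) (fun i y => \sum_k up k i y).
  apply: etrans _ (esym (to_basic_sum _ up)); apply: eq_bigr => k _; rewrite -e.
  exact: (ext_d_spart hw (ltn_ord k) (ltnW (ltn_ord k))).
have Ed : lower (@ext_d R _ M) m basic_spart b =
    to_basic (F := F) (fun i y => \sum_k dn k i y).
  apply: etrans _ (esym (to_basic_sum _ dn)); apply: eq_bigr => k _; rewrite -e.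
  exact: (ext_d_spart hw (ltnW (ltn_ord k)) (ltn_ord k)).
apply: etrans _ (esym (congr2 (fun u v => 'i%C *: (u - v)) Eu Ed)).
apply: (to_basic_eq (w' := fun i y => 'i%C *: (\sum_k up k i y - \sum_k dn k i y))).
move=> i y Ty; apply/funext => s.
have E1 := congr1 (fun a => a s) (delbarE (oT i) (hJ.1 i) (hw.1 i) Ty).
have E2 := congr1 (fun a => a s) (delE (oT i) (hJ.1 i) (hw.1 i) Ty).
exact: (congr2 (fun a c => 'i%C * (a - c)) E1 E2).
Qed.

Lemma ddJ_lemmaE :
  ddJ_lemma J <-> ddmix_lemma (basic F) (@ext_d R _ M) m basic_spart.
Proof.
have E1 : [set ext_d (dJ J w) | w in basic F] =
    [set ext_d (dmix (@ext_d R _ M) m basic_spart w) | w in basic F].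
  by apply: eq_imagel => b hb; rewrite dJE.
have E2 : [set dJ J w | w in basic F] =
    [set dmix (@ext_d R _ M) m basic_spart w | w in basic F].
  by apply: eq_imagel => b hb; rewrite dJE.
have E3 : ker_dJ J = [set b | basic F b /\ dmix (@ext_d R _ M) m basic_spart b = 0].
  by apply/seteqP; split=> b [hb e]; split=> //; move: e; rewrite dJE.
by rewrite /ddJ_lemma E1 E2 E3.
Qed.

Lemma ddJ_lemma_quasi_iso :
  ddJ_lemma J <-> inclusion_quasi_iso (@ext_d R _ M) (ker_dJ J) (basic F).
Proof.
have E3 : ker_dJ J = [set b | basic F b /\ dmix (@ext_d R _ M) m basic_spart b = 0].
  by apply/seteqP; split=> b [hb e]; split=> //; move: e; rewrite dJE.
have H := @ddmix_quasi_iso R _ (basic F) (@ext_d R _ M) m basic_spart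
  B0 B_lin dB d_lin dd PB P_lin PP Psum Pd.
rewrite E3; apply: iff_trans H; exact: ddJ_lemmaE.
Qed.

End BasicSpin.

Theorem theorem4p1 (R : realType) (q l : nat) (M : manifold R (2 * q + l))
    (F : foliation M)
    (J : fol_I F -> fol_T0 F -> 'M[R]_(2 * q + 2 * q))
    (hJ : transverse_gen_complex J) :
  ddJ_lemma J <-> inclusion_quasi_iso (@ext_d R _ M) (ker_dJ J) (basic F).
Proof. exact: ddJ_lemma_quasi_iso. Qed.
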